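(* Let $\overline{M}$ be a smooth manifold of dimension $n+1$ with boundary $\partial M$ and interior $M$. Let $g=g_{ij}$ be a pseudo-Riemannian metric on $M$ with Levi-Civita connection $\nabla$ and scalar curvature $S$, which has the following properties. (i) The projective structure on $M$ defined by $\nabla$ admits a smooth extension to $\overline{M}$. (Under this condition the function $S$ always admits a smooth extension to $\overline{M}$.) (ii) The connection $\nabla$ itself does not admit a smooth extension to any neighborhood of a boundary point. (iii) The scalar curvature $S$ of $g$ is bounded away from zero on $M$ or, more generally, the boundary value on $\partial M$ of the smooth extension of $S$ to $\overline{M}$ is nowhere vanishing. Then $g$ is projectively compact of order $\alpha=2$.
   Context: Projective equivalence: two torsion-free linear connections $\nabla,\hat\nabla$ on the tangent bundle of a smooth manifold $N$ are projectively equivalent if there is a one-form $\Upsilon\in\Omega^1(N)$ such that $\hat\nabla_\xi\eta=\nabla_\xi\eta+\Upsilon(\xi)\eta+\Upsilon(\eta)\xi$ for all vector fields $\xi,\eta$ on $N$ (equivalently, they have the same geodesics up to parametrization). A projective structure is a projective equivalence class of such connections. Extension of the projective structure: for a torsion-free linear connection $\nabla$ on $TM$, the projective structure determined by $\nabla$ admits a smooth extension to $\overline{M}$ if for every $x\in\partial M$ there is an open neighborhood $U$ of $x$ in $\overline{M}$ and a one-form $\Upsilon\in\Omega^1(U\cap M)$ such that for all vector fields $\xi,\eta\in\mathfrak{X}(U)$ (smooth up to the boundary), the vector field $\hat\nabla_\xi\eta=\nabla_\xi\eta+\Upsilon(\xi)\eta+\Upsilon(\eta)\xi$ on $U\cap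 M$ admits a smooth extension to all of $U$. Local defining function: for $U\subset\overline{M}$ open, a smooth function $r:U\to\mathbb{R}_{\geq 0}$ such that $r^{-1}(\{0\})=U\cap\partial M$ and $dr$ is nowhere vanishing on $U\cap\partial M$. Projective compactness: for a constant $\alpha>0$, the connection $\nabla$ is projectively compact of order $\alpha$ if for each $x\in\partial M$ there are an open neighborhood $U$ of $x$ in $\overline{M}$ and a local defining function $r:U\to\mathbb{R}_{\ge 0}$ for the boundary such that the condition in the definition of extension of the projective structure holds with $\Upsilon=\frac{dr}{\alpha r}$. A pseudo-Riemannian metric $g$ on $M$ is projectively compact of order $\alpha$ if its Levi-Civita connection is. *)

(* Defs.v *)
From HB Require Import structures.
From mathcomp Require Export all_boot all_order all_algebra.
From mathcomp Require Export all_classical all_reals all_analysis.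
Export numFieldNormedType.Exports.
Import Order.TTheory GRing.Theory Num.Theory.

Set Implicit Arguments.
Unset Strict Implicit.
Unset Printing Implicit Defensive.

Local Open Scope classical_set_scope.
Local Open Scope ring_scope.

(* Charts take values in the half-space {x_0 >= 0}; the dimension is written
   n.+1, which is also what makes the coordinate x_0 available. *)
Definition halfspace (R : realType) (n : nat) : set 'rV[R]_n.+1 :=
  [set x | 0 <= x 0 0].
Arguments halfspace R n : clear implicits.

Fixpoint Ck (R : realType) (n k : nat) (W : set 'rV[R]_n.+1)
    (f : 'rV[R]_n.+1 -> R) : Prop :=
  (forall x, W x -> {for x, continuous f}) /\
  if k is l.+1 then
    forall i : 'I_n.+1,
      (forall x, W x -> derivable f x 'e_i) /\ Ck l W (fun x => 'D_'e_i f x)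
  else True.

Definition smooth_open (R : realType) (n : nat) (W : set 'rV[R]_n.+1)
    (f : 'rV[R]_n.+1 -> R) : Prop :=
  forall k, Ck k W f.

(* Smoothness on an arbitrary set A, used for relatively open subsets of the
   half-space: f extends smoothly to a neighbourhood of each point of A. *)
Definition smooth_on (R : realType) (n : nat) (A : set 'rV[R]_n.+1)
    (f : 'rV[R]_n.+1 -> R) : Prop :=
  forall x, A x -> exists (W : set 'rV[R]_n.+1) (g : 'rV[R]_n.+1 -> R),
    [/\ open W, W x, smooth_open W g & forall y, W y -> A y -> g y = f y].

(* The partial derivative, as a derivative from the right: it only looks at f on
   the half-space (x + t e_i stays there for x in it and t > 0), and for f smooth
   on a relatively open subset of the half-space it is the usual partial
   derivative of f, i.e. that of any local smooth extension of f. *)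
Definition pd (R : realType) (n : nat) (i : 'I_n.+1) (f : 'rV[R]_n.+1 -> R)
    (x : 'rV[R]_n.+1) : R :=
  lim ((t^-1 * (f (x + t *: 'e_i) - f x)) @[t --> (0 : R)^'+]).

Record bchart (R : realType) (n : nat) (T : topologicalType) := BChart {
  dom : set T;
  coord :> T -> 'rV[R]_n.+1;
  point_at : 'rV[R]_n.+1 -> T;
  dom_open : open dom;
  coord_img : exists2 V, open V & coord @` dom = V `&` halfspace R n;
  coordK : {in dom, cancel coord point_at};
  coord_cont : {within dom, continuous coord};
  point_at_cont : {within coord @` dom, continuous point_at} }.

Definition transition (R : realType) (n : nat) (T : topologicalType)
    (c d : bchart R n T) (x : 'rV[R]_n.+1) : 'rV[R]_n.+1 :=
  d (point_at c x).

Record bmanifold (R : realType) (n : nat) := BManifold {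
  carrier :> topologicalType;
  bm_hausdorff : hausdorff_space carrier;
  bm_second_countable : @second_countable carrier;
  chart_index : Type;
  chart : chart_index -> bchart R n carrier;
  chart_cover : forall p, exists a, dom (chart a) p;
  chart_compat : forall a b (j : 'I_n.+1),
    smooth_on (chart a @` (dom (chart a) `&` dom (chart b)))
      (fun x => transition (chart a) (chart b) x 0 j) }.

Definition boundary (R : realType) (n : nat) (N : bmanifold R n) : set N :=
  [set p | exists a, dom (chart a) p /\ chart a p 0 0 = 0].
Arguments boundary {R n} N.

(* Named inner to avoid a clash with the topological interior. *)
Definition inner (R : realType) (n : nat) (N : bmanifold R n) : set N :=
  ~` boundary N.
Arguments inner {R n} N.

Definition img (R : realType) (n : nat) (N : bmanifold R n) (U : set N)
    (a : chart_index N) : set 'rV[R]_n.+1 :=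
  chart a @` (U `&` dom (chart a)).

Definition in_chart (R : realType) (n : nat) (N : bmanifold R n) (f : N -> R)
    (a : chart_index N) : 'rV[R]_n.+1 -> R :=
  fun x => f (point_at (chart a) x).

Definition smooth_fun (R : realType) (n : nat) (N : bmanifold R n) (U : set N)
    (f : N -> R) : Prop :=
  forall a, smooth_on (img U a) (in_chart f a).

(* (jac a b x) i j = d y_j / d x_i for the change of coordinates y from chart a
   to chart b. *)
Definition jac (R : realType) (n : nat) (N : bmanifold R n)
    (a b : chart_index N) (x : 'rV[R]_n.+1) : 'M[R]_n.+1 :=
  \matrix_(i, j) pd i (fun y => transition (chart a) (chart b) y 0 j) x.

(* Tensor fields and connections on an open set U are given by their components
   in every chart, as functions of the coordinates, subject to the usual
   transformation laws.  The values of a component off img U a are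
   irrelevant. *)
Record vector_field (R : realType) (n : nat) (N : bmanifold R n) (U : set N) :=
  VectorField {
  vf :> chart_index N -> 'rV[R]_n.+1 -> 'rV[R]_n.+1;
  vf_smooth : forall a i, smooth_on (img U a) (fun x => vf a x 0 i);
  vf_law : forall a b p, U p -> dom (chart a) p -> dom (chart b) p ->
    vf b (chart b p) =
      vf a (chart a p) *m jac a b (chart a p) }.

Record one_form (R : realType) (n : nat) (N : bmanifold R n) (U : set N) :=
  OneForm {
  of_comp :> chart_index N -> 'rV[R]_n.+1 -> 'rV[R]_n.+1;
  of_smooth : forall a i, smooth_on (img U a) (fun x => of_comp a x 0 i);
  of_law : forall a b p, U p -> dom (chart a) p -> dom (chart b) p ->
    of_comp a (chart a p) =
      of_comp b (chart b p) *m (jac a b (chart a p))^T }.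

Record metric (R : realType) (n : nat) (N : bmanifold R n) := Metric {
  gm :> chart_index N -> 'rV[R]_n.+1 -> 'M[R]_n.+1;
  gm_smooth : forall a i j,
    smooth_on (img (inner N) a) (fun x => gm a x i j);
  gm_sym : forall a x, img (inner N) a x -> (gm a x)^T = gm a x;
  gm_nondeg : forall a x, img (inner N) a x -> gm a x \in unitmx;
  gm_law : forall a b p, inner N p ->
    dom (chart a) p -> dom (chart b) p ->
    gm a (chart a p) =
      jac a b (chart a p) *m gm b (chart b p) *m
        (jac a b (chart a p))^T }.

(* Linear connections on the tangent bundle of the interior, by their
   Christoffel symbols: nabla_(d_i) d_j = \sum_k (cn a i j k) d_k in chart a. *)
Record connection (R : realType) (n : nat) (N : bmanifold R n) := Connection {
  cn :> chart_index N -> 'I_n.+1 -> 'I_n.+1 -> 'I_n.+1 -> 'rV[R]_n.+1 -> R;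
  cn_smooth : forall a i j k, smooth_on (img (inner N) a) (cn a i j k);
  cn_law : forall a b p, inner N p ->
    dom (chart a) p -> dom (chart b) p ->
    let x := chart a p in
    let J := jac a b x in
    forall i j l : 'I_n.+1,
      \sum_k cn a i j k x * J k l =
        pd i (pd j (fun y => transition (chart a) (chart b) y 0 l)) x +
        \sum_s \sum_t J i s * J j t * cn b s t l (chart b p) }.

Definition torsion_free (R : realType) (n : nat) (N : bmanifold R n)
    (nabla : connection N) : Prop :=
  forall a x, img (inner N) a x ->
    forall i j k : 'I_n.+1, nabla a i j k x = nabla a j i k x.

Definition metric_compatible (R : realType) (n : nat) (N : bmanifold R n)
    (g : metric N) (nabla : connection N) : Prop :=
  forall a x, img (inner N) a x ->
    forall i j k : 'I_n.+1,
      pd k (fun y => g a y i j) x =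
        \sum_l (nabla a k i l x * g a x l j + nabla a k j l x * g a x i l).

Definition levi_civita (R : realType) (n : nat) (N : bmanifold R n)
    (g : metric N) (nabla : connection N) : Prop :=
  torsion_free nabla /\ metric_compatible g nabla.

(* R(d_i, d_j) d_l = \sum_k (riemann nabla a i j l k) d_k, where
   R(X, Y) = [nabla_X, nabla_Y] - nabla_[X, Y]. *)
Definition riemann (R : realType) (n : nat) (N : bmanifold R n)
    (nabla : connection N) (a : chart_index N) (i j l k : 'I_n.+1)
    (x : 'rV[R]_n.+1) : R :=
  pd i (nabla a j l k) x - pd j (nabla a i l k) x +
  \sum_s (nabla a i s k x * nabla a j l s x -
          nabla a j s k x * nabla a i l s x).

Definition ricci (R : realType) (n : nat) (N : bmanifold R n)
    (nabla : connection N) (a : chart_index N) (j l : 'I_n.+1)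
    (x : 'rV[R]_n.+1) : R :=
  \sum_k riemann nabla a k j l k x.

Definition scalar_curvature (R : realType) (n : nat) (N : bmanifold R n)
    (g : metric N) (nabla : connection N) (a : chart_index N)
    (x : 'rV[R]_n.+1) : R :=
  \sum_j \sum_l invmx (g a x) j l * ricci nabla a j l x.

Definition covariant (R : realType) (n : nat) (N : bmanifold R n)
    (nabla : connection N) (U : set N) (xi eta : vector_field U)
    (a : chart_index N) (x : 'rV[R]_n.+1) : 'rV[R]_n.+1 :=
  \row_k (\sum_i xi a x 0 i * pd i (fun y => eta a y 0 k) x +
          \sum_i \sum_j nabla a i j k x * xi a x 0 i * eta a x 0 j).

Definition pairing (R : realType) (n : nat) (w v : 'rV[R]_n.+1) : R :=
  \sum_i w 0 i * v 0 i.

Definition proj_covariant (R : realType) (n : nat) (N : bmanifold R n)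
    (nabla : connection N)
    (Upsilon : chart_index N -> 'rV[R]_n.+1 -> 'rV[R]_n.+1)
    (U : set N) (xi eta : vector_field U)
    (a : chart_index N) (x : 'rV[R]_n.+1) : 'rV[R]_n.+1 :=
  covariant nabla xi eta a x + pairing (Upsilon a x) (xi a x) *: eta a x
    + pairing (Upsilon a x) (eta a x) *: xi a x.

Definition extends_with (R : realType) (n : nat) (N : bmanifold R n)
    (nabla : connection N) (U : set N)
    (Upsilon : chart_index N -> 'rV[R]_n.+1 -> 'rV[R]_n.+1) : Prop :=
  forall xi eta : vector_field U, exists zeta : vector_field U,
    forall a x, img (U `&` inner N) a x ->
      zeta a x = proj_covariant nabla Upsilon xi eta a x.

Definition projective_structure_extends (R : realType) (n : nat)
    (N : bmanifold R n) (nabla : connection N) : Prop :=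
  forall p, boundary N p -> exists U : set N, [/\ open U, U p &
    exists Upsilon : one_form (U `&` inner N), extends_with nabla U Upsilon].

Definition connection_extends (R : realType) (n : nat) (N : bmanifold R n)
    (nabla : connection N) (U : set N) : Prop :=
  forall xi eta : vector_field U, exists zeta : vector_field U,
    forall a x, img (U `&` inner N) a x ->
      zeta a x = covariant nabla xi eta a x.

Definition differential (R : realType) (n : nat) (N : bmanifold R n)
    (r : N -> R) (a : chart_index N) (x : 'rV[R]_n.+1) : 'rV[R]_n.+1 :=
  \row_i pd i (in_chart r a) x.

Definition local_defining_function (R : realType) (n : nat) (N : bmanifold R n)
    (U : set N) (r : N -> R) : Prop :=
  [/\ smooth_fun U r,
      forall p, U p -> 0 <= r p,
      forall p, U p -> (r p = 0 <-> boundary N p) &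
      forall a x, img (U `&` boundary N) a x -> differential r a x <> 0].

Definition projectively_compact (R : realType) (n : nat) (N : bmanifold R n)
    (alpha : R) (nabla : connection N) : Prop :=
  forall p, boundary N p -> exists (U : set N) (r : N -> R),
    [/\ open U, U p, local_defining_function U r &
      extends_with nabla U
        (fun a x => (alpha * in_chart r a x)^-1 *: differential r a x)].

Definition metric_projectively_compact (R : realType) (n : nat)
    (N : bmanifold R n) (alpha : R) (g : metric N) : Prop :=
  exists nabla : connection N,
    levi_civita g nabla /\ projectively_compact alpha nabla.

Definition scalar_curvature_extension (R : realType) (n : nat)
    (N : bmanifold R n) (g : metric N) (nabla : connection N) (S : N -> R) :
    Prop :=
  smooth_fun [set: N] S /\
  forall a x, img (inner N) a x ->
    in_chart S a x = scalar_curvature g nabla a x.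

(* Main.v *)
(* In terms of the trace-free part P of the Christoffel symbols, rho = |det g|^(-1/(n+2)),
   sigma = rho^-1 g^-1 and U = d rho / (2 rho), compatibility of g reads
     d_k sigma^ij + P_kl^i sigma^lj + P_kl^j sigma^il = delta_k^i mu^j + delta_k^j mu^i,
   with mu^i = sigma^ij U_j, and nabla = P - U.  By hypothesis P is smooth up to the boundary.
   Commuting second derivatives prolongs this equation to a closed linear system for sigma,
   mu and d_0 mu^0, with coefficients smooth across the boundary; solving it along the lines
   normal to the boundary extends sigma smoothly.  Hence mu and rho = |det sigma| extend, and
   so does the scalar curvature, which is polynomial in P, sigma, mu, rho and their
   derivatives, every term containing rho or d rho.  If rho were nonzero at a boundary point,
   U would be smooth there and nabla would extend; so rho vanishes on the boundary, and
   d rho <> 0 there since otherwise the scalar curvature would vanish.  Thus rho is a defining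
   function, and adding d rho / (2 rho) to nabla gives the smooth P. *)
From HB Require Import structures.
From mathcomp Require Import perm ring lra zify.
Require Import Defs.
Import Order.TTheory GRing.Theory Num.Theory.
Set Implicit Arguments.
Unset Strict Implicit.
Unset Printing Implicit Defensive.
Local Open Scope classical_set_scope.
Local Open Scope ring_scope.

(** * Functions of class C^k *)

Section Ck_theory.
Context {R : realType} {n : nat}.
Local Notation E := 'rV[R]_n.+1.
Implicit Types (W : set E) (f g : E -> R) (k : nat).

(** The obstacle is that nothing is assumed about the growth of [g] at the boundary: [sigma] might a
    priori blow up there. A linear equation with coefficients smooth on a full neighbourhood
    excludes this: started from an interior slice [x_0 = t0 > 0] and solved on a cube crossing the
    boundary, it has a solution which uniqueness identifies with [sigma] where [x_0 > 0]. So the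
    system has to close only in the direction [e_0], and the trace-free symbols must first be
    extended beyond the half-space. The one-form of the hypothesis has no known relation to
    [dr / 2r]; passing to the trace-free part eliminates it. The exponent [-1/(n+2)], in dimension
    [n+1], is the one for which [det sigma = +-rho], so the defining function is polynomial in the
    extended [sigma]; [alpha = 2] is the factor in [d rho = 2 rho U]. Closing the system takes a
    second coordinate direction; in dimension one there is none, but there the scalar curvature is
    zero, which the curvature hypothesis excludes once there is a boundary point. Curvature is given
    chart by chart, so its independence of the chart is proved before boundary values are glued. *)

Lemma Ck_sub k W W' f : W' `<=` W -> Ck k W f -> Ck k W' f.
Proof.
elim: k f => [|k IH] f sW /= [cf df]; split=> //; first by move=> x /sW/cf.
- by move=> x /sW/cf.
- by move=> i; have [d1 d2] := df i; split; [move=> x /sW/d1|exact: IH].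
Qed.

Lemma open_nearW W x (P : E -> Prop) : open W -> W x -> (forall y, W y -> P y) ->
  \forall y \near x, P y.
Proof. by move=> oW Wx WP; apply: filterS (open_nbhs_nbhs (conj oW Wx)). Qed.

Lemma continuous_eq_at W f g x : open W -> (forall x, W x -> f x = g x) ->
  W x -> {for x, continuous f} -> {for x, continuous g}.
Proof.
move=> oW fg Wx; rewrite /prop_for /continuous_at -(fg _ Wx); apply: cvg_trans.
by apply: (@near_eq_cvg _ _ (nbhs x) _ f g); exact: open_nearW oW Wx fg.
Qed.

Lemma Ck_eq k W f g : open W -> (forall x, W x -> f x = g x) ->
  Ck k W f -> Ck k W g.
Proof.
move=> oW; elim: k f g => [|k IH] f g fg /= [cf df].
  by split=> // x Wx; exact: continuous_eq_at oW fg Wx (cf x Wx).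
have fgx x : W x -> \forall y \near x, f y = g y.
  by move=> Wx; exact: open_nearW oW Wx fg.
split; first by move=> x Wx; exact: continuous_eq_at oW fg Wx (cf x Wx).
move=> i; have [d1 d2] := df i; split.
  by move=> x Wx; apply: near_eq_derivable (d1 x Wx); exact: fgx.
apply: IH d2 => x Wx; apply: near_eq_derive; exact: fgx.
Qed.

Lemma CkS k W f : Ck k.+1 W f -> Ck k W f.
Proof.
elim: k f => [|k IH] f /= [cf df]; first by split.
by split=> // i; have [d1 d2] := df i; split=> //; apply: IH.
Qed.

Lemma Ck_cont k W f x : Ck k W f -> W x -> {for x, continuous f}.
Proof. by case: k => [|k] [] + _ Wx; apply. Qed.

Lemma Ck_leq k l W f : (k <= l)%N -> Ck l W f -> Ck k W f.
Proof.
move=> /subnK <-; elim: (l - k)%N => [|d IH]; first by rewrite add0n.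
by rewrite addSn => /CkS.
Qed.

Lemma Ck_cst k W (c : R) : Ck k W (fun=> c).
Proof.
elim: k c => [|k IH] c /=; split=> //; first by move=> x _; exact: cst_continuous.
- by move=> x _; exact: cst_continuous.
- move=> i; split=> [x _|]; first exact: derivable_cst.
  have -> : (fun x : E => 'D_'e_i (fun=> c) x) = fun=> 0 by
    apply/funext => x; rewrite derive_cst.
  exact: IH.
Qed.

Lemma CkD k W f g : open W -> Ck k W f -> Ck k W g -> Ck k W (fun x => f x + g x).
Proof.
move=> oW; elim: k f g => [|k IH] f g /= [cf df] [cg dg].
  by split=> // x Wx; exact: cvgD (cf x Wx) (cg x Wx).
split=> [x Wx|i]; first exact: cvgD (cf x Wx) (cg x Wx).
have [df1 df2] := df i; have [dg1 dg2] := dg i; split.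
  by move=> x Wx; apply: derivableD; [exact: df1|exact: dg1].
apply: (Ck_eq oW _ (IH _ _ df2 dg2)) => x Wx.
by rewrite deriveD//; [exact: df1|exact: dg1].
Qed.

Lemma CkM k W f g : open W -> Ck k W f -> Ck k W g -> Ck k W (fun x => f x * g x).
Proof.
move=> oW; elim: k f g => [|k IH] f g.
  by move=> /= [cf df] [cg dg]; split=> // x Wx; exact: cvgM (cf x Wx) (cg x Wx).
move=> cf0 cg0; have [cf df] := cf0; have [cg dg] := cg0.
split=> [x Wx|i]; first exact: cvgM (cf x Wx) (cg x Wx).
have [df1 df2] := df i; have [dg1 dg2] := dg i; split.
  by move=> x Wx; apply: derivableM; [exact: df1|exact: dg1].
have h1 := IH _ _ (CkS cf0) dg2; have h2 := IH _ _ (CkS cg0) df2.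
apply: (Ck_eq oW _ (CkD oW h1 h2)) => x Wx.
by rewrite deriveM//; [exact: df1|exact: dg1].
Qed.

Lemma CkN k W f : open W -> Ck k W f -> Ck k W (fun x => - f x).
Proof.
move=> oW h; apply: (Ck_eq oW _ (CkM oW (Ck_cst k W (-1)) h)) => x _.
by rewrite mulN1r.
Qed.

Lemma CkB k W f g : open W -> Ck k W f -> Ck k W g -> Ck k W (fun x => f x - g x).
Proof. by move=> oW hf hg; apply: CkD => //; exact: CkN. Qed.

Lemma Ck_sum k W (I : Type) (s : seq I) (P : pred I) (F : I -> E -> R) : open W ->
  (forall i, P i -> Ck k W (F i)) -> Ck k W (fun x => \sum_(i <- s | P i) F i x).
Proof.
move=> oW h; elim: s => [|i s IH].
  by apply: (Ck_eq oW _ (Ck_cst k W 0)) => x _; rewrite big_nil.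
have [Pi|nPi] := boolP (P i).
  apply: (Ck_eq oW _ (CkD oW (h _ Pi) IH)) => x _.
  by rewrite big_cons Pi.
by apply: (Ck_eq oW _ IH) => x _; rewrite big_cons (negbTE nPi).
Qed.

Lemma is_derive_coord (j : 'I_n.+1) (x v : E) :
  is_derive x v (fun y : E => y 0 j) (v 0 j).
Proof.
have h : derivable (@id E) x v by exact: derivable_id.
apply: DeriveDef; first by have /derivable_mxP := h; apply.
by have := derive_mx h; rewrite derive_id => /matrixP /(_ 0 j); rewrite !mxE => <-.
Qed.

Lemma Ck_coord k W (j : 'I_n.+1) : open W -> Ck k W (fun x : E => x 0 j).
Proof.
move=> oW; case: k => [|k] /=; split=> //.
- by move=> x _; exact: coord_continuous.
- by move=> x _; exact: coord_continuous.
move=> i; split=> [x Wx|].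
  by have [] := is_derive_coord j x ('e_i : E).
apply: (Ck_eq oW _ (Ck_cst k W (('e_i : E) 0 j))) => x _.
by have [_ ->] := is_derive_coord j x ('e_i : E).
Qed.

Lemma is_derive_line f (x v : E) (s df : R) : is_derive (s *: v + x) v f df ->
  is_derive s (1 : R) (fun u : R => f (u *: v + x)) df.
Proof.
have e : (fun h : R => h^-1 *: (f ((h *: (1 : R) + s) *: v + x) - f (s *: v + x)))
   = (fun h => h^-1 *: (f (h *: v + (s *: v + x)) - f (s *: v + x))).
  by apply/funext => h; rewrite addrA -scalerDl [h *: 1]mulr1.
by move=> [d1 d2]; apply: DeriveDef; rewrite ?/derivable ?/derive /= ?e.
Qed.

Lemma is_derive_of_line f (x v : E) (df : R) :
  is_derive (0 : R) (1 : R) (fun u : R => f (u *: v + x)) df -> is_derive x v f df.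
Proof.
have e : (fun h : R => h^-1 *: (f ((h *: (1 : R) + 0) *: v + x) - f (0 *: v + x)))
   = (fun h => h^-1 *: (f (h *: v + x) - f x)).
  by apply/funext => h; rewrite addr0 scale0r add0r [h *: 1]mulr1.
move=> [d1 d2]; apply: DeriveDef; first by move: d1; rewrite /derivable /= e.
by move: d2; rewrite /derive /= e.
Qed.

(** The intermediate point is located only by [|s| <= |t|], so that one statement serves both signs
    of [t]. *)
Lemma MVT_dir f (x v : E) (t : R) :
  (forall s, `|s| <= `|t| -> derivable f (s *: v + x) v) ->
  exists2 s, `|s| <= `|t| & f (t *: v + x) - f x = t * 'D_v f (s *: v + x).
Proof.
move=> h; pose phi s := f (s *: v + x); pose dphi s := 'D_v f (s *: v + x).
have dp s : `|s| <= `|t| -> is_derive s (1 : R) phi (dphi s).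
  by move=> st; apply: is_derive_line; apply: DeriveDef => //; exact: h.
have phi0 : phi 0 = f x by rewrite /phi scale0r add0r.
have cp a b : (forall s, s \in `[a, b]%R -> `|s| <= `|t|) ->
    {within `[a, b], continuous phi}.
  move=> ab; apply: derivable_within_continuous => s sab.
  by have [] := dp s (ab s sab).
have [t0|t0] := leP 0 t.
  have le s : s \in `[0, t]%R -> `|s| <= `|t|.
    by rewrite in_itv /= => /andP[s0 st]; rewrite !ger0_norm.
  have [s sab|s /le st eq] := @MVT_segment R phi dphi 0 t t0 _ (cp _ _ le).
    by apply/dp/le; move: sab; rewrite !in_itv /= => /andP[/ltW-> /ltW->].
  by exists s => //; rewrite -phi0 -/(phi t) eq subr0 mulrC.
have le s : s \in `[t, 0]%R -> `|s| <= `|t|.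
  by rewrite in_itv /= => /andP[ts s0]; rewrite !ler0_norm ?lerN2// ltW.
have [s sab|s /le st eq] := @MVT_segment R phi dphi t 0 (ltW t0) _ (cp _ _ le).
  by apply/dp/le; move: sab; rewrite !in_itv /= => /andP[/ltW-> /ltW->].
by exists s => //; rewrite -phi0 -/(phi t) -opprB eq sub0r mulrN opprK mulrC.
Qed.

Lemma coord_le_norm (x : E) i : `|x 0 i| <= `|x|.
Proof.
rewrite [leRHS]/Num.Def.normr /= mx_normrE.
exact: (le_bigmax _ (fun ij : 'I_1 * 'I_n.+1 => `|x ij.1 ij.2|) (0, i)).
Qed.

Lemma norm_leP (x : E) (e : R) : 0 <= e -> (forall i, `|x 0 i| <= e) -> `|x| <= e.
Proof.
move=> e0 h; rewrite [leLHS]/Num.Def.normr /= mx_normrE.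
by apply: bigmax_le => // -[i j] _ /=; rewrite (ord1 i).
Qed.

Lemma norm_ltP (x : E) (e : R) : 0 < e -> (forall i, `|x 0 i| < e) -> `|x| < e.
Proof.
move=> e0 h; rewrite [ltLHS]/Num.Def.normr /= mx_normrE.
by apply: bigmax_lt => // -[i j] _ /=; rewrite (ord1 i).
Qed.

Lemma open_norm_ball W x : open W -> W x ->
  exists2 d : R, 0 < d & forall y, `|y - x| < d -> W y.
Proof.
move=> oW Wx; have /nbhs_ballP[d d0 dW] := open_nbhs_nbhs (conj oW Wx).
exists d => // y yx; apply: dW; rewrite -ball_normE /= distrC //.
Qed.

Lemma continuous_norm_ball f x (e : R) : {for x, continuous f} -> 0 < e ->
  exists2 d : R, 0 < d & forall y, `|y - x| < d -> `|f y - f x| < e.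
Proof.
move=> /cvgrPdist_lt /(_ e) cf e0; have /nbhs_ballP[d d0 dW] := cf e0.
exists d => // y yx; have := dW y; rewrite -ball_normE /= distrC => /(_ yx).
by rewrite distrC.
Qed.

(** The least of finitely many radii serves for all; the initial value [1] of the minimum keeps it
    positive when [I] is empty. *)
Lemma exists_min (I : finType) (P : I -> R -> Prop) :
  (forall i d d', P i d -> 0 < d' -> d' <= d -> P i d') ->
  (forall i, exists2 d, 0 < d & P i d) -> exists2 d, 0 < d & forall i, P i d.
Proof.
move=> mono h; have [D D0 PD] : exists2 D : I -> R, (forall i, 0 < D i) &
    forall i, P i (D i).
  have hc i : {d : R | 0 < d /\ P i d} by apply: cid; have [d] := h i; exists d.
  by exists (fun i => sval (hc i)) => i; case: (svalP (hc i)).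
exists (\big[Order.min/1]_i D i); first exact: lt_bigmin.
move=> i; apply: mono (PD i) _ _; first exact: lt_bigmin.
exact: bigmin_le.
Qed.

(** The increment is split along the edges of a box, one coordinate at a time; on each edge the mean
    value theorem produces a partial derivative at a point within [|h|] of [x], close to its value
    at [x] by continuity. *)
Lemma C1_differentiable W f x : open W -> Ck 1 W f -> W x -> differentiable f x.
Proof.
move=> oW [_ df] Wx.
pose L (v : E) : R := \sum_i v 0 i * 'D_'e_i f x.
have Llin : linear L.
  move=> a u v; rewrite /L scaler_sumr -big_split /=; apply: eq_bigr => i _.
  by rewrite !mxE mulrDl -mulrA.
pose L' : {linear E -> R} := HB.pack L (GRing.isLinear.Build _ _ _ _ L Llin).
have cL : continuous L'.
  have cL0 : Ck 0 setT L.
    by apply: Ck_sum openT _ => i _; apply: CkM openT _ _; [exact: Ck_coord openT|exact: Ck_cst].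
  by move=> v; exact: Ck_cont cL0 I.
suff eqL : f \o shift x = cst (f x) + L' +o_ (0 : E) id.
  by apply/diff_locallyP; rewrite (diff_unique cL eqL).
apply/eqaddoP => e e0; have en : 0 < e / n.+1%:R by rewrite divr_gt0.
have [d0 d00 dW] := open_norm_ball oW Wx.
have [d1 d10 Hd] : exists2 d : R, 0 < d & forall i y, `|y - x| < d ->
    `|'D_'e_i f y - 'D_'e_i f x| < e / n.+1%:R.
  apply: (@exists_min _ (fun i d => forall y, `|y - x| < d ->
    `|'D_'e_i f y - 'D_'e_i f x| < e / n.+1%:R)).
    by move=> i d d' Pd _ d'd y yx; apply: Pd; exact: lt_le_trans d'd.
  move=> i; apply: continuous_norm_ball => //.
  by have [_ [c _]] := df i; exact: c.
near=> h.
have hd : `|h| < Num.min d0 d1.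
  near: h; apply/nbhs_ballP; exists (Num.min d0 d1); first by rewrite /= lt_min d00.
  by move=> y; rewrite -ball_normE /= sub0r normrN.
move: hd; rewrite lt_min => /andP[hd0 hd1].
(* [z k] is [x] with its first [k] coordinates already moved by [h]. *)
pose z (k : nat) : E := x + \row_j (if (j < k)%N then h 0 j else 0).
have z0 : z 0%N = x by rewrite /z (_ : \row__ _ = 0) ?addr0//; apply/rowP => j; rewrite !mxE.
have zn : z n.+1 = h + x.
  rewrite /z addrC; congr (_ + _); apply/rowP => j; rewrite !mxE ltn_ord //.
have zS (i : 'I_n.+1) : z i.+1 = h 0 i *: 'e_i + z i.
  rewrite /z addrCA; congr (_ + _); apply/rowP => j; rewrite !mxE ltnS leq_eqVlt.
  have [->|ij] := eqVneq j i; first by rewrite !eqxx ltnn mulr1 addr0.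
  by move: ij; rewrite -val_eqE /= => /negbTE ->; rewrite ?andbF mulr0 add0r.
have zd (i : 'I_n.+1) s : `|s| <= `|h 0 i| -> `|s *: 'e_i + z i - x| <= `|h|.
  move=> si; rewrite /z addrCA [x + _]addrC addrK; apply: norm_leP => // j; rewrite !mxE.
  have [->|ij] := eqVneq j i.
    by rewrite !eqxx ltnn mulr1 addr0 (le_trans si)// coord_le_norm.
  rewrite ?andbF mulr0 add0r; case: ifP => _; first exact: coord_le_norm.
  by rewrite normr0.
have /= step (i : 'I_n.+1) : `|f (z i.+1) - f (z i) - h 0 i * 'D_'e_i f x|
    <= e / n.+1%:R * `|h|.
  rewrite zS; have [s /zd si|s /zd si ->] := @MVT_dir f (z i) 'e_i (h 0 i).
    by have [dd _] := df i; apply: dd; apply: dW; exact: le_lt_trans hd0.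
  rewrite -mulrBr normrM mulrC ler_pM// ?coord_le_norm// ltW//.
  exact/Hd/(le_lt_trans si).
rewrite /= !fctE.
have -> : f (h + x) - (f x + L h) =
    \sum_(i < n.+1) (f (z i.+1) - f (z i) - h 0 i * 'D_'e_i f x).
  rewrite sumrB -(big_mkord xpredT (fun i => f (z i.+1) - f (z i))) telescope_sumr//.
  by rewrite z0 zn opprD addrA.
apply: le_trans (ler_norm_sum _ _ _) _.
apply: le_trans (ler_sum _ (fun i _ => step i)) _.
by rewrite sumr_const card_ord -[leLHS]mulr_natr mulrAC divfK// pnatr_eq0.
Unshelve. all: by end_near. Qed.

Lemma derive_differentiable f x v : differentiable f x ->
  is_derive x v f (\sum_j v 0 j * 'D_'e_j f x).
Proof.
move=> df; apply: DeriveDef; first exact: diff_derivable.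
rewrite deriveE// {1}(row_sum_delta v) linear_sum; apply: eq_bigr => j _.
by rewrite linearZ deriveE.
Qed.

(** Only derivatives along [v] of the components of [F] are available, so [F] is restricted to the
    line through [x]: a derivable curve in one variable is differentiable, and the chain rule for
    differentials applies to it. *)
Lemma is_derive_comp (F : E -> E) f x v (dF : E) : differentiable f (F x) ->
  (forall j, is_derive x v (fun y => F y 0 j) (dF 0 j)) ->
  is_derive x v (f \o F) (\sum_j dF 0 j * 'D_'e_j f (F x)).
Proof.
move=> df dFx; apply: is_derive_of_line.
pose phi (s : R) : E := F (s *: v + x).
have phi0 : phi 0 = F x by rewrite /phi scale0r add0r.
have dphij j : is_derive (0 : R) (1 : R) (fun s => phi s 0 j) (dF 0 j).
  apply: (@is_derive_line (fun y => F y 0 j)); rewrite scale0r add0r; exact: dFx.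
have dphi : derivable phi 0 1.
  by apply/derivable_mxP => i j; rewrite (ord1 i); have [] := dphij j.
have phiE : 'D_1 phi 0 = dF.
  rewrite derive_mx//; apply/rowP => j; rewrite !mxE.
  by have [] := dphij j.
have dphi' : differentiable phi 0 by apply/derivable1_diffP.
have df' : differentiable f (phi 0) by rewrite phi0.
have h : differentiable (f \o phi) 0 by exact: differentiable_comp.
apply: DeriveDef; first exact: diff_derivable.
rewrite (deriveE _ h) diff_comp//= -(deriveE _ dphi') phiE -phi0 -(deriveE _ df').
by have [_ ->] := derive_differentiable dF df'.
Qed.

Lemma is_derive_comp1 (phi : R -> R) f x v (dphi df : R) :
  is_derive (f x) (1 : R) phi dphi -> is_derive x v f df ->
  is_derive x v (phi \o f) (dphi * df).
Proof.
move=> phi' f'; apply: is_derive_of_line.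
apply: (@is_derive1_comp _ phi (fun u => f (u *: v + x))).
  by rewrite scale0r add0r.
by apply: is_derive_line; rewrite scale0r add0r.
Qed.

Lemma continuous_coordP (F : E -> E) (x : E) :
  (forall j, {for x, continuous (fun y => F y 0 j)}) -> {for x, continuous F}.
Proof.
move=> h; apply/(@cvgrPdist_lt _ _ _ (nbhs x)) => e e0.
have [d d0 hd] : exists2 d : R, 0 < d & forall j y, `|y - x| < d ->
    `|F y 0 j - F x 0 j| < e.
  apply: (@exists_min _ (fun j d => forall y, `|y - x| < d -> `|F y 0 j - F x 0 j| < e)).
    by move=> i a b Pd _ ab y yx; apply: Pd; exact: lt_le_trans ab.
  by move=> j; exact: (continuous_norm_ball (h j)).
apply/nbhs_ballP; exists d => // y; rewrite -ball_normE /= distrC => yx.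
by apply: norm_ltP => // j; rewrite !mxE distrC; exact: hd.
Qed.

(** The induction is on [k] for all [f], since [D_i (f o F)] is a combination of the functions
    [(D_j f) o F], taken at the lower order. *)
Lemma Ck_comp k W W' f (F : E -> E) : open W -> open W' ->
  (forall j, Ck k W (fun x => F x 0 j)) -> (forall x, W x -> W' (F x)) ->
  Ck k W' f -> Ck k W (f \o F).
Proof.
move=> oW oW'; elim: k f => [|k IH] f CF FW Cf.
  split=> // x Wx; apply: continuous_comp; last exact: Ck_cont Cf (FW _ Wx).
  by apply: continuous_coordP => j; exact: Ck_cont (CF j) Wx.
have dF x i j : W x -> is_derive x 'e_i (fun y => F y 0 j) ('D_'e_i (fun y => F y 0 j) x).
  by move=> Wx; have [_ /(_ i)[+ _]] := CF j => /(_ _ Wx)/derivableP.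
have dc x i : W x -> is_derive x 'e_i (f \o F)
    (\sum_j 'D_'e_i (fun y => F y 0 j) x * 'D_'e_j f (F x)).
  move=> Wx.
  have := @is_derive_comp F f x 'e_i (\row_j 'D_'e_i (fun y => F y 0 j) x).
  under eq_bigr do rewrite mxE; apply.
    by apply: C1_differentiable oW' _ (FW _ Wx); apply: Ck_leq Cf.
  by move=> j; rewrite mxE; exact: dF.
split=> [x Wx|i].
  apply: continuous_comp; last exact: Ck_cont Cf (FW _ Wx).
  by apply: continuous_coordP => j; exact: Ck_cont (CF j) Wx.
split=> [x Wx|]; first by have [] := dc x i Wx.
apply: (@Ck_eq _ _ (fun x => \sum_j 'D_'e_i (fun y => F y 0 j) x * 'D_'e_j f (F x))) => //.
  by move=> x Wx; have [_ ->] := dc x i Wx.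
apply: Ck_sum => // j _; apply: CkM => //.
  by have [_ /(_ i)[]] := CF j.
apply: (IH (fun y => 'D_'e_j f y)) => //; first by move=> l; apply: CkS; exact: CF.
by have [_ /(_ j)[]] := Cf.
Qed.

Lemma CkV k W f : open W -> (forall x, W x -> f x != 0) -> Ck k W f ->
  Ck k W (fun x => (f x)^-1).
Proof.
move=> oW f0; elim: k => [|k IH] Cf.
  by split=> // x Wx; exact: cvgV (f0 x Wx) (Ck_cont Cf Wx).
split=> [x Wx|i]; first exact: cvgV (f0 x Wx) (Ck_cont Cf Wx).
have [_ /(_ i)[df Cdf]] := Cf; split=> [x Wx|].
  by apply: derivableV; [exact: f0|exact: df].
apply: (@Ck_eq _ _ (fun x => - ((f x)^-1 * (f x)^-1 * 'D_'e_i f x))) => //.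
  by move=> x Wx; rewrite deriveV ?f0//; [rewrite expr2 invfM scaleNr|exact: df].
by apply: CkN => //; apply: CkM => //; apply: CkM => //; apply: IH; apply: CkS.
Qed.

Lemma Ck_expR k W f : open W -> Ck k W f -> Ck k W (fun x => expR (f x)).
Proof.
move=> oW; elim: k => [|k IH] Cf.
  split=> // x Wx; apply: (continuous_comp (Ck_cont Cf Wx)); exact: continuous_expR.
split=> [x Wx|i].
  by apply: (continuous_comp (Ck_cont Cf Wx)); exact: continuous_expR.
have [_ /(_ i)[df Cdf]] := Cf.
have dc x : W x -> is_derive x 'e_i (fun y => expR (f y)) (expR (f x) * 'D_'e_i f x).
  by move=> Wx; apply: is_derive_comp1; apply/derivableP/df.
split=> [x Wx|]; first by have [] := dc x Wx.
apply: (@Ck_eq _ _ (fun x => expR (f x) * 'D_'e_i f x)) => //.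
  by move=> x Wx; have [_ ->] := dc x Wx.
by apply: CkM => //; apply: IH; apply: CkS.
Qed.

(** No induction is involved: the first derivative [f^-1 D f] is already covered by [CkV]. *)
Lemma Ck_ln k W f : open W -> (forall x, W x -> 0 < f x) -> Ck k W f ->
  Ck k W (fun x => ln (f x)).
Proof.
move=> oW f0 Cf.
have cl x : W x -> {for x, continuous (fun x => ln (f x))}.
  by move=> Wx; apply: (continuous_comp (Ck_cont Cf Wx)); apply: continuous_ln; exact: f0.
case: k Cf => [|k] Cf; split=> // i.
have [_ /(_ i)[df Cdf]] := Cf.
have dc x : W x -> is_derive x 'e_i (fun y => ln (f y)) ((f x)^-1 * 'D_'e_i f x).
  move=> Wx; apply: is_derive_comp1; last by apply/derivableP/df.
  by apply: is_derive1_ln; exact: f0.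
split=> [x Wx|]; first by have [] := dc x Wx.
apply: (@Ck_eq _ _ (fun x => (f x)^-1 * 'D_'e_i f x)) => //.
  by move=> x Wx; have [_ ->] := dc x Wx.
apply: CkM => //; apply: CkV => //; last exact: CkS.
by move=> x Wx; rewrite gt_eqF// f0.
Qed.

Lemma schwarz W f x i j : open W -> Ck 2 W f -> W x ->
  'D_'e_i (fun y => 'D_'e_j f y) x = 'D_'e_j (fun y => 'D_'e_i f y) x.
Proof.
move=> oW Cf Wx.
have C1 l : Ck 1 W (fun y => 'D_'e_l f y) by have [_ /(_ l)[]] := Cf.
have d1 l y : W y -> derivable f y 'e_l by move=> Wy; have [_ /(_ l)[+ _]] := Cf; apply.
have d2 l l' y : W y -> derivable (fun z => 'D_'e_l' f z) y 'e_l.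
  by move=> Wy; have [_ /(_ l)[+ _]] := C1 l'; apply.
have c2 l l' : {for x, continuous (fun z => 'D_'e_l (fun y => 'D_'e_l' f y) z)}.
  by have [_ /(_ l)[_ [+ _]]] := C1 l'; apply.
have nei l : `|'e_l : E| <= 1.
  by apply: norm_leP => // q; rewrite !mxE /=; case: (q == l); rewrite /= ?normr1 ?normr0.
(* both iterated differences equal [h^2] times a mixed derivative near [x] *)
have key (l l' : 'I_n.+1) (h : R) : 0 < h -> (forall y, `|y - x| <= 2 * h -> W y) ->
   exists2 y, `|y - x| <= 2 * h &
   f (h *: 'e_l + (h *: 'e_l' + x)) - f (h *: 'e_l' + x) - (f (h *: 'e_l + x) - f x)
     = h * (h * 'D_'e_l (fun y => 'D_'e_l' f y) y).
  move=> h0 hW.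
  have nb (s t : R) : `|s| <= `|h| -> `|t| <= `|h| -> `|s *: 'e_l + (t *: 'e_l' + x) - x| <= 2 * h.
    rewrite (gtr0_norm h0) addrA addrK => sh th; rewrite mulr_natl mulr2n.
    apply: le_trans (ler_normD _ _) _; rewrite !normrZ.
    by rewrite lerD// -[leRHS]mulr1 ler_pM.
  pose g y := f (h *: 'e_l + y) - f y.
  have dg s : `|s| <= `|h| -> is_derive (s *: 'e_l' + x) 'e_l' g
     ('D_'e_l' f (h *: 'e_l + (s *: 'e_l' + x)) - 'D_'e_l' f (s *: 'e_l' + x)).
    move=> sh; apply: is_deriveB; last first.
      apply/derivableP/d1/hW; have := nb 0 s; rewrite scale0r add0r; apply=> //.
      by rewrite normr0.
    have [p1 p2] : is_derive (h *: 'e_l + (s *: 'e_l' + x)) 'e_l' f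
       ('D_'e_l' f (h *: 'e_l + (s *: 'e_l' + x))).
      by apply/derivableP/d1/hW/nb.
    have e : (fun u : R => u^-1 *: (f (h *: 'e_l + (u *: 'e_l' + (s *: 'e_l' + x))) -
        f (h *: 'e_l + (s *: 'e_l' + x)))) = (fun u => u^-1 *: (f (u *: 'e_l' +
        (h *: 'e_l + (s *: 'e_l' + x))) - f (h *: 'e_l + (s *: 'e_l' + x)))).
      by apply/funext => u; rewrite addrCA.
    by apply: DeriveDef; rewrite ?/derivable ?/derive /= ?e.
  have [s sh|s sh eq1] := @MVT_dir g x 'e_l' h; first by have [] := dg s sh.
  have [t th|t th eq2] := @MVT_dir (fun y => 'D_'e_l' f y) (s *: 'e_l' + x) 'e_l h.
    by apply/d2/hW/nb.
  exists (t *: 'e_l + (s *: 'e_l' + x)); first exact: nb.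
  rewrite -[LHS]/(g (h *: 'e_l' + x) - g x) eq1; have [_ ->] := dg s sh.
  by rewrite eq2.
apply/eqP; rewrite -subr_eq0 -normr_le0; apply/ler_addgt0Pr => e e0; rewrite add0r.
have e2 : 0 < e / 2 by rewrite divr_gt0.
have [da da0 ha] := continuous_norm_ball (c2 i j) e2.
have [db db0 hb] := continuous_norm_ball (c2 j i) e2.
have [dw dw0 hw] := open_norm_ball oW Wx.
pose m := Num.min (Num.min da db) dw; pose h := m / 4.
have m0 : 0 < m by rewrite !lt_min da0 db0.
have h0 : 0 < h by rewrite divr_gt0.
have lt2 (y : E) : `|y - x| <= 2 * h -> [/\ `|y - x| < da, `|y - x| < db & `|y - x| < dw].
  have : 2 * h < m by rewrite /h; move: m0; lra.
  by move=> hm yh; have := le_lt_trans yh hm; rewrite !lt_min => /andP[/andP[-> ->] ->].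
have hW y : `|y - x| <= 2 * h -> W y by move=> /lt2[_ _] /hw.
have [y1 /lt2[/ha hy1 _ _] eq1] := key i j h h0 hW.
have [y2 /lt2[_ /hb hy2 _] eq2] := key j i h h0 hW.
have eq : 'D_'e_i (fun y => 'D_'e_j f y) y1 = 'D_'e_j (fun y => 'D_'e_i f y) y2.
  apply: (mulfI (lt0r_neq0 h0)); apply: (mulfI (lt0r_neq0 h0)).
  have sw (a b c d : R) : a - b - (c - d) = a - c - (b - d) by ring.
  have A : h *: 'e_j + (h *: 'e_i + x) = h *: 'e_i + (h *: 'e_j + x) by exact: addrCA.
  rewrite A in eq2.
  apply: etrans (esym eq1) _.
  apply: etrans eq2.
  exact: sw.
rewrite -(subrKA ('D_'e_i (fun y => 'D_'e_j f y) y1)) {2}eq.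
rewrite distrC in hy1.
by apply: le_trans (ler_normD _ _) _; rewrite [leRHS]splitr; apply: lerD (ltW hy1) (ltW hy2).
Qed.

End Ck_theory.

(** * Linear differential equations with parameters *)

Section ode_one_variable.
Context {R : realType}.
Implicit Types (c d t : R).

Lemma derive1_continuous (f : R -> R) t df : is_derive t (1 : R) f df -> {for t, continuous f}.
Proof.
by move=> [h _]; apply: differentiable_continuous; apply/derivable1_diffP.
Qed.

Lemma MVT_bound (f df : R -> R) c d (K : R) :
  (forall t, c <= t <= d -> is_derive t (1 : R) f (df t)) ->
  (forall t, c <= t <= d -> `|df t| <= K) ->
  forall s t, c <= s <= d -> c <= t <= d -> `|f t - f s| <= K * (d - c).
Proof.
move=> hf hK.
have main s t : c <= s <= d -> c <= t <= d -> s <= t -> `|f t - f s| <= K * (d - c).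
  move=> /andP[cs sd] /andP[ct td] st.
  have sub u : u \in `[s, t]%R -> c <= u <= d.
    rewrite in_itv /= => /andP[su ut].
    by rewrite (le_trans cs su) (le_trans ut td).
  have [u ust|u|u /sub/hK hu ->] := @MVT_segment R f df s t st.
  - by apply/hf/sub; move: ust; rewrite !in_itv /= => /andP[/ltW-> /ltW->].
  - apply: (derivable_within_continuous (f := f)) => v /sub /hf [] //.
  rewrite normrM; apply: ler_pM => //.
  by rewrite ger0_norm ?subr_ge0// lerB.
move=> s t sI tI; have [st|/ltW ts] := leP s t; first exact: main.
by rewrite distrC; exact: main.
Qed.

Lemma continuous_primitive (h : R -> R) (t0 : R) : continuous h ->
  exists2 H : R -> R, H t0 = 0 & forall t, is_derive t (1 : R) H (h t).
Proof.
(* [F g] integrates [g] from [-1]; it is used on both half-lines, after a reflection on the left one *)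
pose F (g : R -> R) (t : R) : R := (\int[lebesgue_measure]_(u in `[(-1)%R, t]) (g u))%R.
have FE (g : R -> R) : continuous g -> forall t, -1 < t -> is_derive t (1 : R) (F g) (g t).
  move=> cg t t1.
  have ig : lebesgue_measure.-integrable `[(-1)%R, (t + 1)%R] (EFin \o g).
    apply: continuous_compact_integrable; first exact: segment_compact.
    exact: continuous_subspaceT.
  have tt1 : t < t + 1 by rewrite ltrDl.
  have [d1] := continuous_FTC1_closed tt1 ig t1 (cg t).
  by rewrite derive1E => d2; exact: DeriveDef d1 d2.
move=> ch.
have chN : continuous (fun u => h (- u)).
  by move=> u; apply: continuous_comp; [exact: oppr_continuous|exact: ch].
pose Hp t := F h t - F h 0; pose Hm t := - F (fun u => h (- u)) (- t) + F (fun u => h (- u)) 0.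
have Hp' t : -1 < t -> is_derive t (1 : R) Hp (h t).
  by move=> t1; rewrite -[h t]subr0; apply: is_deriveB; exact: FE.
have Hm' t : t < 1 -> is_derive t (1 : R) Hm (h t).
  move=> t1; have tN : -1 < - t by rewrite ltrN2.
  have D := FE _ chN _ tN; rewrite opprK in D.
  have D2 : is_derive t (1 : R) (fun u => F (fun u => h (- u)) (- u)) (h t * (- 1)).
    exact: (@is_derive1_comp _ (F (fun u => h (- u))) (fun u => - u)).
  have := is_deriveD (is_deriveN D2) (is_derive_cst (F (fun u => h (- u)) 0) t 1).
  by rewrite mulrN1 opprK addr0.
(* Both primitives vanish at 0 and have derivative [h], so they coincide on []-1, 1[]; this makes
   the glued function derivable at 0. *)
have Hpm t : -1 < t < 1 -> Hp t = Hm t.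
  move=> /andP[t1 t2]; apply/subr0_eq/normr0_eq0/le_anti/andP; split => //.
  have t3 : `|t| < 1 by rewrite ltr_norml t1.
  have bnd u : - `|t| <= u <= `|t| -> -1 < u < 1.
    by move=> /andP[u1 u2]; rewrite (lt_le_trans _ u1) ?(le_lt_trans u2)// ltrN2.
  have := @MVT_bound (fun u => Hp u - Hm u) (fun=> 0) (- `|t|) `|t| 0 _ _ 0 t.
  have Hp0 : Hp 0 = 0 by rewrite /Hp subrr.
  have Hm0 : Hm 0 = 0 by rewrite /Hm oppr0 addNr.
  rewrite mul0r Hp0 Hm0 !subr0; apply.
  - move=> u /bnd /andP[u1 u2]; rewrite -[0](subrr (h u)); apply: is_deriveB.
      exact: Hp'.
    exact: Hm'.
  - by move=> u _; rewrite normr0.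
  - by rewrite oppr_le0 normr_ge0.
  - by rewrite -ler_norml.
pose H t := if 0 < t then Hp t else Hm t.
have HE t : is_derive t (1 : R) H (h t).
  have [t0'|t0'] := ltP (-1) t.
    apply: (@near_eq_is_derive _ _ _ Hp); last exact: Hp'.
    near=> u; rewrite /H; case: ifPn => //; rewrite -leNgt => u0; apply: Hpm.
    by rewrite (le_lt_trans u0) ?ltr01 ?andbT//; near: u; exact: lt_nbhsr.
  have t1 : t < 0 by rewrite (le_lt_trans t0')// ltrN10.
  apply: (@near_eq_is_derive _ _ _ Hm); last by apply: Hm'; rewrite (lt_trans t1).
  near=> u; rewrite /H ifF//; apply/negbTE; rewrite -leNgt; apply: ltW.
  by near: u; exact: lt_nbhsl.
exists (fun t => H t - H t0); first by rewrite subrr.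
by move=> t; rewrite -[h t]subr0; apply: is_deriveB.
Unshelve. all: by end_near. Qed.

(** With [e k = 2 C / 2^k] a step is at most [e k.+1 = e k - e k.+1], so the intervals
    [[u k - e k, u k + e k]] are nested; the supremum of their left ends lies in all of them, which
    gives the rate as well. *)
Lemma geometric_cvg (u : nat -> R) (C : R) :
  (forall k, `|u k.+1 - u k| <= C / 2 ^+ k) ->
  exists l, forall k, `|l - u k| <= 2 * C / 2 ^+ k.
Proof.
move=> hu.
pose e k := 2 * C / 2 ^+ k.
have e0 k : 0 <= e k.
  by rewrite /e -mulrA mulr_ge0// (le_trans _ (hu k)).
have eS k : e k.+1 = C / 2 ^+ k.
  by rewrite /e exprS invfM mulrACA mulfV ?mul1r.
have e2 k : e k = e k.+1 + e k.+1 by rewrite eS /e -mulrA mulr_natl mulr2n.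
pose lo k := u k - e k; pose hi k := u k + e k.
have lostep k : lo k <= lo k.+1.
  by have := hu k; rewrite -eS ler_norml /lo (e2 k) => /andP[]; lra.
have histep k : hi k.+1 <= hi k.
  by have := hu k; rewrite -eS ler_norml /hi (e2 k) => /andP[]; lra.
have lomono k l : (k <= l)%N -> lo k <= lo l.
  by move=> /subnK <-; elim: (l - k)%N => // m IH; rewrite addSn (le_trans IH).
have himono k l : (k <= l)%N -> hi l <= hi k.
  by move=> /subnK <-; elim: (l - k)%N => // m IH; rewrite addSn (le_trans _ IH).
have lohi k l : lo k <= hi l.
  apply: (le_trans (lomono _ _ (leq_maxl k l))).
  apply: (le_trans _ (himono _ _ (leq_maxr k l))).
  by rewrite lerD// (le_trans _ (e0 _))// oppr_le0.
have ub : has_ubound (range lo) by exists (hi 0%N) => _ [k _ <-]; exact: lohi.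
exists (sup (range lo)) => k.
rewrite ler_distl; apply/andP; split.
  by apply: ub_le_sup => //; exists k.
by apply: ge_sup; [exists (lo 0%N), 0%N|move=> _ [l _ <-]; exact: lohi].
Qed.

Lemma geometric_small (C e : R) : 0 < e -> exists k, C / 2 ^+ k < e.
Proof.
move=> e0; exists (Num.bound (`|C| / e)).
have h := archi_boundP (divr_ge0 (normr_ge0 C) (ltW e0)).
rewrite ltr_pdivrMr ?exprn_gt0// (le_lt_trans (ler_norm C))//.
rewrite mulrC -ltr_pdivrMr// (lt_le_trans h)// -natrX ler_nat.
by apply: ltnW; exact: ltn_expl.
Qed.

Lemma continuous_sumr (T : topologicalType) (I : Type) (s : seq I) (f : I -> T -> R) (t : T) :
  (forall i, {for t, continuous (f i)}) ->
  {for t, continuous (fun x => \sum_(i <- s) f i x)}.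
Proof.
move=> cf; elim: s => [|i s IH].
  rewrite (_ : (fun x => _) = fun=> 0); first exact: cst_continuous.
  by apply/funext => x; rewrite big_nil.
rewrite (_ : (fun x => _) = fun x => f i x + \sum_(j <- s) f j x).
  exact: cvgD (cf i) IH.
by apply/funext => x; rewrite big_cons.
Qed.

End ode_one_variable.

(** * Linear systems on a short interval: a priori bound and existence *)

Section linear_ode_one_variable.
Context {R : realType} {I : finType}.
Variables (c d L t0 : R) (A : I -> I -> R -> R).
Hypotheses (cd : c <= d) (t0I : c <= t0 <= d).
Hypothesis AL : forall i j t, c <= t <= d -> `|A i j t| <= L.
(** The contraction condition: multiplying by [A] and integrating over the interval at least halves
    the sup norm. Short intervals suffice because the boundary problem is local. *)
Hypothesis small : #|I|%:R * L * (d - c) <= 1 / 2.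

Lemma linear_bound (v : I -> R) (M t : R) i : c <= t <= d -> (forall j, `|v j| <= M) ->
  `|\sum_j A i j t * v j| <= #|I|%:R * L * M.
Proof.
move=> tI vM; apply: le_trans (ler_norm_sum _ _ _) _.
have : \sum_j `|A i j t * v j| <= \sum_(j : I) L * M.
  by apply: ler_sum => j _; rewrite normrM; apply: ler_pM => //; exact: AL.
by rewrite sumr_const mulr_natl mulrnAl.
Qed.

(** No exponential appears: if [M] is the maximum of all [|E i t|], integration from [t0] gives
    [M <= e (1 + (d - c)) + M / 2] by [small], and the last term is absorbed, whence the factor 2.
    The case [e = 0] is uniqueness; small [e] gives continuity and derivability in parameters. *)
Lemma linear_ode_gronwall (E F : I -> R -> R) (e : R) : 0 <= e ->
  (forall i t, c <= t <= d ->
     is_derive t (1 : R) (E i) (\sum_j A i j t * E j t + F i t)) ->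
  (forall i, `|E i t0| <= e) -> (forall i t, c <= t <= d -> `|F i t| <= e) ->
  forall i t, c <= t <= d -> `|E i t| <= 2 * (1 + (d - c)) * e.
Proof.
move=> e0 dE Et0 Fe i t tI.
have [M M0 EM] : exists2 M, 0 <= M & (forall i t, c <= t <= d -> `|E i t| <= M) /\
    (exists j, exists2 s, c <= s <= d & M = `|E j s|).
  have hj j : exists2 s, c <= s <= d & forall t, c <= t <= d -> `|E j t| <= `|E j s|.
    have cE : {within `[c, d], continuous (fun t => `|E j t|)}.
      apply: continuous_in_subspaceT => u; rewrite inE /= in_itv /= => uI.
      apply: continuous_comp; last exact: norm_continuous.
      exact: derive1_continuous (dE j u uI).
    have [s] := EVT_max cd cE; rewrite in_itv /= => sI hs.
    by exists s => // u uI; apply: hs; rewrite in_itv.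
  have [s hs] : {s : I -> R & forall j, c <= s j <= d /\ forall t, c <= t <= d -> `|E j t| <= `|E j (s j)|}.
    apply: (@choice I R (fun j s => c <= s <= d /\ forall t, c <= t <= d -> `|E j t| <= `|E j s|)).
    by move=> j; have [s s1 s2] := hj j; exists s.
  exists (\big[Order.max/0]_j `|E j (s j)|); first exact: bigmax_ge_id.
  split=> [j u uI|].
    apply: le_trans (le_bigmax _ _ j); by have [_] := hs j; apply.
  have [//|//|j _ ->] := @eq_bigmax _ _ _ 0 i xpredT (fun j => `|E j (s j)|).
  by exists j => //; exists (s j) => //; have [] := hs j.
have step j s : c <= s <= d -> `|E j s| <= e * (1 + (d - c)) + M / 2.
  move=> sI.
  have := MVT_bound (dE j) (K := #|I|%:R * L * M + e) _ t0I sI.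
  have hK u : c <= u <= d -> `|\sum_j0 A j j0 u * E j0 u + F j u| <= #|I|%:R * L * M + e.
    move=> uI; apply: le_trans (ler_normD _ _) _; apply: lerD; last exact: Fe.
    by apply: linear_bound => // k; have [+ _] := EM; apply.
  move=> /(_ hK) h.
  have h2 : #|I|%:R * L * M * (d - c) <= M / 2.
    rewrite mulrAC [M / 2]mulrC; apply: ler_wpM2r => //.
    by rewrite (le_trans small)// div1r.
  rewrite -(subrK (E j t0) (E j s)).
  apply: le_trans (ler_normD _ _) _; have := Et0 j; move: h h2; rewrite mulrDl; lra.
have M2 : M <= 2 * (1 + (d - c)) * e.
  have dc : 0 <= d - c by rewrite subr_ge0.
  case: EM => _ [j [s sI Ms]].
  by have := step j s sI; rewrite -Ms; lra.
by apply: le_trans M2; have [+ _] := EM; apply.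
Qed.

(** Picard iteration: [T] integrates the right-hand side from [t0], and [small] makes it contract by
    [1/2] on [[c, d]], the only place where the coefficients are bounded. *)
Lemma linear_ode_existence (f : I -> R -> R) (y0 : I -> R) :
  (forall i j, continuous (A i j)) -> (forall i, continuous (f i)) ->
  exists Y : I -> R -> R, (forall i, Y i t0 = y0 i) /\
  forall i t, c <= t <= d -> is_derive t (1 : R) (Y i) (\sum_j A i j t * Y j t + f i t).
Proof.
move=> cA cf.
have [P0 hP] : {P : (R -> R) -> R -> R & forall h, continuous h ->
    P h t0 = 0 /\ forall t, is_derive t (1 : R) (P h) (h t)}.
  apply: (@choice (R -> R) (R -> R) (fun h H => continuous h -> H t0 = 0 /\ forall t, is_derive t (1 : R) H (h t))).
  move=> h; have [ch|nch] := pselect (continuous h); last by exists (fun=> 0).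
  by have [H H1 H2] := continuous_primitive t0 ch; exists H.
pose rhs (Y : I -> R -> R) i t := \sum_j A i j t * Y j t + f i t.
pose T (Y : I -> R -> R) i t := y0 i + P0 (rhs Y i) t.
have crhs Y i : (forall j, continuous (Y j)) -> continuous (rhs Y i).
  move=> cY t; apply: cvgD; last exact: cf.
  by apply: continuous_sumr => j; exact: cvgM (cA _ _ _) (cY _ _).
have dT Y i t : (forall j, continuous (Y j)) -> is_derive t (1 : R) (T Y i) (rhs Y i t).
  move=> cY; have [_ D] := hP _ (crhs Y i cY).
  by rewrite -[rhs Y i t]add0r; apply: is_deriveD.
have T0 Y i : (forall j, continuous (Y j)) -> T Y i t0 = y0 i.
  by move=> cY; have [E _] := hP _ (crhs Y i cY); rewrite /T E addr0.
have cT Y i : (forall j, continuous (Y j)) -> continuous (T Y i).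
  by move=> cY t; exact: derive1_continuous (dT Y i t cY).
have contr Y Z (M : R) : (forall j, continuous (Y j)) -> (forall j, continuous (Z j)) ->
    (forall j t, c <= t <= d -> `|Y j t - Z j t| <= M) ->
    forall j t, c <= t <= d -> `|T Y j t - T Z j t| <= M / 2.
  move=> cY cZ YZ j t tI.
  have M0 : 0 <= M by apply: le_trans (YZ j t tI).
  have D u : c <= u <= d -> is_derive u (1 : R) (fun u => T Y j u - T Z j u) (\sum_k A j k u * (Y k u - Z k u)).
    move=> uI; suff -> : \sum_k A j k u * (Y k u - Z k u) = rhs Y j u - rhs Z j u.
      by apply: is_deriveB; exact: dT.
    rewrite /rhs opprD addrACA subrr addr0 -sumrB; apply: eq_bigr => k _; ring.
  have := MVT_bound D (K := #|I|%:R * L * M) _ t0I tI.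
  rewrite !T0// subrr subr0 => h; apply: le_trans (h _) _.
    by move=> u uI; apply: linear_bound => // k; exact: YZ.
  rewrite mulrAC [M / 2]mulrC; apply: ler_wpM2r => //.
  by rewrite (le_trans small)// div1r.
pose Yk k := iter k T (fun _ _ => 0).
have cYk k i : continuous (Yk k i).
  by elim: k i => [|k IH] i; [move=> t; exact: cst_continuous|exact: cT].
have [C hC] : exists C, forall i t, c <= t <= d -> `|Yk 1%N i t - Yk 0%N i t| <= C.
  have hj j : exists C, forall t, c <= t <= d -> `|Yk 1%N j t - Yk 0%N j t| <= C.
    have cE : {within `[c, d], continuous (fun t => `|Yk 1%N j t - Yk 0%N j t|)}.
      apply: continuous_subspaceT => u.
      by apply: cvg_norm; exact: cvgB (cYk _ _ _) (cYk _ _ _).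
    have [s _ hs] := EVT_max cd cE; exists `|Yk 1%N j s - Yk 0%N j s| => t tI.
    by apply: hs; rewrite in_itv.
  have [s hs] := choice hj.
  exists (\big[Order.max/0]_j s j) => j t tI.
  by apply: le_trans (le_bigmax _ _ j); exact: hs.
have geo k i t : c <= t <= d -> `|Yk k.+1 i t - Yk k i t| <= C / 2 ^+ k.
  elim: k i t => [|k IH] i t tI; first by rewrite expr0 divr1; exact: hC.
  have := contr (Yk k.+1) (Yk k) _ (cYk _) (cYk _) IH i t tI.
  by rewrite exprS invfM mulrA mulrAC.
(* The iterates converge on [[c, d]]; freezing the argument outside gives a limit continuous on the
   whole line, as [T] requires. *)
pose clamp t := Num.max c (Num.min d t).
have clampI t : c <= clamp t <= d by rewrite /clamp le_max lexx ge_max cd ge_min lexx.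
have clampE t : c <= t <= d -> clamp t = t.
  by move=> /andP[ct td]; rewrite /clamp (min_r td) (max_r ct).
have cclamp : continuous clamp.
  by move=> t; apply: (@continuous_max R R (fun=> c)); [exact: cst_continuous|
    apply: (@continuous_min R R (fun=> d)); [exact: cst_continuous|exact: cvg_id]].
have hl i t : exists l, forall k, `|l - Yk k i (clamp t)| <= 2 * C / 2 ^+ k.
  by apply: geometric_cvg => k; apply: geo.
have [Y hY] : {Y : I -> R -> R & forall i t k, `|Y i t - Yk k i (clamp t)| <= 2 * C / 2 ^+ k}.
  apply: (@choice I (R -> R) (fun i y => forall t k, `|y t - Yk k i (clamp t)| <= 2 * C / 2 ^+ k)).
  by move=> i; have [y hy] := choice (hl i); exists y.
have cY i : continuous (Y i).
  move=> t; apply/cvgrPdist_lt => e e0.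
  have [k hk] := geometric_small (2 * C) (divr_gt0 e0 (ltr0n _ 3)).
  have cYc : {for t, continuous (fun u => Yk k i (clamp u))}.
    exact: continuous_comp (cclamp t) (cYk k i _).
  near=> u.
  have h3 : `|Yk k i (clamp t) - Yk k i (clamp u)| < e / 3.
    by near: u; move/cvgrPdist_lt : cYc; apply; rewrite divr_gt0.
  rewrite ltr_norml.
  move: (le_lt_trans (hY i t k) hk) (le_lt_trans (hY i u k) hk) h3.
  rewrite !ltr_norml => /andP[? ?] /andP[? ?] /andP[? ?]; apply/andP; split; lra.
have TY i t : c <= t <= d -> T Y i t = Y i t.
  move=> tI; apply/subr0_eq/normr0_eq0/le_anti/andP; split=> //.
  apply/ler_addgt0Pr => e e0; rewrite add0r.
  have [k hk] := geometric_small (2 * C) e0.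
  have h1 j u : c <= u <= d -> `|Y j u - Yk k j u| <= 2 * C / 2 ^+ k.
    by move=> uI; have := hY j u k; rewrite clampE.
  have h2 := contr Y (Yk k) _ cY (cYk k) h1 i t tI.
  have h3 := hY i t k.+1; rewrite clampE// exprS invfM mulrA mulrAC in h3.
  have -> : T Y i t - Y i t = (T Y i t - T (Yk k) i t) - (Y i t - Yk k.+1 i t).
    have sub3 (x y z : R) : x - y = x - z - (y - z) by ring.
    exact: sub3.
  apply: le_trans (ler_normB _ _) _.
  by move: hk h2 h3; lra.
(* The witness is [T Y] and not [Y]: the latter is constant outside [[c, d]], whereas a primitive on
   the whole line has two-sided derivatives at the endpoints as well. *)
exists (T Y); split=> [i|i t tI]; first exact: T0.
have -> : \sum_j A i j t * T Y j t + f i t = rhs Y i t.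
  by rewrite /rhs; congr (_ + _); apply: eq_bigr => j _; rewrite TY.
exact: dT.
Unshelve. all: by end_near. Qed.

End linear_ode_one_variable.

(** * Linear systems along the lines in direction [e_0], and smooth dependence on the line *)

Section linear_ode_parameters.
Context {R : realType} {n : nat} {I : finType}.
Local Notation E := 'rV[R]_n.+1.
Implicit Types (x y z p : E) (t s h delta e : R).

(** Written as an affine line [t *: v + y] so that the rule for derivatives along a line applies by
    conversion. *)
Definition slice x t : E := t *: 'e_0 + (x - x 0 0 *: 'e_0).

Lemma slice0 x t : slice x t 0 0 = t.
Proof. by rewrite /slice !mxE eqxx /= !mulr1 subrr addr0. Qed.

Lemma slice_id x : slice x (x 0 0) = x.
Proof. by rewrite /slice addrC subrK. Qed.

Lemma sliceE x t j : j != 0 -> slice x t 0 j = x 0 j.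
Proof.
by move=> j0; rewrite /slice !mxE eqxx /= (negbTE j0) !mulr0 subr0 add0r.
Qed.

Lemma slice_slice x t s : slice (slice x t) s = slice x s.
Proof.
apply/rowP => j; have [->|j0] := eqVneq j 0; first by rewrite !slice0.
by rewrite !sliceE.
Qed.

Lemma slice_shift0 x t s : slice (s *: 'e_0 + x) t = slice x t.
Proof.
apply/rowP => j; have [->|j0] := eqVneq j 0; first by rewrite !slice0.
by rewrite !sliceE// !mxE eqxx /= (negbTE j0) mulr0 add0r.
Qed.

Lemma slice_shift x t s l : l != 0 -> slice (s *: 'e_l + x) t = s *: 'e_l + slice x t.
Proof.
move=> l0; apply/rowP => j; have [->|j0] := eqVneq j 0.
  by rewrite slice0 mxE slice0 !mxE eqxx /= (eq_sym 0 l) (negbTE l0) mulr0 add0r.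
by rewrite sliceE// mxE [in RHS]mxE sliceE.
Qed.

Lemma slice_ball p x t delta : `|x - p| < delta -> `|t - p 0 0| < delta ->
  `|slice x t - p| < delta.
Proof.
move=> xp tp; apply: norm_ltP; first exact: le_lt_trans xp.
move=> j; rewrite mxE [X in _ + X]mxE; have [->|j0] := eqVneq j 0; first by rewrite slice0.
rewrite sliceE//; apply: le_lt_trans xp; have := coord_le_norm (x - p) j.
by rewrite !mxE.
Qed.

Lemma slice_cont_t t x : {for t, continuous (slice x)}.
Proof.
rewrite /prop_for /continuous_at /slice; apply: cvgD; last exact: cvg_cst.
by apply: cvgZr_tmp; exact: cvg_id.
Qed.

Lemma slice_dist x z t s : `|slice x t - slice z s| <= Num.max `|x - z| `|t - s|.
Proof.
apply: norm_leP; first by rewrite le_max normr_ge0.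
move=> j; rewrite mxE [X in _ + X]mxE le_max; have [->|j0] := eqVneq j 0.
  by rewrite !slice0 lexx orbT.
by rewrite !sliceE//; have := coord_le_norm (x - z) j; rewrite !mxE => ->.
Qed.

Lemma is_derive_slice (f : E -> R) x t df : is_derive (slice x t) 'e_0 f df ->
  is_derive t (1 : R) (fun u => f (slice x u)) df.
Proof. exact: is_derive_line. Qed.

(** Compactness of [[c, d]] turns continuity at each point of the slice through [z] into one radius
    valid for all [t]; the estimates below compare two whole slices at once. *)
Lemma slice_uniform (g : E -> R) z c d e :
  (forall t, c <= t <= d -> {for slice z t, continuous g}) -> 0 < e ->
  exists2 eta, 0 < eta & forall x t, `|x - z| < eta -> c <= t <= d ->
    `|g (slice x t) - g (slice z t)| < e.
Proof.
move=> cg e0.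
have /compact_near_coveringP cK := @segment_compact R c d.
have H := cK _ (nbhs z) (fun x t => `|g (slice x t) - g (slice z t)| < e) _.
have /H : forall t, `[c, d]%classic t -> \forall t' \near t & x \near z,
    `|g (slice x t') - g (slice z t')| < e.
  move=> t; rewrite /= in_itv /= => tI.
  have [r r0 hr] := continuous_norm_ball (cg t tI) (divr_gt0 e0 (ltr0n R 2)).
  exists (ball t r, ball z r); first by split; exact: nbhsx_ballx.
  move=> [t' x] /= [tt' zx]; rewrite -ball_normE /= in tt'; rewrite -ball_normE /= in zx.
  have h1 : `|g (slice x t') - g (slice z t)| < e / 2.
    by apply: hr; apply: le_lt_trans (slice_dist _ _ _ _) _; rewrite gt_max distrC zx distrC.
  have h2 : `|g (slice z t') - g (slice z t)| < e / 2.
    by apply: hr; apply: le_lt_trans (slice_dist _ _ _ _) _; rewrite gt_max subrr normr0 r0 distrC.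
  move: h1 h2; rewrite !ltr_norml => /andP[? ?] /andP[? ?]; apply/andP; split; lra.
move=> /nbhs_ballP[r r0 hr]; exists r => // x t xz tI.
have := hr x; rewrite -ball_normE /= distrC => /(_ xz t); apply.
by rewrite /= in_itv.
Qed.

Section fixed_coefficients.
Variables (p : E) (L t0 : R) (A : I -> I -> E -> R).
Hypothesis L0 : 0 <= L.

(** The norm is the sup norm, so this ball is a cube: a slice through one of its points stays in it
    as long as [t] is within [delta] of [p 0 0]. *)
Definition cube delta : set E := [set x | `|x - p| < delta].

Lemma cube_open delta : open (cube delta).
Proof.
rewrite openE => x /= xp; apply/nbhs_ballP; exists (delta - `|x - p|) => /=.
  by rewrite subr_gt0.
move=> y; rewrite -ball_normE /= /cube /= distrC => yx.
by rewrite -(subrK x y) -addrA (le_lt_trans (ler_normD _ _))// -ltrBrDr.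
Qed.

Definition solves delta (f : I -> E -> R) (Y : I -> E -> R) :=
  forall i x, cube delta x -> is_derive x 'e_0 (Y i) (\sum_j A i j x * Y j x + f i x).

(** The equation is solved independently on each line; regularity across lines is obtained
    afterwards. The strict inequality [delta' < delta] leaves room for a closed interval of times
    inside the larger cube. *)
Lemma parametric_existence delta delta' (f v0 : I -> E -> R) :
  (forall i j x, cube delta x -> {for x, continuous (A i j)} /\ `|A i j x| <= L) ->
  (forall i x, cube delta x -> {for x, continuous (f i)}) ->
  #|I|%:R * L * (2 * delta) <= 1 / 2 -> delta' < delta -> `|t0 - p 0 0| < delta' ->
  exists2 Y, solves delta' f Y & forall i x, cube delta' x -> x 0 0 = t0 -> Y i x = v0 i x.
Proof.
move=> hA hf small dd t0d.
have d'0 : 0 < delta' by apply: le_lt_trans t0d.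
pose c := p 0 0 - delta'; pose d := p 0 0 + delta'.
have cd : c <= d by rewrite /c /d; move: d'0; lra.
have t0I : c <= t0 <= d by rewrite -ler_distl ltW.
have tI t : c <= t <= d -> `|t - p 0 0| < delta.
  by rewrite -ler_distl => /le_lt_trans; apply.
pose clamp t := Num.max c (Num.min d t).
have clampI t : c <= clamp t <= d by rewrite /clamp le_max lexx ge_max cd ge_min lexx.
have clampE t : c <= t <= d -> clamp t = t.
  by move=> /andP[ct td]; rewrite /clamp (min_r td) (max_r ct).
have cclamp : continuous clamp.
  by move=> t; apply: (@continuous_max R R (fun=> c)); [exact: cst_continuous|
    apply: (@continuous_min R R (fun=> d)); [exact: cst_continuous|exact: cvg_id]].
have sm : #|I|%:R * L * (d - c) <= 1 / 2.
  by apply: le_trans small; apply: ler_wpM2l; [rewrite mulr_ge0|rewrite /c /d; move: dd; lra].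
have ex b : exists Y : I -> R -> R, cube delta b -> (forall i, Y i t0 = v0 i b) /\
    forall i t, c <= t <= d -> is_derive t (1 : R) (Y i)
      (\sum_j A i j (slice b t) * Y j t + f i (slice b t)).
  (* Base points outside the cube get the zero function, so that a solution can be chosen for every
     [b]. *)
  have [Qb|nQb] := pselect (cube delta b); last by exists (fun _ _ => 0).
  have Qs t : cube delta (slice b (clamp t)) by apply: slice_ball => //; exact/tI/clampI.
  have cs (g : E -> R) : (forall x, cube delta x -> {for x, continuous g}) ->
      continuous (fun t => g (slice b (clamp t))).
    move=> cg t; apply: (@continuous_comp _ _ _ (fun t => slice b (clamp t)) g).
      by apply: (@continuous_comp _ _ _ clamp (slice b)); [exact: cclamp|exact: slice_cont_t].
    exact: cg.
  have [|||Y [Y1 Y2]] := @linear_ode_existence R I c d L t0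
    (fun i j t => A i j (slice b (clamp t))) cd t0I _ sm
    (fun i t => f i (slice b (clamp t))) (v0^~ b).
  - by move=> i j t _; have [] := hA i j _ (Qs t).
  - by move=> i j; apply: cs => x Qx; have [] := hA i j x Qx.
  - by move=> i; apply: cs => x Qx; exact: hf.
  exists Y => _; split=> // i t tcd.
  by have := Y2 i t tcd; rewrite clampE.
have [S hS] := choice ex.
have sub x : cube delta' x -> cube delta x by move=> h; exact: lt_trans dd.
have t0d2 : `|t0 - p 0 0| < delta by exact: lt_trans dd.
have Qb x : cube delta' x -> cube delta (slice x t0).
  by move=> Qx; apply: slice_ball => //; exact: sub.
(* Indexing by the foot [slice x t0] makes all points of a line use the same chosen solution. *)
exists (fun i x => S (slice x t0) i (x 0 0)).
  move=> i x Qx; apply: is_derive_of_line.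
  have [_ D] := hS _ (Qb x Qx).
  have xI : c <= x 0 0 <= d.
    rewrite -ler_distl; apply: le_trans (ltW Qx); have := coord_le_norm (x - p) 0.
    by rewrite !mxE.
  have := D i (x 0 0) xI; rewrite slice_slice slice_id => D'.
  under eq_fun => u do rewrite slice_shift0 !mxE eqxx mulr1.
  have D0 : is_derive (0 : R) (1 : R) (fun u : R => u + x 0 0) (1 : R).
    by rewrite -[1 in X in is_derive _ _ _ X]addr0; apply: is_deriveD.
  have := @is_derive1_comp _ (S (slice x t0) i) (fun u => u + x 0 0) 0.
  rewrite add0r => /(_ _ _ D' D0); rewrite mulr1; exact.
move=> i x Qx xt; have [h _] := hS _ (Qb x Qx).
by rewrite xt h -xt slice_id.
Qed.

Lemma segment_bounded c d (g : I -> R -> R) :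
  (forall i t, c <= t <= d -> {for t, continuous (g i)}) ->
  exists2 B, 0 < B & forall i t, c <= t <= d -> `|g i t| <= B.
Proof.
move=> cg; have [cd|dc] := leP c d; last first.
  by exists 1 => // i t /andP[ct td]; have := le_lt_trans (le_trans ct td) dc; rewrite ltxx.
have hj j : exists C, forall t, c <= t <= d -> `|g j t| <= C.
  have cE : {within `[c, d], continuous (fun t => `|g j t|)}.
    apply: continuous_in_subspaceT => u; rewrite inE /= in_itv /= => uI.
    by apply: cvg_norm; exact: cg.
  by have [s _ hs] := EVT_max cd cE; exists `|g j s| => t tI; apply: hs; rewrite in_itv.
have [s hs] := choice hj.
exists (\big[Order.max/1]_j s j); first by rewrite (lt_le_trans _ (bigmax_ge_id _ _ _ _)).
by move=> j t tI; apply: le_trans (le_bigmax _ _ j); exact: hs.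
Qed.

Lemma sum_small (u v : I -> R) e B : 0 < e -> 0 < B ->
  (forall j, `|u j| <= e / #|I|.+1%:R / B) -> (forall j, `|v j| <= B) ->
  `|\sum_j u j * v j| <= e.
Proof.
move=> e0 B0 hu hv; apply: le_trans (ler_norm_sum _ _ _) _.
have : \sum_j `|u j * v j| <= \sum_(j : I) e / #|I|.+1%:R.
  apply: ler_sum => j _; rewrite normrM -[leRHS](divfK (lt0r_neq0 B0)).
  by apply: ler_pM.
move=> /le_trans; apply; rewrite sumr_const -[leLHS]mulr_natr mulrAC ler_pdivrMr//.
by rewrite ler_pM2l// ler_nat.
Qed.

(** For [l != 0] a shift along [e_l] commutes with slicing, so by the mean value theorem the
    difference quotient is a value of [D_l g] on a nearby slice, and [slice_uniform] bounds the
    error for all [t] together. *)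
Lemma slice_diff_quotient (W : set E) (g : E -> R) z c d e l : l != 0 -> open W ->
  Ck 1 W g -> (forall t, c <= t <= d -> W (slice z t)) -> 0 < e ->
  \forall h \near (0 : R)^', forall t, c <= t <= d ->
    `|h^-1 * (g (slice (h *: 'e_l + z) t) - g (slice z t)) - 'D_'e_l g (slice z t)| < e.
Proof.
move=> l0 oW Cg Wz e0.
have [_ /(_ l)[dg [cdg _]]] := Cg.
have [eta eta0 heta] := @slice_uniform (fun y => 'D_'e_l g y) z c d e (fun t tI => cdg _ (Wz t tI)) e0.
have [eta' eta'0 heta'] : exists2 eta', 0 < eta' & forall s t, `|s| < eta' -> c <= t <= d ->
    W (s *: 'e_l + slice z t).
  have /compact_near_coveringP cK := @segment_compact R c d.
  have H := cK _ (nbhs (0 : R)) (fun s t => W (s *: 'e_l + slice z t)) _.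
  have /H : forall t, `[c, d]%classic t -> \forall t' \near t & s \near (0 : R),
      W (s *: 'e_l + slice z t').
    move=> t; rewrite /= in_itv /= => tI.
    have [r r0 hr] := open_norm_ball oW (Wz t tI).
    exists (ball t (r / 2), ball (0 : R) (r / 2)).
      by split; apply: nbhsx_ballx; rewrite divr_gt0.
    move=> [t' s] /= [tt' zx]; apply: hr.
    rewrite -ball_normE /= in tt'; rewrite -ball_normE /= sub0r normrN in zx.
    rewrite -addrA (le_lt_trans (ler_normD _ _))// (splitr r) ltrD//.
      rewrite normrZ (le_lt_trans _ zx)// -[leRHS]mulr1 ler_wpM2l//.
      by apply: norm_leP => // q; rewrite !mxE; case: (q == l); rewrite /= ?andbF ?normr0 ?normr1.
    apply: le_lt_trans (slice_dist _ _ _ _) _.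
    by rewrite subrr normr0 gt_max divr_gt0//= distrC.
  move=> /nbhs_ballP[r r0 hr]; exists r => // s t sr tI.
  by have := hr s; rewrite -ball_normE /= sub0r normrN => /(_ sr t); apply; rewrite /= in_itv.
apply/nbhs_ballP; exists (Num.min eta eta'); first by rewrite /= lt_min eta0.
move=> h; rewrite -ball_normE /= sub0r normrN lt_min => /andP[he he'] h0 t tI.
rewrite slice_shift//.
have [s sh|s sh ->] := @MVT_dir _ _ g (slice z t) 'e_l h.
  by apply: dg; apply: heta' tI; exact: le_lt_trans he'.
rewrite mulrA mulVf// mul1r -slice_shift//; apply: heta => //.
rewrite addrK normrZ; apply: le_lt_trans he; rewrite -[leRHS]mulr1.
apply: ler_pM => //.
by apply: norm_leP => // q; rewrite !mxE; case: (q == l); rewrite /= ?andbF ?normr0 ?normr1.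
Qed.

Lemma slice_uniform_near (g : E -> R) z c d e :
  (forall t, c <= t <= d -> {for slice z t, continuous g}) -> 0 < e ->
  \forall x \near z, forall t, c <= t <= d -> `|g (slice x t) - g (slice z t)| < e.
Proof.
move=> cg e0; have [eta eta0 h] := slice_uniform cg e0.
apply/nbhs_ballP; exists eta => // x; rewrite -ball_normE /= distrC => xz t tI.
exact: h.
Qed.

Definition admissible delta := [/\ forall i j, smooth_open (cube delta) (A i j),
  forall i j x, cube delta x -> `|A i j x| <= L, #|I|%:R * L * (2 * delta) <= 1 / 2 &
  `|t0 - p 0 0| < delta].

Lemma admissible_sub delta delta' : admissible delta -> delta' <= delta ->
  `|t0 - p 0 0| < delta' -> admissible delta'.
Proof.
move=> [h1 h2 h3 h4] dd t0d.
have sub : cube delta' `<=` cube delta by move=> x Qx; exact: lt_le_trans dd.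
split=> //.
- by move=> i j k; exact: Ck_sub sub (h1 i j k).
- by move=> i j x /sub; exact: h2.
- by apply: le_trans h3; rewrite ler_wpM2l ?mulr_ge0// ler_wpM2l.
Qed.

Lemma intermediate_radius delta z : `|t0 - p 0 0| < delta -> cube delta z ->
  exists delta', [/\ delta' < delta, `|t0 - p 0 0| < delta' & cube delta' z].
Proof.
move=> ht hz; exists ((Num.max `|t0 - p 0 0| `|z - p| + delta) / 2).
have m1 : `|t0 - p 0 0| <= Num.max `|t0 - p 0 0| `|z - p| by rewrite le_max lexx.
have m2 : `|z - p| <= Num.max `|t0 - p 0 0| `|z - p| by rewrite le_max lexx orbT.
have m3 : Num.max `|t0 - p 0 0| `|z - p| < delta by rewrite gt_max ht.
by split; rewrite /cube /=; lra.
Qed.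

Lemma slice_itv delta z t : cube delta z -> p 0 0 - delta < t < p 0 0 + delta ->
  cube delta (slice z t).
Proof. by move=> Qz tI; apply: slice_ball => //; rewrite ltr_distl. Qed.

Lemma coord0_itv delta z : cube delta z -> p 0 0 - delta <= z 0 0 <= p 0 0 + delta.
Proof.
move=> Qz; rewrite -ler_distl; apply: le_trans (ltW Qz).
by have := coord_le_norm (z - p) 0; rewrite !mxE.
Qed.

Lemma near_forall z (P : I -> E -> Prop) :
  (forall j, \forall x \near z, P j x) -> \forall x \near z, forall j, P j x.
Proof. by move=> h; apply: (@filter_forall _ _ _ (nbhs z) _). Qed.

(** The difference of the solutions on the slices through [x] and [z] solves the linear system along
    [x] with a forcing [F] made of the variation of the coefficients, small uniformly in [t]; the a
    priori bound makes the difference small. The motion from [z 0 0] to [x 0 0] along the slice of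
    [z] accounts for the other half of [e]. *)
Lemma solution_continuous delta (f Y v0 : I -> E -> R) : admissible delta ->
  (forall i x, cube delta x -> {for x, continuous (f i)}) ->
  (forall i x, cube delta x -> {for x, continuous (v0 i)}) ->
  solves delta f Y -> (forall i x, cube delta x -> x 0 0 = t0 -> Y i x = v0 i x) ->
  forall i z, cube delta z -> {for z, continuous (Y i)}.
Proof.
move=> adm cf cv0 sY Yv0 i z Qz; have [As AL small t0d] := adm.
have [delta' [dd t0d' Qz']] := intermediate_radius t0d Qz.
have [_ AL' small' _] := admissible_sub adm (ltW dd) t0d'.
pose c := p 0 0 - delta'; pose d := p 0 0 + delta'.
have d'0 : 0 < delta' by apply: le_lt_trans t0d'.
have cd : c <= d by rewrite /c /d; lra.
have t0I : c <= t0 <= d by rewrite -ler_distl ltW.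
have itv t : c <= t <= d -> p 0 0 - delta < t < p 0 0 + delta.
  by rewrite /c /d => /andP[? ?]; apply/andP; split; lra.
have sub x : cube delta' x -> cube delta x by move=> h; exact: lt_trans dd.
have Qs x t : cube delta' x -> c <= t <= d -> cube delta (slice x t).
  by move=> /sub Qx /itv; exact: slice_itv.
have dYs x j t : cube delta' x -> c <= t <= d -> is_derive t (1 : R) (fun u => Y j (slice x u))
    (\sum_k A j k (slice x t) * Y k (slice x t) + f j (slice x t)).
  by move=> Qx tI; apply: is_derive_slice; apply: sY; exact: Qs.
have [B B0 hB] := @segment_bounded c d (fun j t => Y j (slice z t))
  (fun j t tI => derive1_continuous (dYs z j t Qz' tI)).
apply/(@cvgrPdist_lt _ _ _ (nbhs z)) => e e0.
(* Chosen so that the bound [2 (1 + (d - c)) e1] of [linear_ode_gronwall] equals [e / 2]. *)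
pose e1 := e / 2 / (2 * (1 + (d - c))).
have K0 : 0 < 2 * (1 + (d - c)) by lra.
have e10 : 0 < e1 by rewrite !divr_gt0.
have e12 : 0 < e1 / 2 by rewrite divr_gt0.
have e20 : 0 < e1 / 2 / #|I|.+1%:R / B by rewrite !divr_gt0.
have nA : \forall x \near z, forall j k t, c <= t <= d ->
    `|A j k (slice x t) - A j k (slice z t)| < e1 / 2 / #|I|.+1%:R / B.
  apply: near_forall => j; apply: near_forall => k.
  by apply: slice_uniform_near e20 => t tI; exact: Ck_cont (As j k 0%N) (Qs z t Qz' tI).
have nf : \forall x \near z, forall j t, c <= t <= d ->
    `|f j (slice x t) - f j (slice z t)| < e1 / 2.
  apply: near_forall => j.
  by apply: slice_uniform_near e12 => t tI; exact: cf (Qs z t Qz' tI).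
have n0 : \forall x \near z, forall j, `|v0 j (slice x t0) - v0 j (slice z t0)| < e1.
  apply: near_forall => j.
  have t0t0 : t0 <= t0 <= t0 by rewrite lexx.
  have : \forall x \near z, forall t, t0 <= t <= t0 -> `|v0 j (slice x t) - v0 j (slice z t)| < e1.
    apply: slice_uniform_near e10 => t /andP[t1 t2].
    have -> : t = t0 by apply/le_anti; rewrite t1 t2.
    exact: cv0 (Qs z t0 Qz' t0I).
  by apply: filterS => x; exact.
near=> x.
have Qx : cube delta' x by near: x; apply: open_nbhs_nbhs; split => //; exact: cube_open.
have hA t : c <= t <= d -> forall j k, `|A j k (slice x t) - A j k (slice z t)| < e1 / 2 / #|I|.+1%:R / B.
  by move=> tI j k; move: j k t tI; near: x; exact: nA.
have hf t : c <= t <= d -> forall j, `|f j (slice x t) - f j (slice z t)| < e1 / 2.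
  by move=> tI j; move: j t tI; near: x; exact: nf.
have h0 j : `|v0 j (slice x t0) - v0 j (slice z t0)| < e1.
  by move: j; near: x; exact: n0.
have h1 : `|Y i (slice z (z 0 0)) - Y i (slice z (x 0 0))| < e / 2.
  near: x; have e2 : 0 < e / 2 by rewrite divr_gt0.
  have := derive1_continuous (dYs z i (z 0 0) Qz' (coord0_itv Qz')).
  move=> cc; have : {for z, continuous (fun x : E => Y i (slice z (x 0 0)))}.
    by apply: (@continuous_comp _ _ _ (fun x : E => x 0 0) (fun u => Y i (slice z u)));
      [exact: coord_continuous|exact: cc].
  by move=> /cvgrPdist_lt /(_ _ e2).
pose D j t := Y j (slice x t) - Y j (slice z t).
pose F j t := \sum_k (A j k (slice x t) - A j k (slice z t)) * Y k (slice z t)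
  + (f j (slice x t) - f j (slice z t)).
have := @linear_ode_gronwall R I c d L t0 (fun j k t => A j k (slice x t)) cd t0I _ _ D F e1 (ltW e10).
move=> /(_ _ _ _ _ _ i (x 0 0) (coord0_itv Qx)) h.
have {}h : `|D i (x 0 0)| <= e / 2.
  have -> : e / 2 = 2 * (1 + (d - c)) * e1 by rewrite /e1 [RHS]mulrC divfK// lt0r_neq0.
  apply: h.
  - by move=> j k t tI; exact: AL (Qs x t Qx tI).
  - by apply: le_trans small'; rewrite ler_wpM2l ?mulr_ge0// /c /d; lra.
  - move=> j t tI.
    have -> : \sum_k A j k (slice x t) * D k t + F j t =
        (\sum_k A j k (slice x t) * Y k (slice x t) + f j (slice x t)) -
        (\sum_k A j k (slice z t) * Y k (slice z t) + f j (slice z t)).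
      rewrite /F addrA -big_split /= [in RHS]opprD addrACA -sumrB; congr (_ + _).
      by apply: eq_bigr => k _; rewrite /D; ring.
    exact: is_deriveB (dYs x j t Qx tI) (dYs z j t Qz' tI).
  - move=> j; rewrite /D !Yv0 ?slice0//; [exact: ltW|exact: Qs|exact: Qs].
  - move=> j t tI; apply: le_trans (ler_normD _ _) _; rewrite [leRHS]splitr.
    apply: lerD; last exact/ltW/hf.
    by apply: (sum_small e12 B0) => k; [exact/ltW/hA|exact: hB].
rewrite slice_id in h1; rewrite /D slice_id in h.
have sub3 (a b m : R) : `|a - m| < e / 2 -> `|b - m| <= e / 2 -> `|a - b| < e.
  move=> a1 b1; rewrite (splitr e) -(subrKA m).
  by apply: le_lt_trans (ler_normD _ _) _; apply: ltr_leD => //; rewrite distrC.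
exact: sub3 h1 h.
Unshelve. all: by end_near. Qed.

(** [Z] solves the system formally differentiated along [e_l], with differentiated initial values.
    The difference quotient of [Y] minus [Z] then solves a linear system with forcing and initial
    values tending to 0 with [h], and so tends to 0. *)
Lemma solution_derivable delta delta' (f Y Z v0 : I -> E -> R) l : l != 0 -> admissible delta ->
  delta' < delta -> `|t0 - p 0 0| < delta' ->
  (forall i, Ck 1 (cube delta) (f i)) -> (forall i, Ck 1 (cube delta) (v0 i)) ->
  solves delta f Y -> (forall i x, cube delta x -> x 0 0 = t0 -> Y i x = v0 i x) ->
  solves delta' (fun i x => \sum_j 'D_'e_l (A i j) x * Y j x + 'D_'e_l (f i) x) Z ->
  (forall i x, cube delta' x -> x 0 0 = t0 -> Z i x = 'D_'e_l (v0 i) x) ->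
  forall i z, cube delta' z -> is_derive z 'e_l (Y i) (Z i z).
Proof.
move=> l0 adm dd t0d' cf cv0 sY Yv0 sZ Zv0 i z Qz; have [As AL small t0d] := adm.
have [_ _ small' _] := admissible_sub adm (ltW dd) t0d'.
have [delta2 [dd2 t0d2 Qz2]] := intermediate_radius t0d' Qz.
pose c := p 0 0 - delta2; pose d := p 0 0 + delta2.
have d'0 : 0 < delta2 by apply: le_lt_trans t0d2.
have cd : c <= d by rewrite /c /d; lra.
have t0I : c <= t0 <= d by rewrite -ler_distl ltW.
have itv t : c <= t <= d -> p 0 0 - delta' < t < p 0 0 + delta'.
  by rewrite /c /d => /andP[? ?]; apply/andP; split; lra.
have sub x : cube delta' x -> cube delta x by move=> h; exact: lt_trans dd.
have sub2 x : cube delta2 x -> cube delta' x by move=> h; exact: lt_trans dd2.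
have Qs' x t : cube delta' x -> c <= t <= d -> cube delta' (slice x t).
  by move=> Qx /itv; exact: slice_itv.
have Qs x t : cube delta' x -> c <= t <= d -> cube delta (slice x t).
  by move=> Qx tI; exact/sub/Qs'.
have dYs x j t : cube delta' x -> c <= t <= d -> is_derive t (1 : R) (fun u => Y j (slice x u))
    (\sum_k A j k (slice x t) * Y k (slice x t) + f j (slice x t)).
  by move=> Qx tI; apply: is_derive_slice; apply: sY; exact: Qs.
have dZs x j t : cube delta' x -> c <= t <= d -> is_derive t (1 : R) (fun u => Z j (slice x u))
    (\sum_k A j k (slice x t) * Z k (slice x t) +
     (\sum_k 'D_'e_l (A j k) (slice x t) * Y k (slice x t) + 'D_'e_l (f j) (slice x t))).
  by move=> Qx tI; apply: (@is_derive_slice (Z j)); apply: sZ; exact: Qs'.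
have [B B0 hB] := @segment_bounded c d (fun j t => Y j (slice z t))
  (fun j t tI => derive1_continuous (dYs z j t Qz tI)).
have [B' B'0 hB'] := @segment_bounded c d (fun j t => Z j (slice z t))
  (fun j t tI => derive1_continuous (dZs z j t Qz tI)).
suff H : (fun h : R => h^-1 *: (Y i (h *: 'e_l + z) - Y i z)) @ (0 : R)^' --> Z i z.
  by apply: DeriveDef; [apply/cvg_ex; exists (Z i z)|exact/cvg_lim].
apply/cvgrPdist_lt => e e0.
pose e1 := e / 2 / (2 * (1 + (d - c))).
have K0 : 0 < 2 * (1 + (d - c)) by lra.
have e10 : 0 < e1 by rewrite !divr_gt0.
have e3 : 0 < e1 / 3 by rewrite divr_gt0.
have e4 : 0 < e1 / 3 / #|I|.+1%:R / B by rewrite !divr_gt0.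
have e5 : 0 < e1 / 3 / #|I|.+1%:R / B' by rewrite !divr_gt0.
have cont (P : E -> Prop) : (\forall x \near z, P x) -> \forall h \near (0 : R)^', P (h *: 'e_l + z).
  move=> /nbhs_ballP[r r0 hr]; apply/nbhs_ballP; exists r => // u.
  rewrite -ball_normE /= sub0r normrN => ur _; apply: hr.
  rewrite -ball_normE /= distrC addrK normrZ; apply: le_lt_trans ur.
  rewrite -[leRHS]mulr1; apply: ler_pM => //.
  by apply: norm_leP => // q; rewrite !mxE; case: (q == l); rewrite /= ?andbF ?normr0 ?normr1.
have nA : \forall h \near (0 : R)^', forall j k t, c <= t <= d ->
    `|A j k (slice (h *: 'e_l + z) t) - A j k (slice z t)| < e1 / 3 / #|I|.+1%:R / B'.
  apply: filter_forall => j; apply: filter_forall => k.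
  apply: (cont _ (slice_uniform_near _ e5)) => t tI.
  exact: Ck_cont (As j k 0%N) (Qs z t Qz tI).
have ndA : \forall h \near (0 : R)^', forall j k t, c <= t <= d ->
    `|h^-1 * (A j k (slice (h *: 'e_l + z) t) - A j k (slice z t)) -
    'D_'e_l (A j k) (slice z t)| < e1 / 3 / #|I|.+1%:R / B.
  apply: filter_forall => j; apply: filter_forall => k.
  by apply: slice_diff_quotient l0 (@cube_open delta) (As j k 1%N) _ e4 => t tI; exact: Qs.
have nf : \forall h \near (0 : R)^', forall j t, c <= t <= d ->
    `|h^-1 * (f j (slice (h *: 'e_l + z) t) - f j (slice z t)) - 'D_'e_l (f j) (slice z t)| < e1 / 3.
  apply: filter_forall => j.
  by apply: slice_diff_quotient l0 (@cube_open delta) (cf j) _ e3 => t tI; exact: Qs.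
have n0 : \forall h \near (0 : R)^', forall j t, c <= t <= d ->
    `|h^-1 * (v0 j (slice (h *: 'e_l + z) t) - v0 j (slice z t)) - 'D_'e_l (v0 j) (slice z t)| < e1.
  apply: filter_forall => j.
  by apply: slice_diff_quotient l0 (@cube_open delta) (cv0 j) _ e10 => t tI; exact: Qs.
near=> h; set x := h *: 'e_l + z.
have Qx : cube delta2 x.
  rewrite /x; near: h; apply: cont; apply: open_nbhs_nbhs; split => //; exact: cube_open.
have hA0 t : c <= t <= d -> forall j k, `|A j k (slice x t) - A j k (slice z t)| < e1 / 3 / #|I|.+1%:R / B'.
  by move=> tI j k; move: j k t tI; rewrite /x; near: h; exact: nA.
have hdA t : c <= t <= d -> forall j k, `|h^-1 * (A j k (slice x t) - A j k (slice z t)) -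
    'D_'e_l (A j k) (slice z t)| < e1 / 3 / #|I|.+1%:R / B.
  by move=> tI j k; move: j k t tI; rewrite /x; near: h; exact: ndA.
have hdf t : c <= t <= d -> forall j, `|h^-1 * (f j (slice x t) - f j (slice z t)) -
    'D_'e_l (f j) (slice z t)| < e1 / 3.
  by move=> tI j; move: j t tI; rewrite /x; near: h; exact: nf.
have h0 j : `|h^-1 * (v0 j (slice x t0) - v0 j (slice z t0)) - 'D_'e_l (v0 j) (slice z t0)| < e1.
  by move: t0I; move: (t0) => t; move: j t; rewrite /x; near: h; exact: n0.
pose D j t := h^-1 * (Y j (slice x t) - Y j (slice z t)) - Z j (slice z t).
(* The three terms are the errors in the difference quotient of [A], in [A] itself and in the
   difference quotient of [f], each allotted a third of [e1]. *)
pose F j t := \sum_k (h^-1 * (A j k (slice x t) - A j k (slice z t)) - 'D_'e_l (A j k) (slice z t)) * Y k (slice z t)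
  + \sum_k (A j k (slice x t) - A j k (slice z t)) * Z k (slice z t)
  + (h^-1 * (f j (slice x t) - f j (slice z t)) - 'D_'e_l (f j) (slice z t)).
have x0 : x 0 0 = z 0 0 by rewrite /x !mxE eqxx /= (eq_sym 0 l) (negbTE l0) mulr0 add0r.
have := @linear_ode_gronwall R I c d L t0 (fun j k t => A j k (slice x t)) cd t0I _ _ D F e1 (ltW e10).
move=> /(_ _ _ _ _ _ i (z 0 0) (coord0_itv Qz2)) H.
have {}H : `|D i (z 0 0)| <= e / 2.
  have -> : e / 2 = 2 * (1 + (d - c)) * e1 by rewrite /e1 [RHS]mulrC divfK// lt0r_neq0.
  apply: H.
  - by move=> j k t tI; exact: AL (Qs x t (sub2 _ Qx) tI).
  - by apply: le_trans small'; rewrite ler_wpM2l ?mulr_ge0// /c /d; lra.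
  - move=> j t tI.
    have -> : \sum_k A j k (slice x t) * D k t + F j t =
        h^-1 * ((\sum_k A j k (slice x t) * Y k (slice x t) + f j (slice x t)) -
        (\sum_k A j k (slice z t) * Y k (slice z t) + f j (slice z t))) -
        (\sum_k A j k (slice z t) * Z k (slice z t) +
     (\sum_k 'D_'e_l (A j k) (slice z t) * Y k (slice z t) + 'D_'e_l (f j) (slice z t))).
      have -> (a b a' b' u v w : R) : h^-1 * ((a + b) - (a' + b')) - (u + (v + w)) =
          (h^-1 * a - h^-1 * a' - u - v) + (h^-1 * (b - b') - w) by ring.
      rewrite /F !addrA; congr (_ + _ + _).
      rewrite -!big_split /= !mulr_sumr -!sumrB.
      by apply: eq_bigr => k _; rewrite /D; ring.
    have dYB := is_deriveB (dYs x j t (sub2 _ Qx) tI) (dYs z j t Qz tI).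
    exact: is_deriveB (is_deriveZ h^-1 dYB) (dZs z j t Qz tI).
  - move=> j; rewrite /D !Yv0 ?Zv0 ?slice0//; [exact/ltW/h0|exact: Qs'|exact: Qs|].
    exact: Qs (sub2 _ Qx) _.
  - move=> j t tI; apply: le_trans (ler_normD _ _) _.
    have -> : e1 = e1 / 3 + e1 / 3 + e1 / 3 by lra.
    apply: lerD; last exact/ltW/hdf.
    apply: le_trans (ler_normD _ _) _; apply: lerD.
      by apply: (sum_small e3 B0) => k; [exact/ltW/hdA|exact: hB].
    by apply: (sum_small e3 B'0) => k; [exact/ltW/hA0|exact: hB'].
rewrite distrC; move: H; rewrite /D slice_id -{1}x0 slice_id.
by move=> /le_lt_trans; apply; rewrite ltr_pdivrMr// ltr_pMr// ltr1n.
Unshelve. all: by end_near. Qed.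

Lemma Ck_local k (W : set E) (g : E -> R) : open W ->
  (forall x, W x -> exists W', [/\ open W', W' x & Ck k W' g]) -> Ck k W g.
Proof.
move=> oW; elim: k g => [|k IH] g h.
  by split=> // x /h[W' [_ W'x Cg]]; exact: Ck_cont Cg W'x.
split=> [x /h[W' [_ W'x Cg]]|l]; first exact: Ck_cont Cg W'x.
split=> [x /h[W' [_ W'x [_ /(_ l)[+ _]]]]|]; first exact.
by apply: IH => x /h[W' [oW' W'x [_ /(_ l)[_ Cg]]]]; exists W'.
Qed.

(** Induction on [k], for all right-hand sides. In direction [e_0] the equation itself gives the
    derivative; in another direction the derivative is the solution [Z] of the differentiated
    system, whose forcing involves [Y] and is [C^k] by induction. [Z] is constructed on smaller
    cubes, hence the local gluing. *)
Lemma solution_Ck k delta (f Y v0 : I -> E -> R) : admissible delta ->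
  (forall i, Ck k (cube delta) (f i)) -> (forall i, Ck k (cube delta) (v0 i)) ->
  solves delta f Y -> (forall i x, cube delta x -> x 0 0 = t0 -> Y i x = v0 i x) ->
  forall i, Ck k (cube delta) (Y i).
Proof.
elim: k delta f Y v0 => [|k IH] delta f Y v0 adm cf cv0 sY Yv0 i.
  have H := solution_continuous adm _ _ sY Yv0.
  split=> // x Qx; apply: H => // j y Qy; first exact: Ck_cont (cf j) Qy.
  exact: Ck_cont (cv0 j) Qy.
have CY j : Ck k (cube delta) (Y j).
  by apply: IH adm _ _ sY Yv0 j => j; apply: CkS.
have [As AL small t0d] := adm.
have oQ := @cube_open delta.
split=> [x Qx|l]; first exact: Ck_cont (CY i) Qx.
have [->|l0] := eqVneq l 0.
  split=> [x Qx|]; first by have [] := sY i x Qx.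
  apply: (Ck_eq (f := fun x => \sum_j A i j x * Y j x + f i x)) => //.
    by move=> x Qx; have [_ ->] := sY i x Qx.
  apply: CkD => //; last exact: CkS.
  by apply: Ck_sum => // j _; apply: CkM => //; exact: As.
have main x : cube delta x -> exists delta', [/\ cube delta' x, forall y, cube delta' y ->
    derivable (Y i) y 'e_l & Ck k (cube delta') (fun y => 'D_'e_l (Y i) y)].
  move=> Qx; have [delta' [dd t0d' Qx']] := intermediate_radius t0d Qx.
  have sub : cube delta' `<=` cube delta by move=> y Qy; exact: lt_trans dd.
  have Cdf j : Ck k (cube delta) (fun x => 'D_'e_l (f j) x) by have [_ /(_ l)[]] := cf j.
  have CF j : Ck k (cube delta) (fun x => \sum_m 'D_'e_l (A j m) x * Y m x + 'D_'e_l (f j) x).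
    apply: CkD => //; apply: Ck_sum => // m _; apply: CkM => //.
    by have [_ /(_ l)[]] := As j m k.+1.
  have [||Z sZ Zv0] := @parametric_existence delta delta'
    (fun i x => \sum_j 'D_'e_l (A i j) x * Y j x + 'D_'e_l (f i) x)
    (fun j x => 'D_'e_l (v0 j) x) _ _ small dd t0d'.
  - by move=> j m y Qy; split; [exact: Ck_cont (As j m 0%N) Qy|exact: AL].
  - by move=> j y Qy; exact: Ck_cont (CF j) Qy.
  have D y : cube delta' y -> is_derive y 'e_l (Y i) (Z i y).
    apply: solution_derivable l0 adm dd t0d' _ _ sY Yv0 sZ Zv0 i y.
      by move=> j; exact: Ck_leq (cf j).
    by move=> j; exact: Ck_leq (cv0 j).
  exists delta'; split=> //; first by move=> y /D[].
  apply: (Ck_eq (f := Z i)); first exact: cube_open.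
    by move=> y /D[_ ->].
  apply: (IH _ _ _ _ (admissible_sub adm (ltW dd) t0d') _ _ sZ Zv0) => j.
    exact: Ck_sub sub (CF j).
  by apply: Ck_sub sub _; have [_ /(_ l)[]] := cv0 j.
split=> [x /main[delta' [Qx h _]]|]; first exact: h.
apply: Ck_local => // x /main[delta' [Qx _ h]].
by exists (cube delta'); split=> //; exact: cube_open.
Qed.

End fixed_coefficients.

(** The initial slice [x_0 = t0] lies where [X] is known; the system is solved from there across
    [x_0 = 0], and its solution coincides with [X] for [x_0 > 0] by uniqueness on each slice. *)
Lemma linear_ode_extension p delta (X : I -> E -> R) (A : I -> I -> E -> R) :
  0 < delta -> p 0 0 = 0 -> (forall i j, smooth_open (cube p delta) (A i j)) ->
  (forall i, smooth_open (cube p delta `&` [set x | 0 < x 0 0]) (X i)) ->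
  (forall i x, cube p delta x -> 0 < x 0 0 -> 'D_'e_0 (X i) x = \sum_j A i j x * X j x) ->
  exists2 delta', 0 < delta' <= delta & exists Y : I -> E -> R,
    (forall i, smooth_open (cube p delta') (Y i)) /\
    forall i x, cube p delta' x -> 0 < x 0 0 -> Y i x = X i x.
Proof.
move=> delta0 p0 As Xs dX.
have Qp : cube p delta p by rewrite /cube /= subrr normr0.
have [d1 d10 hd1] : exists2 d, 0 < d & forall i j x, `|x - p| < d -> `|A i j x - A i j p| < 1.
  apply: (@exists_min _ _ (fun i d => forall j x, `|x - p| < d -> `|A i j x - A i j p| < 1)).
    by move=> i d d' Pd _ d'd j y yx; apply: Pd; exact: lt_le_trans d'd.
  move=> i; apply: (@exists_min _ _ (fun j d => forall x, `|x - p| < d -> `|A i j x - A i j p| < 1)).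
    by move=> j d d' Pd _ d'd y yx; apply: Pd; exact: lt_le_trans d'd.
  by move=> j; apply: continuous_norm_ball => //; exact: Ck_cont (As i j 0%N) Qp.
(* Bounds every coefficient wherever it differs from its value at [p] by less than 1; the summand 1
   also keeps [L] positive. *)
pose L := 1 + \sum_i \sum_j `|A i j p|.
have Lij i j : 1 + `|A i j p| <= L.
  rewrite lerD2l (bigD1 i)//= (bigD1 j)//= -addrA lerDl addr_ge0// sumr_ge0// => i' _.
  by rewrite sumr_ge0.
have L1 : 1 <= L by rewrite lerDl sumr_ge0// => i _; rewrite sumr_ge0.
pose N : R := #|I|.+1%:R * L.
have N1 : 0 < N by rewrite mulr_gt0// (lt_le_trans _ L1).
(* The factor 4 gives [N * (2 * delta') <= 1 / 2], the smallness required of a time interval of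
   length [2 * delta']. *)
pose delta' := Num.min (Num.min delta d1) (4 * N)^-1.
have d'0 : 0 < delta' by rewrite !lt_min delta0 d10 invr_gt0 mulr_gt0.
have d'd : delta' <= delta by rewrite !ge_min lexx.
have d'd1 : delta' <= d1 by rewrite !ge_min lexx orbT.
have d'N : delta' <= (4 * N)^-1 by rewrite !ge_min lexx !orbT.
pose t0 := delta' / 2.
have t00 : 0 < t0 by rewrite divr_gt0.
have t0d : `|t0 - p 0 0| < delta' by rewrite p0 subr0 gtr0_norm// /t0; lra.
have sub : cube p delta' `<=` cube p delta by move=> x Qx; exact: lt_le_trans d'd.
have adm : admissible p L t0 A delta'.
  split=> //.
  - by move=> i j k; exact: Ck_sub sub (As i j k).
  - move=> i j x Qx; apply: le_trans (Lij i j); rewrite -(subrK (A i j p) (A i j x)).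
    by apply: le_trans (ler_normD _ _) _; rewrite lerD2r ltW// hd1// (lt_le_trans Qx).
  - have NL : #|I|%:R * L <= N by rewrite ler_pM// ?ler_nat// (le_trans _ L1).
    have Nd : N * delta' <= 1 / 4.
      by rewrite mulrC -ler_pdivlMr// (le_trans d'N)// invfM div1r.
    apply: (@le_trans _ _ (N * (2 * delta'))); last by lra.
    by rewrite ler_wpM2r// mulr_ge0// ltW.
(* Strictly between [t0 = delta' / 2] and [delta']: the initial slice still meets the smaller cube,
   and existence has its margin. *)
pose delta2 := 3 / 4 * delta'.
have d20 : 0 < delta2 by rewrite /delta2; lra.
have d2d : delta2 < delta' by rewrite /delta2; lra.
have t0d2 : `|t0 - p 0 0| < delta2 by rewrite p0 subr0 gtr0_norm// /t0 /delta2; lra.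
have adm2 := admissible_sub (le_trans ler01 L1) adm (ltW d2d) t0d2.
have sub2 x : cube p delta2 x -> cube p delta' x by move=> h; exact: lt_trans d2d.
pose v0 i x := X i (slice x t0).
have [As' AL small _] := adm.
have [||Y sY Yv0] := @parametric_existence p L t0 A (le_trans ler01 L1) delta' delta2
    (fun _ _ => 0) v0 _ _ small d2d t0d2.
  by move=> i j x Qx; split; [exact: Ck_cont (As' i j 0%N) Qx|exact: AL].
  by move=> i x _; exact: cst_continuous.
exists delta2; first by rewrite d20 (le_trans (ltW d2d)).
exists Y; split=> [i k|i x Qx x0].
  apply: (solution_Ck (le_trans ler01 L1) adm2 _ _ sY Yv0) => j.
    exact: Ck_cst.
  apply: (@Ck_comp _ _ k _ _ (X j) (slice^~ t0) (@cube_open p delta2) _ _ _ (Xs j k)).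
  - apply: openI; first exact: cube_open.
    apply: (@open_comp _ _ (fun x : E => x 0 0) [set t | 0 < t]); last exact: open_gt.
    by move=> x _; exact: coord_continuous.
  - move=> l; have [->|l0] := eqVneq l 0.
      apply: (Ck_eq (f := fun=> t0)); [exact: cube_open|by move=> x _; rewrite slice0|exact: Ck_cst].
    apply: (Ck_eq (f := fun x => x 0 l)); [exact: cube_open|by move=> x _; rewrite sliceE|].
    by apply: Ck_coord; exact: cube_open.
  - move=> x Qx; split; last by rewrite /= slice0.
    by apply: sub; apply: slice_ball => //; exact: sub2.
(* The times between [x 0 0] and [t0] are positive, so [X] solves the equation on this whole
   interval. *)
pose c := Num.min (x 0 0) t0; pose d := Num.max (x 0 0) t0.
have xI : `|x 0 0 - p 0 0| < delta2.
  by apply: le_lt_trans Qx; have := coord_le_norm (x - p) 0; rewrite !mxE.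
have hh t : c <= t <= d -> 0 < t /\ `|t - p 0 0| < delta2.
  rewrite /c /d ge_min le_max => /andP[h1 h2].
  move: xI t0d2; rewrite p0 !subr0 !ltr_norml => /andP[? ?] /andP[? ?].
  by case/orP: h1 => ?; case/orP: h2 => ?; split; rewrite ?ltr_norml; try lra; apply/andP; split; lra.
have cI : c <= x 0 0 <= d by rewrite /c /d ge_min le_max !lexx.
have t0I : c <= t0 <= d by rewrite /c /d ge_min le_max !lexx !orbT.
have cd : c <= d by have /andP[h1 h2] := cI; exact: le_trans h2.
have Qs t : c <= t <= d -> cube p delta2 (slice x t).
  by move=> /hh[_ td]; apply: slice_ball.
have dX' j t : c <= t <= d -> is_derive t (1 : R) (fun u => X j (slice x u))
    (\sum_k A j k (slice x t) * X k (slice x t)).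
  move=> tI; apply: is_derive_slice; have Q1 := sub _ (sub2 _ (Qs t tI)).
  have s0 : 0 < slice x t 0 0 by rewrite slice0; have [] := hh t tI.
  rewrite -dX//; apply/derivableP; have [_ /(_ 0)[+ _]] := Xs j 1%N; apply.
  by split.
have dY' j t : c <= t <= d -> is_derive t (1 : R) (fun u => Y j (slice x u))
    (\sum_k A j k (slice x t) * Y k (slice x t) + 0).
  by move=> tI; apply: is_derive_slice; apply: sY; exact: Qs.
have := @linear_ode_gronwall R I c d L t0 (fun j k t => A j k (slice x t)) cd t0I _ _
  (fun j t => Y j (slice x t) - X j (slice x t)) (fun _ _ => 0) 0 (lexx 0).
move=> /(_ _ _ _ _ _ i (x 0 0) cI); rewrite mulr0 slice_id => H.
apply/subr0_eq/normr0_eq0/le_anti/andP; split=> //; apply: H.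
- by move=> j k t tI; apply: AL; exact/sub2/Qs.
- apply: le_trans small; rewrite ler_wpM2l ?mulr_ge0 ?(le_trans ler01 L1)//.
  have dI : c <= d <= d by rewrite cd lexx.
  have cI' : c <= c <= d by rewrite cd lexx.
  move: (hh _ dI) (hh _ cI') => [_ +] [_].
  by rewrite p0 !subr0 !ltr_norml => /andP[? ?] /andP[? ?]; lra.
- move=> j t tI.
  have -> : \sum_k A j k (slice x t) * (Y k (slice x t) - X k (slice x t)) + 0 =
     (\sum_k A j k (slice x t) * Y k (slice x t) + 0) - \sum_k A j k (slice x t) * X k (slice x t).
    by rewrite !addr0 -sumrB; apply: eq_bigr => k _; rewrite mulrBr.
  exact: is_deriveB (dY' j t tI) (dX' j t tI).
- move=> j; rewrite Yv0 ?slice0//; last exact: Qs.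
  by rewrite /v0 slice_slice subrr normr0.
- by move=> j t _; rewrite normr0.
Qed.

End linear_ode_parameters.

(** * Calculus on the half-space *)

Section smooth_on_theory.
Context {R : realType} {n : nat}.
Local Notation E := 'rV[R]_n.+1.
Implicit Types (A W V : set E) (f g : E -> R) (x y : E) (j : 'I_n.+1).

Lemma smooth_on_eq A f g : (forall x, A x -> f x = g x) -> smooth_on A f -> smooth_on A g.
Proof.
move=> fg h x Ax; have [W [u [oW Wx su uf]]] := h x Ax.
by exists W, u; split=> // y Wy Ay; rewrite uf ?fg.
Qed.

Lemma smooth_on_sub A A' f : A' `<=` A -> smooth_on A f -> smooth_on A' f.
Proof.
move=> sA h x /sA Ax; have [W [u [oW Wx su uf]]] := h x Ax.
by exists W, u; split=> // y Wy /sA Ay; rewrite uf.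
Qed.

Lemma smooth_on_local A f :
  (forall x, A x -> exists V, [/\ open V, V x & smooth_on (A `&` V) f]) -> smooth_on A f.
Proof.
move=> h x Ax; have [V [oV Vx hV]] := h x Ax.
have [W [u [oW Wx su uf]]] := hV x (conj Ax Vx).
exists (W `&` V), u; split=> //; first exact: openI.
  by move=> k; apply: Ck_sub (su k) => y [].
by move=> y [Wy Vy] Ay; apply: uf.
Qed.

Lemma smooth_open_on W f : open W -> smooth_open W f -> smooth_on W f.
Proof. by move=> oW sf x Wx; exists W, f; split. Qed.

Lemma smooth_on_open A f : open A -> smooth_on A f -> smooth_open A f.
Proof.
move=> oA h k; apply: Ck_local => // x Ax; have [W [u [oW Wx su uf]]] := h x Ax.
exists (W `&` A); split=> //; first exact: openI.
apply: (Ck_eq (f := u)); first exact: openI.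
  by move=> y [Wy Ay]; exact: uf.
by apply: Ck_sub (su k) => y [].
Qed.

Lemma smooth_on_cst A (c : R) : smooth_on A (fun=> c).
Proof. by move=> x _; exists setT, (fun=> c); split=> //; [exact: openT|move=> k; exact: Ck_cst]. Qed.

Lemma smooth_on_lift2 A f g (op : R -> R -> R) :
  (forall k W u v, open W -> Ck k W u -> Ck k W v -> Ck k W (fun x : E => op (u x) (v x))) ->
  smooth_on A f -> smooth_on A g -> smooth_on A (fun x => op (f x) (g x)).
Proof.
move=> hop hf hg x Ax; have [W [u [oW Wx su uf]]] := hf x Ax.
have [W' [v [oW' Wx' sv vg]]] := hg x Ax.
have oWW := openI oW oW'.
exists (W `&` W'), (fun x => op (u x) (v x)); split=> //.
  move=> k; apply: hop => //; [apply: Ck_sub (su k)|apply: Ck_sub (sv k)];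
  by move=> y [].
by move=> y [Wy Wy'] Ay; rewrite uf// vg.
Qed.

Lemma smooth_onD A f g : smooth_on A f -> smooth_on A g -> smooth_on A (fun x => f x + g x).
Proof. by apply: smooth_on_lift2 => k W u v; exact: CkD. Qed.

Lemma smooth_onM A f g : smooth_on A f -> smooth_on A g -> smooth_on A (fun x => f x * g x).
Proof. by apply: smooth_on_lift2 => k W u v; exact: CkM. Qed.

Lemma smooth_onB A f g : smooth_on A f -> smooth_on A g -> smooth_on A (fun x => f x - g x).
Proof. by apply: (@smooth_on_lift2 _ _ _ (fun a b => a - b)) => k W u v; exact: CkB. Qed.

Lemma smooth_onN A f : smooth_on A f -> smooth_on A (fun x => - f x).
Proof.
move=> hf; apply: (smooth_on_eq (f := fun x => 0 - f x)); first by move=> x _; rewrite sub0r.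
by apply: smooth_onB => //; exact: smooth_on_cst.
Qed.

Lemma smooth_on_sum A (I : Type) (s : seq I) (P : pred I) (F : I -> E -> R) :
  (forall i, P i -> smooth_on A (F i)) -> smooth_on A (fun x => \sum_(i <- s | P i) F i x).
Proof.
move=> h; elim: s => [|i s IH].
  by apply: (smooth_on_eq _ (@smooth_on_cst A 0)) => x _; rewrite big_nil.
have [Pi|nPi] := boolP (P i).
  by apply: (smooth_on_eq _ (smooth_onD (h _ Pi) IH)) => x _; rewrite big_cons Pi.
by apply: (smooth_on_eq _ IH) => x _; rewrite big_cons (negbTE nPi).
Qed.

Lemma smooth_on_prod A (I : Type) (s : seq I) (P : pred I) (F : I -> E -> R) :
  (forall i, P i -> smooth_on A (F i)) -> smooth_on A (fun x => \prod_(i <- s | P i) F i x).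
Proof.
move=> h; elim: s => [|i s IH].
  by apply: (smooth_on_eq _ (@smooth_on_cst A 1)) => x _; rewrite big_nil.
have [Pi|nPi] := boolP (P i).
  by apply: (smooth_on_eq _ (smooth_onM (h _ Pi) IH)) => x _; rewrite big_cons Pi.
by apply: (smooth_on_eq _ IH) => x _; rewrite big_cons (negbTE nPi).
Qed.

(* [op] is only required to preserve smoothness on the open set where its argument lies in [D] *)
Lemma smooth_on_lift1 A f (D : set R) (op : R -> R) : open D ->
  (forall k W u, open W -> (forall x, W x -> D (u x)) -> Ck k W u -> Ck k W (fun x : E => op (u x))) ->
  (forall x, A x -> D (f x)) -> smooth_on A f -> smooth_on A (fun x => op (f x)).
Proof.
move=> oD hop fD hf x Ax; have [W [u [oW Wx su uf]]] := hf x Ax.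
have [r r0 hr] : exists2 r : R, 0 < r & forall y, `|y - x| < r -> W y /\ D (u y).
  have [r1 r10 hr1] := open_norm_ball oW Wx.
  have /nbhs_ballP[e e0 he] : nbhs (u x) D.
    by apply: open_nbhs_nbhs; split=> //; rewrite uf//; exact: fD.
  have [r2 r20 hr2] := continuous_norm_ball (Ck_cont (su 0%N) Wx) e0.
  exists (Num.min r1 r2); first by rewrite lt_min r10.
  move=> y; rewrite lt_min => /andP[y1 y2]; split; first exact: hr1.
  by apply: he; rewrite -ball_normE /= distrC; exact: hr2.
exists (cube x r), (fun y => op (u y)); split; first exact: cube_open.
- by rewrite /cube /= subrr normr0.
- move=> k; apply: hop => [||]; first exact: cube_open.
    by move=> y /hr[].
  by apply: Ck_sub (su k) => y /hr[].
- by move=> y /hr[Wy _] Ay; rewrite uf.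
Qed.

Lemma smooth_onV A f : (forall x, A x -> f x != 0) -> smooth_on A f ->
  smooth_on A (fun x => (f x)^-1).
Proof.
move=> f0; apply: (@smooth_on_lift1 _ _ [set t | t != 0]) => //.
by move=> k W u oW uD; exact: CkV.
Qed.

Lemma smooth_on_expR A f : smooth_on A f -> smooth_on A (fun x => expR (f x)).
Proof.
apply: (@smooth_on_lift1 _ _ setT) => //; first exact: openT.
by move=> k W u oW _; exact: Ck_expR.
Qed.

Lemma smooth_on_ln A f : (forall x, A x -> 0 < f x) -> smooth_on A f ->
  smooth_on A (fun x => ln (f x)).
Proof.
move=> f0; apply: (@smooth_on_lift1 _ _ [set t | 0 < t]) => //; by move=> k W u oW uD; exact: Ck_ln.
Qed.

(** The components of [F] are extended separately and the finitely many domains intersected. The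
    extended map may leave [A'], which is why it is composed with an extension of [f]; continuity
    keeps its values in the domain of that extension. *)
Lemma smooth_on_comp A A' f (F : E -> E) : (forall j, smooth_on A (fun x => F x 0 j)) ->
  (forall x, A x -> A' (F x)) -> smooth_on A' f -> smooth_on A (f \o F).
Proof.
move=> sF FA sf x Ax.
have [W' [g [oW' W'x sg gf]]] := sf _ (FA _ Ax).
have [G hG] : {G : 'I_n.+1 -> set E * (E -> R) & forall j, [/\ open (G j).1, (G j).1 x,
    smooth_open (G j).1 (G j).2 & forall y, (G j).1 y -> A y -> (G j).2 y = F y 0 j]}.
  apply: (@choice _ _ (fun j G => [/\ open G.1, G.1 x,
    smooth_open G.1 G.2 & forall y, G.1 y -> A y -> G.2 y = F y 0 j])) => j.
  by have [W [u [h1 h2 h3 h4]]] := sF j x Ax; exists (W, u).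
pose Ft y : E := \row_j (G j).2 y.
have Ftx : Ft x = F x.
  by apply/rowP => j; rewrite mxE; have [_ h1 _ h2] := hG j; exact: h2.
have [r1 r10 hr1] : exists2 r : R, 0 < r & forall j y, `|y - x| < r -> (G j).1 y.
  apply: (@exists_min _ _ (fun j r => forall y, `|y - x| < r -> (G j).1 y)).
    by move=> i d d' Pd _ d'd y yx; apply: Pd; exact: lt_le_trans d'd.
  by move=> j; have [h1 h2 _ _] := hG j; exact: open_norm_ball.
have cFt : {for x, continuous Ft}.
  apply: continuous_coordP => j; have [oG Gx sG _] := hG j.
  apply: (@continuous_eq_at _ _ (G j).1 (G j).2) => //; first by move=> y _; rewrite mxE.
  exact: Ck_cont (sG 0%N) Gx.
have /nbhs_ballP[r2 r20 hr2] : \forall y \near x, W' (Ft y).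
  by apply: cFt; apply: open_nbhs_nbhs; rewrite Ftx.
have r0 : 0 < Num.min r1 r2 by rewrite lt_min r10.
have sub y : cube x (Num.min r1 r2) y -> (forall j, (G j).1 y) /\ W' (Ft y).
  rewrite /cube /= lt_min => /andP[y1 y2]; split; first by move=> j; exact: hr1.
  by apply: hr2; rewrite -ball_normE /= distrC.
exists (cube x (Num.min r1 r2)), (g \o Ft); split; first exact: cube_open.
- by rewrite /cube /= subrr normr0.
- move=> k; apply: (Ck_comp (@cube_open _ _ _ _) oW' _ _ (sg k)).
    move=> j; apply: (Ck_eq (f := (G j).2)); first exact: cube_open.
      by move=> y _; rewrite mxE.
    by have [_ _ sG _] := hG j; apply: Ck_sub (sG k) => y /sub[].
  by move=> y /sub[].
- move=> y /sub[Gy W'y] Ay /=.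
  have FtF : Ft y = F y by apply/rowP => j; rewrite mxE; have [_ _ _ h2] := hG j; exact: h2.
  by rewrite -FtF; apply: gf => //; rewrite FtF; exact: FA.
Qed.

Definition rel_open A := exists2 V, open V & A = V `&` halfspace R n.

Lemma rel_open_ball A x : rel_open A -> A x ->
  exists2 r : R, 0 < r & forall y, `|y - x| < r -> 0 <= y 0 0 -> A y.
Proof.
move=> [V oV ->] [Vx _]; have [r r0 hr] := open_norm_ball oV Vx.
by exists r => // y yx y0; split=> //; exact: hr.
Qed.

Lemma open_pos : open [set x : E | 0 < x 0 0].
Proof.
apply: (@open_comp _ _ (fun x : E => x 0 0) [set t | 0 < t]); last exact: open_gt.
by move=> x _; exact: coord_continuous.
Qed.

Lemma rel_open_pos A : rel_open A -> open (A `&` [set x | 0 < x 0 0]).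
Proof.
move=> [V oV ->].
rewrite (_ : V `&` halfspace R n `&` [set x | 0 < x 0 0] = V `&` [set x | 0 < x 0 0]).
  exact: openI oV open_pos.
by apply/seteqP; split=> x [] => [[Vx _]|Vx] x0; split=> //; split=> //; exact: ltW.
Qed.

(** The right-hand quotient only visits points [x + t e_i] with small [t > 0], which stay in the
    half-space and hence in [A], where [f] and [g] agree; so the two-sided derivative of [g]
    determines it. *)
Lemma pd_is_derive A W f g x (i : 'I_n.+1) (l : R) : rel_open A -> A x -> open W -> W x ->
  is_derive x 'e_i g l -> (forall y, W y -> A y -> g y = f y) -> pd i f x = l.
Proof.
move=> oA Ax oW Wx [dg <-] gf.
have [r r0 hr] := rel_open_ball oA Ax.
have [s s0 hs] := open_norm_ball oW Wx.
have x0 : 0 <= x 0 0 by case: oA Ax => V _ ->[].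
have [/= d' hl] := (cvg_ex _).1 dg.
have -> : 'D_'e_i g x = d' by apply/cvg_lim.
apply/cvg_lim => //; apply/cvgrPdist_lt => e e0.
move/cvgrPdist_lt : hl => /(_ e e0) /nbhs_ballP[d d0 hd].
near=> t.
have t0 : 0 < t by [].
have nt : `|t *: 'e_i : E| <= t.
  rewrite normrZ gtr0_norm// -[leRHS]mulr1 ler_wpM2l ?(ltW t0)//.
  by apply: norm_leP => // q; rewrite !mxE; case: (q == i); rewrite /= ?andbF ?normr0 ?normr1.
have ei : 0 <= ('e_i : E) 0 0 by rewrite mxE.
have tr : t < r by near: t; exact: nbhs_right_lt.
have ts : t < s by near: t; exact: nbhs_right_lt.
have td : t < d by near: t; exact: nbhs_right_lt.
have Ay : A (x + t *: 'e_i).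
  apply: hr; first by rewrite [x + _]addrC addrK; exact: le_lt_trans tr.
  by rewrite !mxE addr_ge0// mulr_ge0// ltW.
have Wy : W (x + t *: 'e_i) by apply: hs; rewrite [x + _]addrC addrK; exact: le_lt_trans ts.
rewrite -gf// -gf//; have := hd t; rewrite -ball_normE /= sub0r normrN gtr0_norm//.
by rewrite [x + _]addrC => /(_ td (lt0r_neq0 t0)).
Unshelve. all: by end_near. Qed.

Lemma pdE A W f g x i : rel_open A -> A x -> open W -> W x -> Ck 1 W g ->
  (forall y, W y -> A y -> g y = f y) -> pd i f x = 'D_'e_i g x.
Proof.
move=> oA Ax oW Wx [_ /(_ i)[dg _]].
exact: pd_is_derive oA Ax oW Wx (derivableP (dg x Wx)).
Qed.

(** One extension computes [pd] at all nearby points of [A], boundary included; the rules for [pd]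
    are those for two-sided derivatives, transported through it. *)
Lemma pd_extend A f x : rel_open A -> smooth_on A f -> A x -> exists W g,
  [/\ open W, W x, smooth_open W g, forall y, W y -> A y -> g y = f y &
    forall i y, W y -> A y -> pd i f y = 'D_'e_i g y].
Proof.
move=> oA sf Ax; have [W [g [oW Wx sg gf]]] := sf x Ax.
by exists W, g; split=> // i y Wy Ay; exact: pdE oA Ay oW Wy (sg 1%N) gf.
Qed.

Lemma smooth_open_derive W f i : smooth_open W f -> smooth_open W (fun y => 'D_'e_i f y).
Proof. by move=> sf k; have [_ /(_ i)[]] := sf k.+1. Qed.

Lemma smooth_on_pd A f i : rel_open A -> smooth_on A f -> smooth_on A (pd i f).
Proof.
move=> oA sf x Ax; have [W [g [oW Wx sg gf dg]]] := pd_extend oA sf Ax.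
exists W, (fun y => 'D_'e_i g y); split=> //; first exact: smooth_open_derive.
by move=> y Wy Ay; rewrite dg.
Qed.

Lemma pd_eq A f g x i : rel_open A -> smooth_on A f -> A x -> (forall y, A y -> f y = g y) ->
  pd i f x = pd i g x.
Proof.
move=> oA sf Ax fg; have [W [u [oW Wx su uf du]]] := pd_extend oA sf Ax.
rewrite (du i x Wx Ax); apply/esym; apply: pdE oA Ax oW Wx (su 1%N) _.
by move=> y Wy Ay; rewrite uf ?fg.
Qed.

Lemma smooth_open_derivable W f i x : smooth_open W f -> W x -> derivable f x 'e_i.
Proof. by move=> sf Wx; have [_ /(_ i)[+ _]] := sf 1%N; apply. Qed.

Lemma pd_open A f x i : open A -> rel_open A -> smooth_on A f -> A x -> pd i f x = 'D_'e_i f x.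
Proof.
move=> oA oA' sf Ax.
exact: (@pdE A A f f x i oA' Ax oA Ax (smooth_on_open oA sf 1%N) (fun _ _ _ => erefl)).
Qed.

Section pd_rules.
Variables (A : set E) (x : E) (i : 'I_n.+1).
Hypotheses (oA : rel_open A) (Ax : A x).

Lemma pd_lift2 f g (op : R -> R -> R) (c : R) :
  (forall k W u v, open W -> Ck k W u -> Ck k W v -> Ck k W (fun x : E => op (u x) (v x))) ->
  (forall u v du dv, u x = f x -> v x = g x -> is_derive x 'e_i u du -> is_derive x 'e_i v dv ->
    du = pd i f x -> dv = pd i g x -> is_derive x 'e_i (fun y : E => op (u y) (v y)) c) ->
  smooth_on A f -> smooth_on A g -> pd i (fun y => op (f y) (g y)) x = c.
Proof.
move=> hop hd sf sg.
have [W [u [oW Wx su uf du]]] := pd_extend oA sf Ax.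
have [W' [v [oW' Wx' sv vg dv]]] := pd_extend oA sg Ax.
have oWW := openI oW oW'.
rewrite (@pdE A (W `&` W') _ (fun y => op (u y) (v y)))//.
- have [_ ->//] : is_derive x 'e_i (fun y : E => op (u y) (v y)) c.
  apply: (hd _ _ ('D_'e_i u x) ('D_'e_i v x)); rewrite ?uf ?vg ?du ?dv//.
    exact/derivableP/(smooth_open_derivable su).
  exact/derivableP/(smooth_open_derivable sv).
- by apply: hop => //; [apply: Ck_sub (su 1%N)|apply: Ck_sub (sv 1%N)] => y [].
- by move=> y [Wy W'y] Ay; rewrite uf ?vg.
Qed.

Lemma pdD f g : smooth_on A f -> smooth_on A g ->
  pd i (fun y => f y + g y) x = pd i f x + pd i g x.
Proof.
apply: (pd_lift2 (op := +%R)); first by move=> k W u v; exact: CkD.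
by move=> u v du dv _ _ hu hv <- <-; exact: is_deriveD.
Qed.

Lemma pdB f g : smooth_on A f -> smooth_on A g ->
  pd i (fun y => f y - g y) x = pd i f x - pd i g x.
Proof.
apply: (pd_lift2 (op := fun a b => a - b)); first by move=> k W u v; exact: CkB.
by move=> u v du dv _ _ hu hv <- <-; exact: is_deriveB.
Qed.

Lemma pdM f g : smooth_on A f -> smooth_on A g ->
  pd i (fun y => f y * g y) x = pd i f x * g x + f x * pd i g x.
Proof.
apply: (pd_lift2 (op := *%R)); first by move=> k W u v; exact: CkM.
move=> u v du dv ux vx hu hv <- <-; rewrite -ux -vx addrC [du * _]mulrC.
exact: is_deriveM.
Qed.

Lemma pd_cst (c : R) : pd i (fun=> c) x = 0.
Proof.
rewrite (@pdE A setT _ (fun=> c))// ?derive_cst//; first exact: openT.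
exact: Ck_cst.
Qed.

Lemma pdN f : smooth_on A f -> pd i (fun y => - f y) x = - pd i f x.
Proof.
move=> sf; rewrite -[RHS]sub0r -(pd_cst 0) -pdB//; last exact: smooth_on_cst.
by apply: pd_eq oA _ Ax _ => [|y _]; [exact: smooth_onN|rewrite sub0r].
Qed.

Lemma pd_coord j : pd i (fun y => y 0 j) x = (i == j)%:R.
Proof.
rewrite (@pdE A setT _ (fun y => y 0 j))//; last 2 first.
- exact: openT.
- by apply: Ck_coord; exact: openT.
by have [_ ->] := @is_derive_coord R n j x 'e_i; rewrite mxE eqxx eq_sym.
Qed.

Lemma pd_sum (I : Type) (s : seq I) (P : pred I) (F : I -> E -> R) :
  (forall q, P q -> smooth_on A (F q)) ->
  pd i (fun y => \sum_(q <- s | P q) F q y) x = \sum_(q <- s | P q) pd i (F q) x.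
Proof.
move=> h; elim: s => [|q s IH].
  transitivity (pd i (fun=> 0 : R) x); last by rewrite big_nil pd_cst.
  by apply: (pd_eq i oA _ Ax) => [|y _]; [exact: smooth_on_sum|rewrite big_nil].
have sS := @smooth_on_sum A I (q :: s) P F h.
have sS' := @smooth_on_sum A I s P F h.
rewrite big_cons; have [Pq|nPq] := boolP (P q).
  rewrite -IH -pdD//; last exact: h.
  by apply: pd_eq oA sS Ax _ => y _; rewrite big_cons Pq.
rewrite -IH; apply: pd_eq oA sS Ax _ => y _; by rewrite big_cons (negbTE nPq).
Qed.

Lemma pd_schwarz f j : smooth_on A f -> pd i (pd j f) x = pd j (pd i f) x.
Proof.
move=> sf; have [W [u [oW Wx su uf du]]] := pd_extend oA sf Ax.
have h l l' : pd l (pd l' f) x = 'D_'e_l (fun y => 'D_'e_l' u y) x.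
  apply: pdE oA Ax oW Wx _ _; first exact: smooth_open_derive su 1%N.
  by move=> y Wy Ay; rewrite du.
by rewrite !h; exact: schwarz oW (su 2%N) Wx.
Qed.

Lemma pd_comp A' f (F : E -> E) : rel_open A' -> (forall j, smooth_on A (fun y => F y 0 j)) ->
  (forall y, A y -> A' (F y)) -> smooth_on A' f ->
  pd i (f \o F) x = \sum_j pd i (fun y => F y 0 j) x * pd j f (F x).
Proof.
move=> oA' sF FA sf.
have [W' [g [oW' W'x sg gf dg]]] := pd_extend oA' sf (FA _ Ax).
have sc := smooth_on_comp sF FA sf.
have [G hG] : {G : 'I_n.+1 -> set E * (E -> R) & forall j, [/\ open (G j).1, (G j).1 x,
    smooth_open (G j).1 (G j).2, forall y, (G j).1 y -> A y -> (G j).2 y = F y 0 j &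
    pd i (fun y => F y 0 j) x = 'D_'e_i (G j).2 x]}.
  apply: (@choice _ _ (fun j G => [/\ open G.1, G.1 x,
    smooth_open G.1 G.2, forall y, G.1 y -> A y -> G.2 y = F y 0 j &
    pd i (fun y => F y 0 j) x = 'D_'e_i G.2 x])) => j.
  by have [W [u [h1 h2 h3 h4 h5]]] := pd_extend oA (sF j) Ax; exists (W, u); split=> //; exact: h5.
have [W [u [oW Wx su uf du]]] := pd_extend oA sc Ax.
pose Ft y : E := \row_j (G j).2 y.
have Ftx : Ft x = F x.
  by apply/rowP => j; rewrite mxE; have [_ h1 _ h2 _] := hG j; exact: h2.
have D : is_derive x 'e_i (g \o Ft) (\sum_j pd i (fun y => F y 0 j) x * pd j f (F x)).
  under eq_bigr => j _ do rewrite (dg j _ W'x (FA _ Ax)) -Ftx.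
  have -> : \sum_j pd i (fun y => F y 0 j) x * 'D_'e_j g (Ft x) =
      \sum_j (\row_j pd i (fun y => F y 0 j) x) 0 j * 'D_'e_j g (Ft x).
    by apply: eq_bigr => j _; rewrite mxE.
  apply: is_derive_comp.
    by rewrite Ftx; exact: C1_differentiable oW' (sg 1%N) W'x.
  move=> j; rewrite mxE; have [_ Gx sG _ ->] := hG j.
  rewrite (_ : (fun y => _) = (G j).2); last by apply/funext => y; rewrite mxE.
  exact/derivableP/(smooth_open_derivable sG).
have cFt : {for x, continuous Ft}.
  apply: continuous_coordP => j; have [oG Gx sG _ _] := hG j.
  apply: (@continuous_eq_at _ _ (G j).1 (G j).2) => //; first by move=> y _; rewrite mxE.
  exact: Ck_cont (sG 0%N) Gx.
have /nbhs_ballP[r2 r20 hr2] : \forall y \near x, W' (Ft y).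
  by apply: cFt; apply: open_nbhs_nbhs; rewrite Ftx.
have [r1 r10 hr1] : exists2 r : R, 0 < r & forall j y, `|y - x| < r -> (G j).1 y.
  apply: (@exists_min _ _ (fun j r => forall y, `|y - x| < r -> (G j).1 y)).
    by move=> q d d' Pd _ d'd y yx; apply: Pd; exact: lt_le_trans d'd.
  by move=> j; have [h1 h2 _ _ _] := hG j; exact: open_norm_ball.
have sub y : cube x (Num.min r1 r2) y -> (forall j, (G j).1 y) /\ W' (Ft y).
  rewrite /cube /= lt_min => /andP[y1 y2]; split; first by move=> j; exact: hr1.
  by apply: hr2; rewrite -ball_normE /= distrC.
have [_ <-] := D.
apply: pdE oA Ax (@cube_open _ _ x (Num.min r1 r2)) _ _ _.
- by rewrite /cube /= subrr normr0 lt_min r10.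
- apply: (Ck_comp (@cube_open _ _ _ _) oW' _ _ (sg 1%N)).
    move=> j; apply: (Ck_eq (f := (G j).2)); first exact: cube_open.
      by move=> y _; rewrite mxE.
    by have [_ _ sG _ _] := hG j; apply: Ck_sub (sG 1%N) => y /sub[].
  by move=> y /sub[].
- move=> y /sub[Gy W'y] Ay /=.
  have FtF : Ft y = F y by apply/rowP => j; rewrite mxE; have [_ _ _ h2 _] := hG j; exact: h2.
  by rewrite -FtF; apply: gf => //; rewrite FtF; exact: FA.
Qed.

Lemma pd_comp1 f (phi : R -> R) (dphi : R) : smooth_on A f ->
  is_derive (f x) (1 : R) phi dphi -> pd i (fun y => phi (f y)) x = dphi * pd i f x.
Proof.
move=> sf; have [W [u [oW Wx su uf du]]] := pd_extend oA sf Ax.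
rewrite -uf// du// => dp; apply: (pd_is_derive oA Ax oW Wx).
  by apply: is_derive_comp1 dp _; apply/derivableP; exact: smooth_open_derivable su Wx.
by move=> y Wy Ay /=; rewrite uf.
Qed.

End pd_rules.
End smooth_on_theory.

(** * Charts and change of coordinates *)

Section manifold_theory.
Context {R : realType} {n : nat} {N : bmanifold R n}.
Local Notation E := 'rV[R]_n.+1.
Implicit Types (a b c : chart_index N) (p q : N) (x y : E) (U V C : set N).

Lemma point_atK a p : dom (chart a) p -> point_at (chart a) (chart a p) = p.
Proof. by move=> ap; apply: coordK; rewrite inE. Qed.

Lemma transition_coord a b p : dom (chart a) p ->
  transition (chart a) (chart b) (chart a p) = chart b p.
Proof. by move=> ap; rewrite /transition point_atK. Qed.

Lemma coord_ge0 a p : dom (chart a) p -> 0 <= chart a p 0 0.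
Proof.
move=> ap; have [V oV eV] := coord_img (chart a).
by have : (chart a @` dom (chart a)) (chart a p) by [exists p]; rewrite eV => -[].
Qed.

Lemma img_rel_open U a : open U -> rel_open (img U a).
Proof.
move=> oU; have [V oV eV] := coord_img (chart a).
have /continuousP/(_ U oU) := @point_at_cont _ _ _ (chart a).
move=> H; have [W oW WE] := (open_subspaceP _ _).1 H.
exists (V `&` W); first exact: openI.
have key : img U a = W `&` (chart a @` dom (chart a)).
  rewrite WE; apply/seteqP; split=> x.
    move=> [p [Up ap] <-]; split; last by exists p.
    by rewrite /from_subspace /preimage /= point_atK.
  move=> [Ux [p ap px]]; exists p => //; split=> //.
  by move: Ux; rewrite -px /from_subspace /preimage /= point_atK.
by rewrite key eV setIA [W `&` V]setIC.
Qed.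

Lemma img_sub U V a : U `<=` V -> img U a `<=` img V a.
Proof. by move=> UV x [p [/UV Vp ap] <-]; exists p. Qed.

Lemma imgI_pred U a p : U p -> dom (chart a) p -> img U a (chart a p).
Proof. by move=> Up ap; exists p. Qed.

Lemma img_point U a x : img U a x ->
  [/\ U (point_at (chart a) x), dom (chart a) (point_at (chart a) x) &
      chart a (point_at (chart a) x) = x].
Proof. by move=> [p [Up ap] <-]; rewrite point_atK. Qed.

Lemma imgI U V a : img (U `&` V) a = img U a `&` img V a.
Proof.
apply/seteqP; split=> x; first by move=> [p [[Up Vp] ap] <-]; split; exists p.
by move=> [/img_point[Up ap xp] /img_point[Vp _ _]]; exists (point_at (chart a) x).
Qed.

Definition overlap a b := img (dom (chart b)) a.

Lemma overlap_rel_open a b : rel_open (overlap a b).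
Proof. by apply: img_rel_open; exact: dom_open. Qed.

Lemma transition_smooth a b j :
  smooth_on (overlap a b) (fun x => transition (chart a) (chart b) x 0 j).
Proof. by have := @chart_compat _ _ N a b j; rewrite setIC. Qed.

Arguments transition_smooth : clear implicits.

Lemma jac_smooth a b i j : smooth_on (overlap a b) (fun x => jac a b x i j).
Proof.
apply: (smooth_on_eq (f := pd i (fun y => transition (chart a) (chart b) y 0 j))).
  by move=> x _; rewrite mxE.
by apply: smooth_on_pd; [exact: overlap_rel_open|exact: transition_smooth].
Qed.

Arguments jac_smooth : clear implicits.

Lemma transition_img U a b x : img (U `&` dom (chart b)) a x ->
  img U b (transition (chart a) (chart b) x).
Proof.
by move=> [p [[Up bp] ap] <-]; rewrite transition_coord//; exists p.
Qed.

Lemma smooth_on_transition U a b (f : E -> R) : smooth_on (img U b) f ->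
  smooth_on (img (U `&` dom (chart b)) a) (fun x => f (transition (chart a) (chart b) x)).
Proof.
move=> sf; apply: (@smooth_on_comp _ _ _ (img U b) f (transition (chart a) (chart b))) => //.
  by move=> j; apply: smooth_on_sub (transition_smooth a b j); apply: img_sub => p [].
by move=> x; exact: transition_img.
Qed.

Lemma pd_transition U a b p (f : E -> R) i : open U -> U p -> dom (chart a) p ->
  dom (chart b) p -> smooth_on (img U b) f ->
  pd i (fun x => f (transition (chart a) (chart b) x)) (chart a p) =
  \sum_j jac a b (chart a p) i j * pd j f (chart b p).
Proof.
move=> oU Up ap bp sf.
have oA : rel_open (img (U `&` dom (chart b)) a).
  by apply: img_rel_open; apply: openI => //; exact: dom_open.
rewrite (@pd_comp _ _ (img (U `&` dom (chart b)) a) _ i oA _ (img U b) f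
  (transition (chart a) (chart b)))//.
- by apply: eq_bigr => j _; rewrite mxE transition_coord.
- by exists p.
- exact: img_rel_open.
- by move=> j; apply: smooth_on_sub (transition_smooth a b j); apply: img_sub => q [].
- by move=> y; exact: transition_img.
Qed.

Lemma jac_id a p : dom (chart a) p -> jac a a (chart a p) = 1%:M.
Proof.
move=> ap; apply/matrixP => i j; rewrite !mxE.
have Aa : overlap a a (chart a p) by exists p.
rewrite -(@pd_coord _ _ (overlap a a) (chart a p) i (overlap_rel_open a a) Aa j).
apply: (pd_eq i (overlap_rel_open a a) (transition_smooth a a j) Aa).
by move=> y [q [aq _] <-]; rewrite transition_coord.
Qed.

Lemma jac_cocycle a b c p : dom (chart a) p -> dom (chart b) p -> dom (chart c) p ->
  jac a b (chart a p) *m jac b c (chart b p) = jac a c (chart a p).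
Proof.
move=> ap bp cp; apply/matrixP => i j; rewrite mxE [RHS]mxE.
have oD := dom_open (chart c).
transitivity (\sum_k jac a b (chart a p) i k *
    pd k (fun y => transition (chart b) (chart c) y 0 j) (chart b p)).
  by apply: eq_bigr => k _; congr (_ * _); rewrite mxE.
rewrite -(pd_transition i oD cp ap bp); last exact: transition_smooth.
have oA : rel_open (img (dom (chart c) `&` dom (chart b)) a).
  by apply: img_rel_open; apply: openI => //; exact: dom_open.
apply: (pd_eq i oA).
- exact: smooth_on_transition (transition_smooth b c j).
- by exists p.
- by move=> y [q [[cq bq] aq] <-]; rewrite !transition_coord.
Qed.

Lemma jacK a b p : dom (chart a) p -> dom (chart b) p ->
  jac a b (chart a p) *m jac b a (chart b p) = 1%:M.
Proof. by move=> ap bp; rewrite jac_cocycle// jac_id. Qed.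

Lemma jac_unit a b p : dom (chart a) p -> dom (chart b) p ->
  jac a b (chart a p) \in unitmx.
Proof. by move=> ap bp; have /mulmx1_unit[] := jacK ap bp. Qed.

Lemma inner_coord_gt0 a p : inner N p -> dom (chart a) p -> 0 < chart a p 0 0.
Proof.
move=> ip ap; rewrite lt_def coord_ge0// andbT; apply/eqP => x0.
by apply: ip; exists a.
Qed.

(* If [x_0 > 0] in [a] while [y_0 = 0] in [b], then [y_0] has an interior minimum
   in the coordinates of [a], so the invertible Jacobian has a zero column. *)
Lemma boundary_coord a p : boundary N p -> dom (chart a) p -> chart a p 0 0 = 0.
Proof.
move=> [b [bp b0]] ap; apply/eqP; rewrite eq_le coord_ge0// andbT leNgt.
apply/negP => a0.
pose x := chart a p; pose A := overlap a b `&` [set x | 0 < x 0 0].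
have oA : open A by apply: rel_open_pos; exact: overlap_rel_open.
have Ax : A x by split=> //; exists p.
pose f y := transition (chart a) (chart b) y 0 0.
have sf : smooth_on A f by apply: smooth_on_sub (transition_smooth a b 0) => y [].
have f0 y : A y -> 0 <= f y.
  by move=> [[q [bq aq] <-] _]; rewrite /f transition_coord// coord_ge0.
have fx : f x = 0 by rewrite /f transition_coord.
have [r r0 hr] := open_norm_ball oA Ax.
have jac0 i : jac a b x i 0 = 0.
  rewrite mxE -/f.
  have oA' : rel_open A by exists A => //; apply/seteqP; split=> y [] // h1 h2; split=> //; exact: ltW.
  rewrite (pd_open i oA oA' sf Ax).
  have nb t : t \in `]- r, r[%R -> A (t *: 'e_i + x).
    rewrite in_itv /= -ltr_norml => tr; apply: hr; rewrite addrK normrZ.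
    apply: le_lt_trans tr; rewrite -[leRHS]mulr1 ler_wpM2l//.
    by apply: norm_leP => // q; rewrite !mxE; case: (q == i); rewrite /= ?andbF ?normr0 ?normr1.
  have D t : t \in `]- r, r[%R -> is_derive t (1 : R) (fun u => f (u *: 'e_i + x)) ('D_'e_i f (t *: 'e_i + x)).
    move=> /nb At; apply: is_derive_line; apply/derivableP.
    exact: smooth_open_derivable (smooth_on_open oA sf) At.
  have z0 : 0 \in `]- r, r[%R by rewrite in_itv /= oppr_lt0 r0.
  have := @derive1_at_min R (fun u => f (u *: 'e_i + x)) (- r) r 0 _ _ z0 _.
  move=> [||t tI|_ e].
  - by rewrite ge0_cp// ltW.
  - by move=> t /D[].
  - by rewrite scale0r add0r fx f0//; exact: nb.
  - by have [_] := D 0 z0; rewrite e scale0r add0r.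
have := jacK bp ap; rewrite -/x => /matrixP/(_ 0 0); rewrite !mxE big1 ?eqxx.
  by move=> /esym/eqP; rewrite oner_eq0.
by move=> k _; rewrite jac0 mulr0.
Qed.

Lemma img_inner U a : img (U `&` inner N) a = img U a `&` [set x | 0 < x 0 0].
Proof.
apply/seteqP; split=> x.
  by move=> [p [[Up ip] ap] <-]; split; [exists p|exact: inner_coord_gt0].
move=> [[p [Up ap] <-] /= x0]; exists p => //; split=> //; split=> // bp.
by move: x0; rewrite (boundary_coord bp ap) ltxx.
Qed.

(* [C] controls the support: [z] vanishes on [U] outside it *)
Lemma vector_field_of_chart a U C (z : E -> E) : open U -> closed C ->
  C `&` U `<=` dom (chart a) -> (forall j, smooth_on (img U a) (fun x => z x 0 j)) ->
  (forall p, U p -> dom (chart a) p -> ~ C p -> z (chart a p) = 0) ->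
  exists v : vector_field U, forall x, img U a x -> v a x = z x.
Proof.
move=> oU cC CU sz z0.
pose v b y : E := if `[< dom (chart a) (point_at (chart b) y) >] then
  z (transition (chart b) (chart a) y) *m jac a b (transition (chart b) (chart a) y) else 0.
have vE b p : U p -> dom (chart b) p -> dom (chart a) p ->
    v b (chart b p) = z (chart a p) *m jac a b (chart a p).
  by move=> Up bp ap; rewrite /v point_atK// asboolT// transition_coord.
have v0 b p : U p -> dom (chart b) p -> ~ dom (chart a) p -> v b (chart b p) = 0.
  by move=> Up bp ap; rewrite /v point_atK// asboolF.
have sv b i : smooth_on (img U b) (fun x => v b x 0 i).
  (* Near a point of the chart domain the transformation formula is smooth; a point of [U] outside
     that domain is not in [C], and the field vanishes on the open complement of [C]. *)
  apply: smooth_on_local => x [p [Up bp] <-].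
  have [ap|nap] := pselect (dom (chart a) p).
    have [W oW WE] := img_rel_open b (dom_open (chart a)).
    exists W; split=> //.
      have : img (dom (chart a)) b (chart b p) by exists p.
      by rewrite WE => -[].
    have sub : img U b `&` W `<=` img (U `&` dom (chart a)) b.
      rewrite imgI WE => y [Uy Wy]; split=> //; split=> //.
      by move: Uy => [q [_ bq] <-]; exact: coord_ge0.
    apply: smooth_on_sub sub _.
    apply: (smooth_on_eq (f := fun y => \sum_j z (transition (chart b) (chart a) y) 0 j *
      jac a b (transition (chart b) (chart a) y) j i)).
      move=> y [q [[Uq aq] bq] <-]; rewrite vE// mxE; apply: eq_bigr => j _.
      by rewrite transition_coord.
    apply: smooth_on_sum => j _; apply: smooth_onM; first exact: (smooth_on_transition (f := fun x => z x 0 j)).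
    apply: (@smooth_on_eq _ _ _ (fun y => jac a b (transition (chart b) (chart a) y) j i)) => //.
    have := @smooth_on_transition (dom (chart b)) b a _ (jac_smooth a b j i).
    by apply: smooth_on_sub => y [q [[Uq aq] bq] <-]; exists q.
  have nCp : ~ C p by move=> Cp; apply: nap; exact: CU.
  have [W oW WE] := img_rel_open b (closed_openC cC).
  exists W; split=> //.
    have : img (~` C) b (chart b p) by exists p.
    by rewrite WE => -[].
  apply: (smooth_on_eq (f := fun=> 0)); last exact: smooth_on_cst.
  move=> y [[q [Uq bq] <-] Wq].
  have /img_point[] : img (~` C) b (chart b q) by rewrite WE; split=> //; exact: coord_ge0.
  rewrite point_atK// => nCq _ _.
  have [aq|naq] := pselect (dom (chart a) q); last by rewrite v0// mxE.
  by rewrite vE// z0// mul0mx mxE.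
have lv b c p : U p -> dom (chart b) p -> dom (chart c) p ->
    v c (chart c p) = v b (chart b p) *m jac b c (chart b p).
  move=> Up bp cp; have [ap|nap] := pselect (dom (chart a) p).
    by rewrite !vE// -mulmxA jac_cocycle.
  by rewrite !v0// mul0mx.
exists (VectorField sv lv) => x [p [Up ap] <-] /=.
by rewrite vE// jac_id// mulmx1.
Qed.

Lemma sum4_exchange (H : 'I_n.+1 -> 'I_n.+1 -> 'I_n.+1 -> 'I_n.+1 -> R) :
  \sum_s \sum_t \sum_i \sum_j H s t i j = \sum_i \sum_j \sum_s \sum_t H s t i j.
Proof.
under eq_bigr => s _ do rewrite exchange_big /=.
rewrite exchange_big /=; apply: eq_bigr => i _.
under eq_bigr => s _ do rewrite exchange_big /=.
by rewrite exchange_big.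
Qed.

Lemma sum_change_basis (u v : 'I_n.+1 -> R) (J G : 'I_n.+1 -> 'I_n.+1 -> R) :
  \sum_s \sum_t G s t * (\sum_i u i * J i s) * (\sum_j v j * J j t) =
  \sum_i u i * (\sum_j v j * (\sum_s \sum_t J i s * J j t * G s t)).
Proof.
transitivity (\sum_s \sum_t \sum_i \sum_j (u i * v j * (J i s * J j t * G s t))).
  apply: eq_bigr => s _; apply: eq_bigr => t _.
  rewrite [G s t * _]mulr_sumr mulr_suml; apply: eq_bigr => i _.
  by rewrite mulr_sumr; apply: eq_bigr => j _; ring.
rewrite sum4_exchange; apply: eq_bigr => i _.
rewrite mulr_sumr; apply: eq_bigr => j _.
rewrite mulrA mulr_sumr; apply: eq_bigr => s _.
by rewrite mulr_sumr.
Qed.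

(* Differentiating [eta_b (F x) = eta_a x *m J x], the term in the derivative of [J] is
   absorbed by the inhomogeneous term of [cn_law]. *)
Lemma covariant_law (nabla : connection N) U (xi eta : vector_field U) a b p :
  open U -> U p -> inner N p -> dom (chart a) p -> dom (chart b) p ->
  covariant nabla xi eta b (chart b p) =
  covariant nabla xi eta a (chart a p) *m jac a b (chart a p).
Proof.
move=> oU Up ip ap bp; set x := chart a p; set J := jac a b x.
pose O := img (U `&` dom (chart b)) a.
have oO : rel_open O by apply: img_rel_open; apply: openI => //; exact: dom_open.
have Ox : O x by exists p.
have OU : O `<=` img U a by apply: img_sub => q [].
have Oab : O `<=` overlap a b by apply: img_sub => q [].
have sJ k l : smooth_on O (fun y => jac a b y k l) by exact: smooth_on_sub Oab (jac_smooth a b k l).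
have se k : smooth_on O (fun y => eta a y 0 k) by exact: smooth_on_sub OU (@vf_smooth _ _ _ _ eta a k).
have seb l : smooth_on (img U b) (fun y => eta b y 0 l) by exact: vf_smooth.
have deta i l : \sum_s J i s * pd s (fun y => eta b y 0 l) (chart b p) =
    \sum_k (pd i (fun y => eta a y 0 k) x * J k l + eta a x 0 k * pd i (fun y => jac a b y k l) x).
  rewrite -(pd_transition i oU Up ap bp (seb l)).
  transitivity (pd i (fun y => \sum_k eta a y 0 k * jac a b y k l) x).
    apply: (pd_eq i oO) => //; first exact: smooth_on_transition (seb l).
    by move=> y [q [[Uq bq] aq] <-]; rewrite transition_coord// (vf_law eta Uq aq bq) mxE.
  rewrite (pd_sum i oO Ox) => [|k _]; last exact: smooth_onM.
  by apply: eq_bigr => k _; rewrite (pdM i oO Ox).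
have xib s : xi b (chart b p) 0 s = \sum_i xi a x 0 i * J i s.
  by rewrite (vf_law xi Up ap bp) mxE.
have etab t : eta b (chart b p) 0 t = \sum_j eta a x 0 j * J j t.
  by rewrite (vf_law eta Up ap bp) mxE.
apply/rowP => l; rewrite mxE [RHS]mxE.
have law i j : \sum_s \sum_t J i s * J j t * nabla b s t l (chart b p) =
    \sum_k nabla a i j k x * J k l - pd i (fun y => jac a b y j l) x.
  rewrite (cn_law nabla ip ap bp) addrAC /jac.
  under [X in _ = _ - pd i X _ + _]eq_fun do rewrite mxE.
  by rewrite subrr add0r.
have step i : \sum_s J i s * pd s (fun y => eta b y 0 l) (chart b p) +
   \sum_j eta a x 0 j * (\sum_s \sum_t J i s * J j t * nabla b s t l (chart b p)) =
   \sum_k (pd i (fun y => eta a y 0 k) x + \sum_j eta a x 0 j * nabla a i j k x) * J k l.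
  have -> : \sum_j eta a x 0 j * (\sum_s \sum_t J i s * J j t * nabla b s t l (chart b p)) =
      \sum_k (\sum_j eta a x 0 j * nabla a i j k x) * J k l -
      \sum_k eta a x 0 k * pd i (fun y => jac a b y k l) x.
    under eq_bigr => j _ do rewrite law mulrBr mulr_sumr.
    rewrite sumrB exchange_big /=; congr (_ - _); apply: eq_bigr => k _.
    by rewrite mulr_suml; apply: eq_bigr => j _; rewrite mulrA.
  rewrite deta big_split /=.
  have cancel (u v w : R) : u + v + (w - v) = u + w by ring.
  rewrite cancel -big_split /=; apply: eq_bigr => k _; by rewrite mulrDl.
under eq_bigr => s _ do rewrite xib.
under [X in _ + X]eq_bigr => s _ do under eq_bigr => t _ do rewrite xib etab.
rewrite (sum_change_basis (fun i => xi a x 0 i) (fun j => eta a x 0 j) J (fun s t => nabla b s t l (chart b p))).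
have -> : \sum_s (\sum_i xi a x 0 i * J i s) * pd s (fun y => eta b y 0 l) (chart b p) =
    \sum_i xi a x 0 i * \sum_s J i s * pd s (fun y => eta b y 0 l) (chart b p).
  under eq_bigr => s _ do rewrite mulr_suml.
  rewrite exchange_big /=; apply: eq_bigr => i _.
  by rewrite mulr_sumr; apply: eq_bigr => s _; rewrite mulrA.
rewrite -big_split /=.
under eq_bigr => i _ do rewrite -mulrDr step mulr_sumr.
rewrite exchange_big /=; apply: eq_bigr => k _.
rewrite [covariant nabla xi eta a x 0 k]mxE -big_split /= mulr_suml; apply: eq_bigr => i _.
rewrite mulrA; congr (_ * _); rewrite mulrDr mulr_sumr; congr (_ + _).
by apply: eq_bigr => j _; ring.
Qed.

(* The components of [Ups] only matter over [U `&` inner N]. *)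
Definition covector_law (Ups : chart_index N -> E -> E) U := forall a b p,
  (U `&` inner N) p -> dom (chart a) p -> dom (chart b) p ->
  Ups a (chart a p) = Ups b (chart b p) *m (jac a b (chart a p))^T.

Lemma pairing_law (w w' v v' : E) (J : 'M[R]_n.+1) : w' = w *m J^T -> v = v' *m J ->
  pairing w v = pairing w' v'.
Proof.
move=> -> ->; rewrite /pairing.
under eq_bigr => i _ do rewrite mxE mulr_sumr.
rewrite exchange_big /=; apply: eq_bigr => j _; rewrite mxE mulr_suml.
by apply: eq_bigr => i _; rewrite mxE; ring.
Qed.

Lemma proj_covariant_law (nabla : connection N) Ups U (xi eta : vector_field U) a b p :
  open U -> covector_law Ups U -> U p -> inner N p -> dom (chart a) p -> dom (chart b) p ->
  proj_covariant nabla Ups xi eta b (chart b p) =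
  proj_covariant nabla Ups xi eta a (chart a p) *m jac a b (chart a p).
Proof.
move=> oU law Up ip ap bp; rewrite /proj_covariant (covariant_law _ _ _ oU Up ip ap bp).
have lw := law a b p (conj Up ip) ap bp.
rewrite (pairing_law lw (vf_law xi Up ap bp)) (pairing_law lw (vf_law eta Up ap bp)).
by rewrite !mulmxDl -!scalemxAl -!(vf_law _ Up ap bp).
Qed.

(* The components [Gam i j k] in the chart [a] of a connection smooth up to the boundary,
   equal to [nabla + Ups] inside. *)
Lemma extends_with_of_chart (nabla : connection N) Ups U a
    (Gam : 'I_n.+1 -> 'I_n.+1 -> 'I_n.+1 -> E -> R) :
  open U -> U `<=` dom (chart a) -> covector_law Ups U ->
  (forall i j k, smooth_on (img U a) (Gam i j k)) ->
  (forall x i j k, img (U `&` inner N) a x ->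
     Gam i j k x = nabla a i j k x + Ups a x 0 i * (j == k)%:R + Ups a x 0 j * (i == k)%:R) ->
  extends_with nabla U Ups.
Proof.
move=> oU Ua law sG hG xi eta.
pose z x : E := \row_k (\sum_i xi a x 0 i * pd i (fun y => eta a y 0 k) x +
          \sum_i \sum_j Gam i j k x * xi a x 0 i * eta a x 0 j).
have oI := img_rel_open a oU.
have sxi i : smooth_on (img U a) (fun x => xi a x 0 i) := @vf_smooth _ _ _ _ xi a i.
have seta i : smooth_on (img U a) (fun x => eta a x 0 i) := @vf_smooth _ _ _ _ eta a i.
have sz k : smooth_on (img U a) (fun x => z x 0 k).
  apply: (smooth_on_eq (f := fun x => \sum_i xi a x 0 i * pd i (fun y => eta a y 0 k) x +
          \sum_i \sum_j Gam i j k x * xi a x 0 i * eta a x 0 j)).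
    by move=> x _; rewrite mxE.
  apply: smooth_onD; apply: smooth_on_sum => i _.
    by apply: smooth_onM => //; exact: smooth_on_pd.
  by apply: smooth_on_sum => j _; apply: smooth_onM => //; exact: smooth_onM.
(* [U] lies in the chart domain, so the support may be everything and the vanishing condition is
   void. *)
have [||zeta hz] := @vector_field_of_chart a U setT z oU closedT _ sz.
- by move=> q [_ Uq]; exact: Ua.
- by move=> q _ _ /(_ I).
exists zeta => b y [p [[Up ip] bp] <-].
have ap := Ua _ Up.
rewrite (vf_law zeta Up ap bp) (proj_covariant_law _ _ _ oU law Up ip ap bp); congr (_ *m _).
rewrite hz; last by exists p.
have Ip : img (U `&` inner N) a (chart a p) by exists p.
set x := chart a p in Ip *; apply/rowP => k; rewrite /z /proj_covariant /covariant !mxE -!addrA.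
congr (_ + _).
have e1 i j : Gam i j k x * xi a x 0 i * eta a x 0 j = nabla a i j k x * xi a x 0 i * eta a x 0 j +
   (Ups a x 0 i * xi a x 0 i * (eta a x 0 j * (j == k)%:R) +
    Ups a x 0 j * eta a x 0 j * (xi a x 0 i * (i == k)%:R)).
  by rewrite hG//; ring.
under eq_bigr => i _ do under eq_bigr => j _ do rewrite e1.
under eq_bigr => i _ do rewrite big_split /=.
rewrite big_split /=; congr (_ + _).
under eq_bigr => i _ do rewrite big_split /=.
rewrite big_split /=; congr (_ + _).
  rewrite /pairing mulr_suml; apply: eq_bigr => i _; rewrite -mulr_sumr; congr (_ * _).
  by rewrite (bigD1 k)//= eqxx mulr1 big1 ?addr0// => j /negbTE ->; rewrite mulr0.
rewrite /pairing exchange_big mulr_suml; apply: eq_bigr => i _; rewrite -mulr_sumr; congr (_ * _).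
by rewrite (bigD1 k)//= eqxx mulr1 big1 ?addr0// => j /negbTE ->; rewrite mulr0.
Qed.

End manifold_theory.

(** * Bump functions and Christoffel symbols *)

Section flat_function.
Context {R : realType}.

(** The family [t^-k exp(-1/t)] extended by 0: differentiation maps it into combinations of its own
    members, so smoothness of all of them is a single induction on the order. *)
Definition flat (k : nat) (t : R) : R := if 0 < t then (t^-1) ^+ k * expR (- t^-1) else 0.

Lemma flat_le0 k t : t <= 0 -> flat k t = 0.
Proof. by rewrite /flat leNgt => /negbTE ->. Qed.

Lemma flat_ge0 k t : 0 <= flat k t.
Proof. by rewrite /flat; case: ifP => // t0; rewrite mulr_ge0 ?expR_ge0// exprn_ge0// invr_ge0 ltW. Qed.

Lemma flat_gt0 t : 0 < t -> 0 < flat 0 t.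
Proof. by move=> t0; rewrite /flat t0 expr0 mul1r expR_gt0. Qed.

Lemma flatS k t : flat k t = t * flat k.+1 t.
Proof.
rewrite /flat; case: ifPn => [t0|_]; last by rewrite mulr0.
by rewrite exprS !mulrA mulfV ?mul1r// gt_eqF.
Qed.

(** From [u^(k+1) <= (k+1)! exp u] at [u = 1/t]; it yields the limit 0 at the origin. *)
Lemma flat_bound k t : `|flat k t| <= k.+1`!%:R * `|t|.
Proof.
have [t0|t0] := ltP 0 t; last by rewrite flat_le0// normr0 mulr_ge0.
rewrite ger0_norm ?flat_ge0// gtr0_norm// /flat t0.
set u := t^-1; have u0 : 0 < u by rewrite invr_gt0.
have h : u ^+ k.+1 <= k.+1`!%:R * expR u.
  have f0 : (0 : R) < k.+1`!%:R by rewrite ltr0n fact_gt0.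
  rewrite mulrC -ler_pdivrMr//.
  by apply: (le_trans _ (expR_ge1Dxn k (ltW u0))); rewrite lerDr.
rewrite expRN ler_pdivrMr ?expR_gt0// -mulrA [t * _]mulrC mulrA.
rewrite -ler_pdivrMr// -/u -exprSr.
exact: h.
Qed.

(** At 0 the difference quotient [flat k h / h] is [flat k.+1 h], which tends to 0 by
    [flat_bound]. *)
Lemma is_derive_flat k t : is_derive t (1 : R) (flat k) (flat k.+2 t - k%:R * flat k.+1 t).
Proof.
have [t0|t0|->] := ltgtP t 0.
- rewrite !flat_le0 ?ltW// mulr0 subr0.
  have D0 : is_derive t (1 : R) (fun=> 0 : R) (0 : R) by exact: is_derive_cst.
  apply: near_eq_is_derive D0.
  near=> u; rewrite flat_le0//; apply: ltW; near: u; exact: lt_nbhsl.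
- suff D0 : is_derive t (1 : R) (fun u : R => (u^-1) ^+ k * expR (- u^-1))
      (flat k.+2 t - k%:R * flat k.+1 t).
    apply: near_eq_is_derive D0.
    near=> u; rewrite /flat ifT//; near: u; exact: lt_nbhsr.
  have tn : t != 0 by rewrite gt_eqF.
  have D1 : is_derive t (1 : R) (fun u : R => u^-1) (- t ^- 2).
    have d := @derivableV R R (fun u => u) t 1 tn (@derivable_id _ _ _ _).
    have e := @deriveV R R (fun u => u) t 1 tn (@derivable_id _ _ _ _).
    apply: DeriveDef d _; rewrite e.
    have -> : 'D_1 (fun u : R => u) t = 1 by exact: derive_id.
    by rewrite scaleNr [_ *: _]mulr1.
  set v := t^-1 in D1 *.
  have D2 : is_derive v (1 : R) (fun v : R => v ^+ k * expR (- v))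
      (v ^+ k * - expR (- v) + expR (- v) * (k%:R * v ^+ k.-1)).
    have Dx : is_derive v (1 : R) (fun v : R => v ^+ k) (k%:R * v ^+ k.-1).
      apply: DeriveDef; first exact: exprn_derivable.
      by rewrite exp_derive [LHS]mulr1.
    have De : is_derive v (1 : R) (fun v : R => expR (- v)) (- expR (- v)).
      have DN : is_derive v (1 : R) (fun v : R => - v) (- 1) by exact: is_deriveN.
      have := @is_derive1_comp R expR (fun v => - v) v _ _ (is_derive_expR _) DN.
      by rewrite mulrN1.
    exact: is_deriveM Dx De.
  have := @is_derive1_comp R _ (fun u => u^-1) t _ _ D2 D1.
  rewrite /flat t0 -/v -exprVn -/v.
  suff -> : v ^+ k.+2 * expR (- v) - k%:R * (v ^+ k.+1 * expR (- v)) =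
    (v ^+ k * - expR (- v) + expR (- v) * (k%:R * v ^+ k.-1)) * - v ^+ 2 by [].
  case: k {D2} => [|k] /=; first by rewrite !mul0r; ring.
  by rewrite !exprS; ring.
- rewrite !flat_le0// mulr0 subr0.
  suff H : (fun h : R => h^-1 *: (flat k (h *: (1 : R) + 0) - flat k 0)) @ (0 : R)^' --> (0 : R).
    by apply: DeriveDef; [apply/cvg_ex; exists 0|exact/cvg_lim].
  apply/cvgrPdist_lt => e e0.
  have K0 : 0 < (k.+2`!%:R : R) by rewrite ltr0n fact_gt0.
  near=> h; have h0 : h != 0 by near: h; exact: nbhs_dnbhs_neq.
  rewrite [h *: 1]mulr1 addr0 (flat_le0 k (lexx 0)) subr0 sub0r normrN.
  rewrite [_ *: _](_ : _ = flat k.+1 h); last by rewrite flatS [LHS]mulrA mulVf// mul1r.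
  apply: le_lt_trans (flat_bound _ _) _; rewrite mulrC -ltr_pdivlMr//.
  near: h; apply/nbhs_ballP; exists (e / k.+2`!%:R); first by rewrite /= divr_gt0.
  by move=> h; rewrite -ball_normE /= sub0r normrN.
Unshelve. all: by end_near. Qed.

End flat_function.

Section bump.
Context {R : realType} {n : nat}.
Local Notation E := 'rV[R]_n.+1.

Lemma Ck_flat l k (W : set E) (h : E -> R) : open W -> smooth_open W h ->
  Ck l W (fun x => flat k (h x)).
Proof.
move=> oW sh; elim: l k => [|l IH] k.
  split=> // x Wx; apply: (continuous_comp (Ck_cont (sh 0%N) Wx)).
  exact: derive1_continuous (is_derive_flat k (h x)).
have D x i : W x -> is_derive x 'e_i (fun x => flat k (h x))
    ((flat k.+2 (h x) - k%:R * flat k.+1 (h x)) * 'D_'e_i h x).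
  move=> Wx; apply: is_derive_comp1; first exact: is_derive_flat.
  by apply/derivableP; exact: smooth_open_derivable sh Wx.
split=> [x Wx|i].
  apply: (continuous_comp (Ck_cont (sh 0%N) Wx)).
  exact: derive1_continuous (is_derive_flat k (h x)).
split=> [x Wx|]; first by have [] := D x i Wx.
apply: (Ck_eq (f := fun x => (flat k.+2 (h x) - k%:R * flat k.+1 (h x)) * 'D_'e_i h x)) => //.
  by move=> x Wx; have [_ ->] := D x i Wx.
apply: CkM => //; last exact: smooth_open_derive.
by apply: CkB => //; apply: CkM => //; exact: Ck_cst.
Qed.

(** The Euclidean distance is used because its square is smooth; one coordinate exceeding [r] in
    absolute value already makes it larger than [r]. *)
Lemma bump_function (p : E) (r : R) : 0 < r -> exists chi : E -> R,
  [/\ smooth_open setT chi, 0 < chi p & forall x, r < `|x - p| -> chi x = 0].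
Proof.
move=> r0; pose h (x : E) := r ^+ 2 - \sum_i (x 0 i - p 0 i) * (x 0 i - p 0 i).
have sh : smooth_open setT h.
  move=> k; apply: CkB; [exact: openT|exact: Ck_cst|].
  apply: Ck_sum => [|i _]; first exact: openT.
  by apply: CkM; try exact: openT; apply: CkB; try exact: openT;
    [exact: Ck_coord openT|exact: Ck_cst|exact: Ck_coord openT|exact: Ck_cst].
exists (fun x => flat 0 (h x)); split.
- by move=> k; apply: Ck_flat => //; exact: openT.
- apply: flat_gt0; rewrite /h big1 ?subr0 ?exprn_gt0// => i _.
  by rewrite subrr mul0r.
- move=> x xr; apply: flat_le0; rewrite /h subr_le0.
  have [i ri] : exists i, r < `|x 0 i - p 0 i|.
    apply: contrapT => /forallNP ni; move: xr; rewrite ltNge => /negP; apply.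
    by apply: norm_leP (ltW r0) _ => i; rewrite !mxE leNgt; apply/negP/ni.
  rewrite (bigD1 i)//=; apply: (@le_trans _ _ ((x 0 i - p 0 i) * (x 0 i - p 0 i))).
    rewrite -expr2 -[leRHS]real_normK ?num_real// lerXn2r ?nnegrE ?(ltW r0) ?(ltW ri) ?normr_ge0//.
  by rewrite lerDl sumr_ge0// => j _; rewrite -expr2 sqr_ge0.
Qed.

End bump.

(** * From extension of covariant derivatives to extension of Christoffel symbols *)

Section local_christoffel.
Context {R : realType} {n : nat} {N : bmanifold R n}.
Local Notation E := 'rV[R]_n.+1.
Implicit Types (a b : chart_index N) (p q : N) (U : set N).

Lemma open_chart_preimage a (W : set E) : open W -> open (dom (chart a) `&` chart a @^-1` W).
Proof.
move=> oW; have /continuousP/(_ W oW) H := @coord_cont _ _ _ (chart a).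
have [V oV VE] := (open_subspaceP _ _).1 H.
rewrite (_ : _ `&` _ = V `&` dom (chart a)); last by rewrite VE setIC.
by apply: openI => //; exact: dom_open.
Qed.

Lemma img_chart_preimage U a (W : set E) :
  img (U `&` (dom (chart a) `&` chart a @^-1` W)) a = img U a `&` W.
Proof.
apply/seteqP; split=> x; first by move=> [p [[Up [ap Wp]] _] <-]; split=> //; exists p.
by move=> [[p [Up ap] <-] Wx]; exists p.
Qed.

(** A closed coordinate ball cut by the half-space is compact, so its image under the continuous
    [point_at] is compact, hence closed in the Hausdorff manifold. It is a support outside which a
    field built in one chart can be extended by zero. *)
Lemma closed_chart_ball U a p (r : R) :
  (forall y, `|y - chart a p| <= r -> 0 <= y 0 0 -> img U a y) ->
  exists2 C : set N, closed C & C `<=` U `&` dom (chart a) /\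
    forall q, dom (chart a) q -> ~ C q -> r < `|chart a q - chart a p|.
Proof.
move=> hr; pose B := [set y : E | `|y - chart a p| <= r /\ 0 <= y 0 0].
have cB : compact B.
  apply: bounded_closed_compact.
    exists (`|chart a p| + r); split; first exact: num_real.
    move=> M hM y [yr _]; apply: ltW; apply: le_lt_trans hM.
    rewrite -(subrK (chart a p) y) addrC; apply: le_trans (ler_normD _ _) _.
    by rewrite lerD2l.
  apply: closedI.
    apply: (@preimage_closed _ _ (fun y : E => `|y - chart a p|) [set t : R | t <= r]); last exact: closed_le.
    move=> y _; apply: (@continuous_comp _ _ _ (fun y : E => y - chart a p) (fun z : E => `|z|)).
      by apply: (@cvgB _ _ _ (nbhs y)); [exact: cvg_id|exact: cvg_cst].
    exact: norm_continuous.
  apply: (@preimage_closed _ _ (fun y : E => y 0 0) [set t | 0 <= t]); last exact: closed_ge.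
  by move=> y _; exact: coord_continuous.
have sB : B `<=` chart a @` dom (chart a).
  by move=> y [y1 y2]; have [q [_ aq] <-] := hr y y1 y2; exists q.
exists (point_at (chart a) @` B).
  apply: compact_closed; first exact: bm_hausdorff.
  apply: continuous_compact => //.
  exact: continuous_subspaceW sB (@point_at_cont _ _ _ (chart a)).
split.
  move=> q [y [y1 y2] <-]; have [h1 h2 _] := img_point (hr y y1 y2); by split.
move=> q aq nC; rewrite ltNge; apply/negP => qr; apply: nC; exists (chart a q).
  by split=> //; exact: coord_ge0.
exact: point_atK.
Qed.

(* The components are recovered from [chi^2 Gam = zeta - chi d chi] for the fields
   [chi d_i], where [chi] is a bump function with [chi > 0] at [p]. *)
Lemma local_christoffel (nabla : connection N) Ups U p a : open U -> U p -> dom (chart a) p ->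
  extends_with nabla U Ups ->
  exists V (Gam : 'I_n.+1 -> 'I_n.+1 -> 'I_n.+1 -> E -> R),
    [/\ open V, V p, V `<=` U `&` dom (chart a),
      forall i j k, smooth_on (img V a) (Gam i j k) &
      forall x i j k, img (V `&` inner N) a x ->
        Gam i j k x = nabla a i j k x + Ups a x 0 i * (j == k)%:R + Ups a x 0 j * (i == k)%:R].
Proof.
move=> oU Up ap ext.
have oI := img_rel_open a oU.
have [r0 r00 hr0] := rel_open_ball oI (imgI_pred Up ap).
have r2 : 0 < r0 / 2 by rewrite divr_gt0.
have hr y : `|y - chart a p| <= r0 / 2 -> 0 <= y 0 0 -> img U a y.
  by move=> yr; apply: hr0; apply: le_lt_trans yr _; rewrite ltr_pdivrMr// ltr_pMr// ltr1n.
have [C cC [CU hC]] := closed_chart_ball hr.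
have [chi [schi chip chi0]] := bump_function (chart a p) r2.
have schi_on A : smooth_on A chi.
  by apply: smooth_on_sub (@subsetT _ A) _; apply: smooth_open_on => //; exact: openT.
have hxi i : exists v : vector_field U, forall x, img U a x -> v a x = chi x *: 'e_i.
  apply: (@vector_field_of_chart _ _ _ a U C (fun x => chi x *: 'e_i)) => //.
  - by move=> q [/CU[]].
  - move=> j; apply: (smooth_on_eq (f := fun x => chi x * ('e_i : E) 0 j)).
      by move=> x _; rewrite [RHS]mxE.
    by apply: smooth_onM => //; exact: smooth_on_cst.
  - by move=> q Uq aq nCq; rewrite chi0 ?scale0r//; exact: hC.
have [xi hxi'] := choice hxi.
have hz ij : exists zeta : vector_field U, forall b x, img (U `&` inner N) b x ->
    zeta b x = proj_covariant nabla Ups (xi ij.1) (xi ij.2) b x by exact: ext.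
have [zeta hzeta] := choice hz.
pose W := [set x | chi x != 0].
have oW : open W.
  apply: (@open_comp _ _ chi [set t | t != 0]); last exact: open_neq.
  by move=> x _; exact: Ck_cont (schi 0%N) I.
exists (U `&` (dom (chart a) `&` chart a @^-1` W)).
exists (fun i j k x => (zeta (i, j) a x 0 k - chi x * pd i chi x * (j == k)%:R) / (chi x * chi x)).
have VU : U `&` (dom (chart a) `&` chart a @^-1` W) `<=` U by move=> q [].
split.
- by apply: openI => //; exact: open_chart_preimage.
- by split=> //; split=> //; rewrite /preimage /W /= gt_eqF.
- by move=> q [Uq [aq _]].
- move=> i j k; apply: smooth_onM.
    apply: smooth_onB; first exact: smooth_on_sub (img_sub VU) (@vf_smooth _ _ _ _ (zeta (i, j)) a k).
    apply: smooth_onM; last exact: smooth_on_cst.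
    apply: smooth_onM => //; apply: smooth_on_sub (img_sub VU) _.
    exact: smooth_on_pd.
  apply: smooth_onV; last exact: smooth_onM.
  by rewrite img_chart_preimage => x [_ Wx]; rewrite mulf_neq0.
- move=> x i j k [q [[[Uq [aq Wq]] iq] _] <-].
  have Iq : img (U `&` inner N) a (chart a q) by exists q.
  have Uaq : img U a (chart a q) by exists q.
  set y := chart a q in Iq Uaq Wq *.
  rewrite hzeta// /proj_covariant /covariant !mxE.
  have xiE l s : xi l a y 0 s = chi y * (s == l)%:R by rewrite hxi'// !mxE eqxx.
  have dxi l s t : pd s (fun z => xi l a z 0 t) y = pd s chi y * (t == l)%:R.
    transitivity (pd s (fun z => chi z * (t == l)%:R) y).
      apply: (pd_eq s oI _ Uaq); first exact: (@vf_smooth _ _ _ _ (xi l) a t).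
      by move=> z Uz; rewrite hxi'// !mxE eqxx.
    rewrite (pdM s oI Uaq) ?(pd_cst s oI Uaq) ?mulr0 ?addr0//; exact: smooth_on_cst.
  have pr l : pairing (Ups a y) (xi l a y) = chi y * Ups a y 0 l.
    rewrite /pairing (bigD1 l)//= xiE eqxx mulr1 big1 ?addr0 1?mulrC// => s /negbTE sl.
    by rewrite xiE sl !mulr0.
  rewrite !pr !xiE /=.
  have -> : \sum_s xi i a y 0 s * pd s (fun z => xi j a z 0 k) y = chi y * pd i chi y * (j == k)%:R.
    rewrite (bigD1 i)//= xiE dxi eqxx mulr1 big1 ?addr0; first by rewrite mulrA eq_sym.
    by move=> s /negbTE sl; rewrite xiE sl mulr0 mul0r.
  have -> : \sum_s \sum_t nabla a s t k y * xi i a y 0 s * xi j a y 0 t = nabla a i j k y * chi y * chi y.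
    rewrite (bigD1 i)//= [X in _ + X]big1 ?addr0; last first.
      by move=> s /negbTE sl; rewrite big1// => t _; rewrite xiE sl mulr0 mulr0 mul0r.
    rewrite (bigD1 j)//= !xiE !eqxx !mulr1 big1 ?addr0// => t /negbTE tl.
    by rewrite xiE tl !mulr0.
  have c0 : chi y != 0 by [].
  rewrite (eq_sym k j) (eq_sym k i).
  by field.
Qed.

End local_christoffel.

(** * Prolongation of the metrizability equation *)

Section span.
Context {R : realType} {n : nat}.
Local Notation E := 'rV[R]_n.+1.
Variables (B Bp : set E).
Hypotheses (oB : open B) (oBp : rel_open Bp) (BpB : Bp `<=` B).
Implicit Types (f g c : E -> R) (G : (E -> R) -> Prop).

(* The coefficients are smooth on [B], which also contains the points beyond the boundary. *)
Inductive span G : (E -> R) -> Prop :=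
| span_gen f : G f -> span G f
| span0 : span G (fun=> 0)
| spanD f g : span G f -> span G g -> span G (fun x => f x + g x)
| spanM c f : smooth_open B c -> span G f -> span G (fun x => c x * f x)
| span_eq f g : (forall x, Bp x -> f x = g x) -> span G f -> span G g.

Lemma spanZ G (c : R) f : span G f -> span G (fun x => c * f x).
Proof. by apply: spanM => k; exact: Ck_cst. Qed.

Lemma spanB G f g : span G f -> span G g -> span G (fun x => f x - g x).
Proof.
move=> sf sg; apply: (span_eq (f := fun x => f x + (-1) * g x)); first by move=> x _; rewrite mulN1r.
exact: spanD sf (spanZ _ sg).
Qed.

Lemma span_sum G (I : Type) (s : seq I) (F : I -> E -> R) : (forall i, span G (F i)) ->
  span G (fun x => \sum_(i <- s) F i x).
Proof.
move=> h; elim: s => [|i s IH].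
  by apply: (span_eq (f := fun=> 0)); [move=> x _; rewrite big_nil|exact: span0].
by apply: (span_eq (f := fun x => F i x + \sum_(j <- s) F j x));
  [move=> x _; rewrite big_cons|exact: spanD].
Qed.

Lemma span_sub G G' f : (forall g, G g -> span G' g) -> span G f -> span G' f.
Proof.
move=> GG'; elim=> [g /GG'//||g h _ sg _ sh|c g sc _ sg|g h gh _ sg]; first exact: span0.
- exact: spanD.
- exact: spanM.
- exact: span_eq gh sg.
Qed.

Lemma smooth_open_onB c : smooth_open B c -> smooth_on Bp c.
Proof. by move=> sc; apply: smooth_on_sub BpB _; exact: smooth_open_on. Qed.

Lemma span_smooth G f : (forall g, G g -> smooth_on Bp g) -> span G f -> smooth_on Bp f.
Proof.
move=> sG; elim=> [g /sG//||g h _ sg _ sh|c g sc _ sg|g h gh _ sg].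
- exact: smooth_on_cst.
- exact: smooth_onD.
- by apply: smooth_onM => //; exact: smooth_open_onB.
- exact: smooth_on_eq gh sg.
Qed.

(** Leibniz: a derivative falls either on a coefficient, leaving a generator of [G], or on a
    generator; hence the two conditions on [G'], to be checked on generators only. *)
Lemma span_pd G G' f k : (forall g, G g -> smooth_on Bp g) ->
  (forall g, G g -> span G' g) -> (forall g, G g -> span G' (pd k g)) ->
  span G f -> span G' (pd k f).
Proof.
move=> sG GG' dG sf.
suff : span G' f /\ span G' (pd k f) by case.
elim: sf => [g Gg||g h hg [sg dg] hh [sh dh]|c g sc hg [sg dg]|g h gh hg [sg dg]].
- by split; [exact: GG'|exact: dG].
- split; first exact: span0.
  apply: (span_eq (f := fun=> 0)); last exact: span0.
  by move=> x Bx; rewrite (pd_cst k oBp Bx).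
- split; first exact: spanD.
  apply: (span_eq _ (spanD dg dh)) => x Bx.
  by rewrite (pdD k oBp Bx) //; exact: span_smooth sG _.
- split; first exact: spanM.
  apply: (span_eq (f := fun x => 'D_'e_k c x * g x + c x * pd k g x)).
    move=> x Bx; rewrite (pdM k oBp Bx); [|exact: smooth_open_onB|exact: span_smooth sG hg].
    by rewrite (@pdE _ _ Bp B c c x k oBp Bx oB (BpB Bx) (sc 1%N)).
  by apply: spanD; apply: spanM => //; exact: smooth_open_derive.
- split; first exact: span_eq gh sg.
  apply: (span_eq _ dg) => x Bx; apply: (pd_eq k oBp _ Bx gh).
  exact: span_smooth sG hg.
Qed.

(** Membership in [span] spares explicit formulas during the prolongation; here it becomes the row
    of coefficients that the differential equation needs. *)
Lemma span_finite (I : finType) (X : I -> E -> R) f : span (fun g => exists i, g = X i) f ->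
  exists c : I -> E -> R, (forall i, smooth_open B (c i)) /\
    forall x, Bp x -> f x = \sum_i c i x * X i x.
Proof.
elim=> [g [i ->]||g h _ [c [sc hc]] _ [d [sd hd]]|c g sc _ [d [sd hd]]|g h gh _ [c [sc hc]]].
- exists (fun j _ => (j == i)%:R); split; first by move=> j k; exact: Ck_cst.
  move=> x _; rewrite (bigD1 i)//= eqxx mul1r big1 ?addr0// => j /negbTE ->.
  by rewrite mul0r.
- exists (fun _ _ => 0); split; first by move=> j k; exact: Ck_cst.
  by move=> x _; rewrite big1// => j _; rewrite mul0r.
- exists (fun i x => c i x + d i x); split; first by move=> i k; apply: CkD => //; [exact: sc|exact: sd].
  move=> x Bx; rewrite hc// hd// -big_split /=; apply: eq_bigr => i _; by rewrite mulrDl.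
- exists (fun i x => c x * d i x); split; first by move=> i k; apply: CkM => //; exact: sd.
  by move=> x Bx; rewrite hd// mulr_sumr; apply: eq_bigr => i _; rewrite mulrA.
- by exists c; split=> // x Bx; rewrite -gh// hc.
Qed.

End span.

Section prolongation.
Context {R : realType} {n : nat}.
Local Notation E := 'rV[R]_n.+1.
Variables (p : E) (delta : R) (sg : 'I_n.+1 -> 'I_n.+1 -> E -> R) (mu : 'I_n.+1 -> E -> R)
  (P : 'I_n.+1 -> 'I_n.+1 -> 'I_n.+1 -> E -> R).
Hypotheses (n0 : (0 < n)%N) (delta0 : 0 < delta) (p0 : p 0 0 = 0).
Let B := cube p delta.
Let Bp := B `&` [set x : E | 0 < x 0 0].
Hypothesis P_smooth : forall k i j, smooth_open B (P k i j).
Hypothesis sg_smooth : forall i j, smooth_on Bp (sg i j).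
Hypothesis mu_smooth : forall j, smooth_on Bp (mu j).

(** The terms of order zero of the metrizability equation: being linear in [sg], they never
    introduce a new unknown when differentiated. *)
Let ell k i j x := - (\sum_l sg i l x * P k l j x) - \sum_l P k l i x * sg l j x.

Hypothesis metrizability : forall k i j x, Bp x ->
  pd k (sg i j) x = (k == j)%:R * mu i x + (k == i)%:R * mu j x + ell k i j x.

Let oB : open B. Proof. exact: cube_open. Qed.
Let BpB : Bp `<=` B. Proof. by move=> x []. Qed.
Let oBp' : open Bp. Proof. by apply: openI => //; exact: open_pos. Qed.
Let oBp : rel_open Bp.
Proof. by exists Bp => //; apply/seteqP; split=> x [] // h1 h2; split=> //; exact: ltW. Qed.

(** Three levels of unknowns: derivatives of the first two levels are spanned by the next one, and
    the system closes because [d_0] of the last unknown is again spanned by [Gr]. *)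
Let Gs f := exists i j, f = sg i j.
Let Gm f := Gs f \/ exists j, f = mu j.
Let Gr f := Gm f \/ f = pd 0 (mu 0).
Local Notation span := (span B Bp).

Let Gs_smooth f : Gs f -> smooth_on Bp f. Proof. by move=> [i [j ->]]. Qed.
Let Gm_smooth f : Gm f -> smooth_on Bp f. Proof. by move=> [/Gs_smooth//|[j ->]]. Qed.
Let GsGm f : Gs f -> span Gm f. Proof. by move=> h; apply: span_gen; left. Qed.
Let GmGr f : Gm f -> span Gr f. Proof. by move=> h; apply: span_gen; left. Qed.
Let span_mu j : span Gm (mu j). Proof. by apply: span_gen; right; exists j. Qed.

Let span_ell k i j : span Gs (ell k i j).
Proof.
apply: spanB; last first.
  by apply: span_sum => l; apply: spanM => //; apply: span_gen; exists l, j.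
apply: (span_eq (f := fun x => 0 - \sum_l sg i l x * P k l j x)); first by move=> x _; rewrite sub0r.
apply: spanB; first exact: span0.
apply: span_sum => l; apply: (span_eq (f := fun x => P k l j x * sg i l x)).
  by move=> x _; rewrite mulrC.
by apply: spanM => //; apply: span_gen; exists i, l.
Qed.

Let span_dsg k f : span Gs f -> span Gm (pd k f).
Proof.
apply: (span_pd oB oBp BpB Gs_smooth GsGm) => _ [i [j ->]].
apply: (span_eq (f := fun x => (k == j)%:R * mu i x + (k == i)%:R * mu j x + ell k i j x)).
  by move=> x Bx; rewrite metrizability.
by apply: spanD; [apply: spanD; exact: spanZ|exact: span_sub GsGm (span_ell k i j)].
Qed.

Let ell_smooth k i j : smooth_on Bp (ell k i j).
Proof. exact: span_smooth oB BpB _ _ Gs_smooth (span_ell k i j). Qed.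

(* the mixed second derivatives of [sg i j], computed from [metrizability] in both orders *)
Let integrability k l i j x : Bp x ->
  (l == j)%:R * pd k (mu i) x + (l == i)%:R * pd k (mu j) x + pd k (ell l i j) x =
  (k == j)%:R * pd l (mu i) x + (k == i)%:R * pd l (mu j) x + pd l (ell k i j) x.
Proof.
move=> Bx.
have key a b : pd a (pd b (sg i j)) x =
    (b == j)%:R * pd a (mu i) x + (b == i)%:R * pd a (mu j) x + pd a (ell b i j) x.
  transitivity (pd a (fun x => (b == j)%:R * mu i x + (b == i)%:R * mu j x + ell b i j x) x).
    by apply: (pd_eq a oBp _ Bx) => [|y By]; [exact: smooth_on_pd|rewrite metrizability].
  have sM c i' : smooth_on Bp (fun x => c * mu i' x) by apply: smooth_onM => //; exact: smooth_on_cst.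
  rewrite (pdD a oBp Bx)//; last exact: smooth_onD.
  rewrite (pdD a oBp Bx)// !(pdM a oBp Bx)//; try exact: smooth_on_cst.
  by rewrite !(pd_cst a oBp Bx) !mul0r !add0r.
by rewrite -!key; exact: (pd_schwarz k oBp Bx l).
Qed.

(** With [i = j = l = b] and [k = a], integrability leaves [2 d_a mu^b] against derivatives of
    [ell]. *)
Let span_pd_mu_offdiag a b : a != b -> span Gm (pd a (mu b)).
Proof.
move=> ab.
apply: (span_eq (f := fun x => 2^-1 * (pd b (ell a b b) x - pd a (ell b b b) x))).
  move=> x Bx; have := integrability a b b b Bx; rewrite eqxx (negbTE ab) !mul1r !mul0r !add0r => <-.
  by field.
by apply: spanZ; apply: spanB; apply: span_dsg; exact: span_ell.
Qed.

(** With [k = j = a] and [l = i = b], integrability leaves [d_a mu^a - d_b mu^b]. So the derivative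
    of [mu] is a multiple of the identity modulo lower terms, and the single unknown [d_0 mu^0]
    stands for the multiple. *)
Let span_pd_mu_diag a b : a != b -> span Gm (fun x => pd a (mu a) x - pd b (mu b) x).
Proof.
move=> ab.
apply: (span_eq (f := fun x => pd b (ell a b a) x - pd a (ell b b a) x)).
  move=> x Bx; have := integrability a b b a Bx.
  rewrite !eqxx (negbTE ab) eq_sym (negbTE ab) !mul1r !mul0r !add0r addr0 => h.
  have {}h : pd b (ell a b a) x = pd a (mu a) x + pd a (ell b b a) x - pd b (mu b) x.
    by rewrite h addrAC subrr add0r.
  by rewrite h; ring.
by apply: spanB; apply: span_dsg; exact: span_ell.
Qed.

Let span_pd_mu a b : span Gr (pd a (mu b)).
Proof.
have [<-|ab] := eqVneq a b; last exact: span_sub GmGr (span_pd_mu_offdiag ab).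
have rho : span Gr (pd 0 (mu 0)) by apply: span_gen; right.
have [->//|a0] := eqVneq a 0.
apply: (span_eq (f := fun x => pd a (mu a) x - pd 0 (mu 0) x + pd 0 (mu 0) x)).
  by move=> x _; rewrite subrK.
by apply: spanD => //; apply: span_sub GmGr _; exact: span_pd_mu_diag.
Qed.

Let span_dm k f : span Gm f -> span Gr (pd k f).
Proof.
apply: (span_pd oB oBp BpB Gm_smooth GmGr) => g [Gg|[j ->]]; last exact: span_pd_mu.
by apply: span_sub GmGr _; apply: span_dsg; exact: span_gen.
Qed.

(** For [b != 0], [d_0 d_b mu^b = d_b (d_0 mu^b)] with [d_0 mu^b] of lower level, while [d_b mu^b]
    and [d_0 mu^0] differ by lower terms; this expresses [d_0 d_0 mu^0]. Such a [b] exists because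
    [0 < n]. *)
Let span_pd_rho : span Gr (pd 0 (pd 0 (mu 0))).
Proof.
have [b b0] : exists b : 'I_n.+1, b != 0.
  by exists (Ordinal (n0 : (1 < n.+1)%N)).
pose h x := pd b (mu b) x - pd 0 (mu 0) x.
have sh : span Gm h by exact: span_pd_mu_diag.
have s0b : span Gm (pd 0 (mu b)) by apply: span_pd_mu_offdiag; rewrite eq_sym.
apply: (span_eq (f := fun x => pd b (pd 0 (mu b)) x - pd 0 h x)); last by apply: spanB; exact: span_dm.
move=> x Bx; rewrite (pd_schwarz b oBp Bx 0 (mu_smooth b)).
rewrite -(pdB 0 oBp Bx); [|exact: smooth_on_pd|exact: span_smooth oB BpB _ _ Gm_smooth sh].
apply: (pd_eq 0 oBp _ Bx).
  by apply: smooth_onB; [exact: smooth_on_pd|exact: span_smooth oB BpB _ _ Gm_smooth sh].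
by move=> y _; rewrite /h subKr.
Qed.

(** Only [sg] is returned: [mu] and the density are recovered from it later by a derivative and a
    determinant. *)
Theorem metrizability_extension : exists2 delta', 0 < delta' <= delta &
  exists Y : 'I_n.+1 -> 'I_n.+1 -> E -> R, (forall i j, smooth_open (cube p delta') (Y i j)) /\
    forall i j x, cube p delta' x -> 0 < x 0 0 -> Y i j x = sg i j x.
Proof.
pose I : finType := ('I_n.+1 * 'I_n.+1 + ('I_n.+1 + unit))%type.
pose X (i : I) : E -> R := match i with
  | inl ij => sg ij.1 ij.2 | inr (inl j) => mu j | inr (inr _) => pd 0 (mu 0) end.
have GrX f : Gr f -> span (fun g => exists i, g = X i) f.
  move=> [[[i [j ->]]|[j ->]]|->]; apply: span_gen.
  - by exists (inl (i, j)).
  - by exists (inr (inl j)).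
  - by exists (inr (inr tt)).
have sX i : smooth_on Bp (X i).
  by case: i => [ij|[j|u]] /=; [exact: sg_smooth|exact: mu_smooth|exact: smooth_on_pd].
have dX i : span Gr (pd 0 (X i)).
  case: i => [[i j]|[j|u]] /=; last exact: span_pd_rho.
    by apply: span_sub GmGr _; apply: span_dsg; apply: span_gen; exists i, j.
  exact: span_pd_mu.
have hA i := span_finite oB (span_sub GrX (dX i)).
have [A hA'] := choice hA.
have [|||delta' d' [Y [sY YX]]] := @linear_ode_extension R n I p delta X A delta0 p0.
- by move=> i j; have [h _] := hA' i; exact: h.
- by move=> i; apply: smooth_on_open.
- move=> i x Bx x0; have Bpx : Bp x by [].
  by rewrite -(pd_open 0 oBp' oBp (sX i) Bpx); have [_ ->] := hA' i.
exists delta' => //; exists (fun i j => Y (inl (i, j))); split=> //.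
by move=> i j x Qx x0; rewrite YX.
Qed.

End prolongation.

(** * Derivatives of determinants and of the metric *)

Section matrix_calculus.
Context {R : realType} {n : nat}.
Local Notation E := 'rV[R]_n.+1.
Implicit Types (A : set E) (x : E) (k : 'I_n.+1).

Definition msmooth p q A (M : E -> 'M[R]_(p, q)) :=
  forall i j, smooth_on A (fun x => M x i j).

Definition mpd p q k (M : E -> 'M[R]_(p, q)) x : 'M[R]_(p, q) :=
  \matrix_(i, j) pd k (fun y => M y i j) x.

Lemma msmoothM p q s A (M : E -> 'M[R]_(p, q)) (M' : E -> 'M[R]_(q, s)) :
  msmooth A M -> msmooth A M' -> msmooth A (fun x => M x *m M' x).
Proof.
move=> sM sM' i j; apply: (smooth_on_eq (f := fun x => \sum_l M x i l * M' x l j)).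
  by move=> x _; rewrite mxE.
by apply: smooth_on_sum => l _; exact: smooth_onM.
Qed.

Lemma msmoothD p q A (M M' : E -> 'M[R]_(p, q)) :
  msmooth A M -> msmooth A M' -> msmooth A (fun x => M x + M' x).
Proof.
move=> sM sM' i j; apply: (smooth_on_eq (f := fun x => M x i j + M' x i j)).
  by move=> x _; rewrite mxE.
exact: smooth_onD.
Qed.

Lemma msmoothZ p q A (f : E -> R) (M : E -> 'M[R]_(p, q)) :
  smooth_on A f -> msmooth A M -> msmooth A (fun x => f x *: M x).
Proof.
move=> sf sM i j; apply: (smooth_on_eq (f := fun x => f x * M x i j)).
  by move=> x _; rewrite mxE.
exact: smooth_onM.
Qed.

Lemma msmooth_sum p q A (I : finType) (M : I -> E -> 'M[R]_(p, q)) :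
  (forall l, msmooth A (M l)) -> msmooth A (fun x => \sum_l M l x).
Proof.
move=> sM i j; apply: (smooth_on_eq (f := fun x => \sum_l M l x i j)).
  by move=> x _; rewrite summxE.
by apply: smooth_on_sum => l _; exact: sM.
Qed.

Lemma msmooth_pd p q A k (M : E -> 'M[R]_(p, q)) : rel_open A -> msmooth A M -> msmooth A (mpd k M).
Proof.
move=> oA sM i j; apply: (smooth_on_eq (f := pd k (fun y => M y i j))).
  by move=> x _; rewrite mxE.
exact: smooth_on_pd.
Qed.

Lemma smooth_on_det p A (M : E -> 'M[R]_p) : msmooth A M -> smooth_on A (fun x => \det (M x)).
Proof.
move=> sM; rewrite /determinant; apply: smooth_on_sum => s _; apply: smooth_onM.
  exact: smooth_on_cst.
by apply: smooth_on_prod => i _; exact: sM.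
Qed.

Lemma msmooth_invmx p A (M : E -> 'M[R]_p) : (forall x, A x -> M x \in unitmx) ->
  msmooth A M -> msmooth A (fun x => invmx (M x)).
Proof.
move=> uM sM i j.
apply: (smooth_on_eq (f := fun x => (\det (M x))^-1 * cofactor (M x) j i)).
  by move=> x Ax; rewrite /invmx uM// !mxE.
apply: smooth_onM.
  by apply: smooth_onV; [move=> x /uM; rewrite unitmxE unitfE|exact: smooth_on_det].
rewrite /cofactor; apply: smooth_onM; first exact: smooth_on_cst.
apply: smooth_on_det => i' j'; apply: (smooth_on_eq (f := fun x => M x (lift j i') (lift i j'))).
  by move=> x _; rewrite !mxE.
exact: sM.
Qed.

Section at_point.
Variables (A : set E) (x : E) (k : 'I_n.+1).
Hypotheses (oA : rel_open A) (Ax : A x).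

Lemma mpd_eq p q (M M' : E -> 'M[R]_(p, q)) : msmooth A M -> (forall y, A y -> M y = M' y) ->
  mpd k M x = mpd k M' x.
Proof.
move=> sM MM'; apply/matrixP => i j; rewrite !mxE; apply: (pd_eq k oA (sM i j) Ax) => y Ay.
by rewrite MM'.
Qed.

Lemma mpdM p q s (M : E -> 'M[R]_(p, q)) (M' : E -> 'M[R]_(q, s)) :
  msmooth A M -> msmooth A M' ->
  mpd k (fun x => M x *m M' x) x = mpd k M x *m M' x + M x *m mpd k M' x.
Proof.
move=> sM sM'; apply/matrixP => i j; rewrite [LHS]mxE [RHS]mxE [X in _ = X + _]mxE [X in _ = _ + X]mxE.
transitivity (pd k (fun y => \sum_l M y i l * M' y l j) x).
  by apply: (pd_eq k oA _ Ax) => [|y _]; [exact: msmoothM|rewrite mxE].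
rewrite (pd_sum k oA Ax) => [|l _]; last exact: smooth_onM.
by rewrite -big_split /=; apply: eq_bigr => l _; rewrite (pdM k oA Ax)// !mxE.
Qed.

Lemma mpdD p q (M M' : E -> 'M[R]_(p, q)) : msmooth A M -> msmooth A M' ->
  mpd k (fun x => M x + M' x) x = mpd k M x + mpd k M' x.
Proof.
move=> sM sM'; apply/matrixP => i j; rewrite !mxE -(pdD k oA Ax)//.
by apply: (pd_eq k oA _ Ax) => [|y _]; [exact: msmoothD|rewrite mxE].
Qed.

Lemma mpdZ p q (f : E -> R) (M : E -> 'M[R]_(p, q)) : smooth_on A f -> msmooth A M ->
  mpd k (fun x => f x *: M x) x = pd k f x *: M x + f x *: mpd k M x.
Proof.
move=> sf sM; apply/matrixP => i j; rewrite !mxE -(pdM k oA Ax)//.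
by apply: (pd_eq k oA _ Ax) => [|y _]; [exact: msmoothZ|rewrite mxE].
Qed.

Lemma mpd_sum p q (I : finType) (M : I -> E -> 'M[R]_(p, q)) : (forall l, msmooth A (M l)) ->
  mpd k (fun x => \sum_l M l x) x = \sum_l mpd k (M l) x.
Proof.
move=> sM; apply/matrixP => i j; rewrite [LHS]mxE summxE.
transitivity (pd k (fun y => \sum_l M l y i j) x).
  by apply: (pd_eq k oA _ Ax) => [|y _]; [exact: msmooth_sum|rewrite summxE].
rewrite (pd_sum k oA Ax) => [|l _]; last exact: sM.
by apply: eq_bigr => l _; rewrite mxE.
Qed.

Lemma mpd_cst p q (C : 'M[R]_(p, q)) : mpd k (fun=> C) x = 0.
Proof. by apply/matrixP => i j; rewrite !mxE (pd_cst k oA Ax). Qed.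

(** Obtained by differentiating [M M^-1 = 1]. *)
Lemma mpd_invmx p (M : E -> 'M[R]_p) : (forall x, A x -> M x \in unitmx) -> msmooth A M ->
  mpd k (fun x => invmx (M x)) x = - (invmx (M x) *m mpd k M x *m invmx (M x)).
Proof.
move=> uM sM; have sI := msmooth_invmx uM sM.
have h : mpd k M x *m invmx (M x) + M x *m mpd k (fun x => invmx (M x)) x = 0.
  rewrite -mpdM// -(mpd_cst 1%:M); apply: mpd_eq => [|y Ay]; first exact: msmoothM.
  by rewrite mulmxV ?uM.
have /(congr1 (mulmx (invmx (M x)))) := h.
rewrite mulmxDr mulKmx ?uM// mulmx0 mulmxA => /eqP.
by rewrite addrC addr_eq0 => /eqP.
Qed.

Lemma pd_prod (I : finType) (f : I -> E -> R) : (forall i, smooth_on A (f i)) ->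
  pd k (fun y => \prod_i f i y) x = \sum_i pd k (f i) x * \prod_(j | j != i) f j x.
Proof.
move=> sf.
suff H (s : seq I) : uniq s -> pd k (fun y => \prod_(i <- s) f i y) x =
    \sum_(i <- s) pd k (f i) x * \prod_(j <- s | j != i) f j x.
  rewrite -(H (index_enum I)) //; exact: index_enum_uniq.
elim: s => [|i s IH] /=.
  move=> _; rewrite big_nil -[RHS](pd_cst k oA Ax 1).
  by apply: (pd_eq k oA _ Ax) => [|y _]; [apply: smooth_on_prod|rewrite big_nil].
move=> /andP[ni us].
transitivity (pd k (fun y => f i y * \prod_(j <- s) f j y) x).
  by apply: (pd_eq k oA _ Ax) => [|y _]; [apply: smooth_on_prod|rewrite big_cons].
rewrite (pdM k oA Ax)//; last exact: smooth_on_prod.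
rewrite IH// !big_cons eqxx /=; congr (_ * _ + _).
  rewrite big_seq_cond [RHS]big_seq_cond; apply: eq_bigl => j.
  by case: (boolP (j \in s)) => //= js; apply/esym; apply: contraNneq ni => <-.
rewrite mulr_sumr big_seq [RHS]big_seq; apply: eq_bigr => j js.
rewrite big_cons; have -> : i != j by apply: contraNneq ni => ->.
ring.
Qed.

(** Jacobi's formula. The Leibniz rule gives a sum over the differentiated row [i]; expanding [Ni i]
    along that row only uses cofactors which the derivative does not touch. *)
Lemma pd_det p (M : E -> 'M[R]_p) : msmooth A M ->
  pd k (fun y => \det (M y)) x = \tr (mpd k M x *m \adj (M x)).
Proof.
move=> sM.
have sP (s : {perm 'I_p}) : smooth_on A (fun y => \prod_i M y i (s i)).
  by apply: smooth_on_prod => i _; exact: sM.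
rewrite /determinant (pd_sum k oA Ax); last first.
  by move=> s _; apply: smooth_onM => //; exact: smooth_on_cst.
pose Ni i := \matrix_(a, b) if a == i then mpd k M x a b else M x a b.
transitivity (\sum_i \det (Ni i)).
  rewrite exchange_big /=; apply: eq_bigr => s _.
  rewrite (pdM k oA Ax)//; last exact: smooth_on_cst.
  rewrite (pd_cst k oA Ax) mul0r add0r (pd_prod (f := fun i y => M y i (s i)))//.
  rewrite mulr_sumr; apply: eq_bigr => i _; congr (_ * _).
  rewrite /Ni [RHS](bigD1 i)//= !mxE eqxx; congr (_ * _).
  by apply: eq_bigr => j /negbTE ji; rewrite mxE ji.
rewrite /mxtrace; apply: eq_bigr => i _.
rewrite (expand_det_row _ i) mxE; apply: eq_bigr => j _.
rewrite [Ni i i j]mxE eqxx mxE; congr (_ * _); rewrite mxE /cofactor; congr (_ * \det _).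
by apply/matrixP => a b; rewrite !mxE eq_sym (negbTE (neq_lift _ _)).
Qed.

End at_point.
End matrix_calculus.

Section metric_calculus.
Context {R : realType} {n : nat}.
Local Notation E := 'rV[R]_n.+1.
Variables (A : set E) (g : E -> 'M[R]_n.+1) (Gam : 'I_n.+1 -> 'I_n.+1 -> 'I_n.+1 -> E -> R).
Hypotheses (oA : rel_open A) (g_smooth : msmooth A g)
  (g_sym : forall x, A x -> (g x)^T = g x) (g_unit : forall x, A x -> g x \in unitmx)
  (Gam_smooth : forall i j k, smooth_on A (Gam i j k))
  (Gam_sym : forall x, A x -> forall i j k, Gam i j k x = Gam j i k x)
  (compat : forall x, A x -> forall i j k, pd k (fun y => g y i j) x =
     \sum_l (Gam k i l x * g x l j + Gam k j l x * g x i l)).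

Let N1 : R := n.+2%:R.

Definition gmx k x : 'M[R]_n.+1 := \matrix_(i, l) Gam k i l x.
(* [n.+2] is the dimension plus one; [thomas] is the trace-free part of [Gam], which depends
   only on the projective class. *)
Definition ups k x : R := - (\sum_l Gam k l l x) / N1.
Definition thomas i j k x : R := Gam i j k x + ups i x * (j == k)%:R + ups j x * (i == k)%:R.
(* [rho = |det g| ^ (- 1 / n.+2)], through [det g ^ 2] because the sign of [det g] is arbitrary *)
Definition rho x : R := expR (- (ln ((\det (g x)) ^+ 2) / (2 * N1))).
(** The inverse metric with a density weight: [det sigma = rho^-(n+1) / det g = +-rho], so the scale
    is recovered from [sigma] alone. *)
Definition sigma x : 'M[R]_n.+1 := (rho x)^-1 *: invmx (g x).
Definition mu j x : R := \sum_l sigma x j l * ups l x.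

Let N10 : N1 != 0. Proof. by rewrite /N1 pnatr_eq0. Qed.

Lemma rho_gt0 x : 0 < rho x. Proof. exact: expR_gt0. Qed.

Lemma ups_smooth k : smooth_on A (ups k).
Proof.
rewrite /ups; apply: smooth_onM; last exact: smooth_on_cst.
by apply: smooth_onN; apply: smooth_on_sum.
Qed.

Lemma det_neq0 x : A x -> \det (g x) != 0.
Proof. by move=> /g_unit; rewrite unitmxE unitfE. Qed.

Lemma det2_gt0 x : A x -> 0 < (\det (g x)) ^+ 2.
Proof. by move=> /det_neq0 h; rewrite exprn_even_gt0. Qed.

Lemma rho_smooth : smooth_on A rho.
Proof.
rewrite /rho; apply: smooth_on_expR; apply: smooth_onN; apply: smooth_onM; last exact: smooth_on_cst.
apply: smooth_on_ln; first exact: det2_gt0.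
by apply: smooth_onM; exact: smooth_on_det.
Qed.

Lemma sigma_smooth i j : smooth_on A (fun x => sigma x i j).
Proof.
apply: msmoothZ; last exact: msmooth_invmx.
by apply: smooth_onV; [move=> x _; rewrite gt_eqF// rho_gt0|exact: rho_smooth].
Qed.

Lemma mu_smooth j : smooth_on A (mu j).
Proof.
by rewrite /mu; apply: smooth_on_sum => l _; apply: smooth_onM;
  [exact: sigma_smooth|exact: ups_smooth].
Qed.

Lemma sigma_sym x i j : A x -> sigma x i j = sigma x j i.
Proof.
move=> Ax; have h : (invmx (g x))^T = invmx (g x) by rewrite trmx_inv g_sym.
by rewrite !mxE -{1}h mxE.
Qed.

Lemma mpd_g k x : A x -> mpd k g x = gmx k x *m g x + g x *m (gmx k x)^T.
Proof.
move=> Ax; apply/matrixP => i j; rewrite !mxE compat// big_split /=; congr (_ + _).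
  by apply: eq_bigr => l _; rewrite mxE.
by apply: eq_bigr => l _; rewrite !mxE mulrC.
Qed.

Lemma tr_gmx k x : \tr (gmx k x) = - (N1 * ups k x).
Proof.
rewrite /ups mulrC divfK// opprK /mxtrace; by apply: eq_bigr => l _; rewrite mxE.
Qed.

(** Jacobi's formula with metric compatibility: each of the two Christoffel terms contributes the
    trace [- N1 ups_k]. *)
Lemma pd_det_g k x : A x -> pd k (fun y => \det (g y)) x = - (2 * N1 * ups k x) * \det (g x).
Proof.
move=> Ax; rewrite (pd_det k oA Ax g_smooth) mpd_g// mulmxDl mxtraceD.
rewrite -mulmxA mul_mx_adj mul_mx_scalar mxtraceZ.
rewrite mxtrace_mulC mulmxA mul_adj_mx mul_scalar_mx mxtraceZ mxtrace_tr tr_gmx.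
ring.
Qed.

(** So [ups = d rho / (2 rho)]: the form that corrects [Gam] to its trace-free part is the one
    prescribed by projective compactness of order 2, with [rho] as candidate defining function. *)
Lemma pd_rho k x : A x -> pd k rho x = 2 * ups k x * rho x.
Proof.
move=> Ax.
have sd := smooth_on_det g_smooth.
have sd2 : smooth_on A (fun y => (\det (g y)) ^+ 2) by apply: smooth_onM.
have d2 := det2_gt0 Ax.
have sln : smooth_on A (fun y => ln ((\det (g y)) ^+ 2)).
  by apply: smooth_on_ln => //; exact: det2_gt0.
pose phi (t : R) := expR (- (t / (2 * N1))).
have dphi t : is_derive t (1 : R) phi (phi t * - (2 * N1)^-1).
  apply: (@is_derive1_comp _ expR (fun t => - (t / (2 * N1)))).
  apply: is_deriveN.
  have := @is_deriveM R R (fun t => t) (fun=> (2 * N1)^-1) t 1 _ _ (is_derive_id _ _) (is_derive_cst _ _ _).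
  by rewrite [_ *: 0]mulr0 add0r [_ *: 1]mulr1.
rewrite (@pd_comp1 _ _ A x k oA Ax (fun y => ln ((\det (g y)) ^+ 2)) phi _ sln (dphi _)).
rewrite (pd_comp1 (A := A) k oA Ax sd2 (is_derive1_ln d2)).
transitivity (phi (ln (\det (g x) ^+ 2)) * - (2 * N1)^-1 *
  ((\det (g x) ^+ 2)^-1 * (2 * (\det (g x) * pd k (fun y => \det (g y)) x)))).
  congr (_ * (_ * _)); rewrite (pdM k oA Ax sd sd); ring.
rewrite pd_det_g// /rho -/(phi _); have dn := det_neq0 Ax.
move: N10 (phi _); generalize N1 => c c0 F.
by field; rewrite c0 dn.
Qed.

Lemma pd_rhoV k x : A x -> pd k (fun y => (rho y)^-1) x = - (2 * ups k x) * (rho x)^-1.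
Proof.
move=> Ax; have r0 : rho x != 0 by rewrite gt_eqF// rho_gt0.
have D : is_derive (rho x) (1 : R) (fun u : R => u^-1) (- (rho x) ^- 2).
  have d := @derivableV R R (fun u => u) (rho x) 1 r0 (@derivable_id _ _ _ _).
  have e := @deriveV R R (fun u => u) (rho x) 1 r0 (@derivable_id _ _ _ _).
  apply: DeriveDef d _; rewrite e.
  have -> : 'D_1 (fun u : R => u) (rho x) = 1 by exact: derive_id.
  by rewrite scaleNr [_ *: _]mulr1.
rewrite (pd_comp1 (A := A) k oA Ax rho_smooth D) pd_rho//.
by field.
Qed.

Lemma mpd_sigma k x : A x -> mpd k sigma x =
  - (2 * ups k x) *: sigma x - sigma x *m gmx k x - (gmx k x)^T *m sigma x.
Proof.
move=> Ax.
have sV : smooth_on A (fun y => (rho y)^-1).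
  by apply: smooth_onV; [move=> y _; rewrite gt_eqF// rho_gt0|exact: rho_smooth].
rewrite /sigma (mpdZ k oA Ax sV (msmooth_invmx g_unit g_smooth)) pd_rhoV//.
rewrite (mpd_invmx k oA Ax g_unit g_smooth) mpd_g//.
rewrite mulmxDr mulmxDl [invmx _ *m (_ *m g x)]mulmxA mulmxK ?g_unit//.
rewrite [invmx _ *m (g x *m _)]mulmxA mulVmx ?g_unit// mul1mx.
by rewrite opprD scalerDr !scalerN -scalemxAl -scalemxAr scalerA addrA.
Qed.

(** Passing from [Gam] to [thomas] adds [ups_k sigma] twice, which cancels the derivative of the
    weight [rho^-1]; the remaining Kronecker terms contract [ups] with [sigma] to [mu]. *)
Lemma sigma_metrizability k i j x : A x -> pd k (fun y => sigma y i j) x =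
  (k == j)%:R * mu i x + (k == i)%:R * mu j x +
  (- (\sum_l sigma x i l * thomas k l j x) - \sum_l thomas k l i x * sigma x l j).
Proof.
move=> Ax; have := mpd_sigma k Ax => /matrixP/(_ i j); rewrite [LHS]mxE => ->.
have e1 : \sum_l sigma x i l * thomas k l j x =
    (sigma x *m gmx k x) i j + ups k x * sigma x i j + (k == j)%:R * mu i x.
  rewrite mxE /mu mulr_sumr.
  have -> : ups k x * sigma x i j = \sum_l sigma x i l * (ups k x * (l == j)%:R).
    by rewrite (bigD1 j)//= eqxx mulr1 mulrC big1 ?addr0// => l /negbTE ->; rewrite !mulr0.
  rewrite -!big_split /=; apply: eq_bigr => l _; rewrite [gmx k x l j]mxE /thomas; ring.
have e2 : \sum_l thomas k l i x * sigma x l j =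
    ((gmx k x)^T *m sigma x) i j + ups k x * sigma x i j + (k == i)%:R * mu j x.
  rewrite mxE /mu mulr_sumr.
  have -> : ups k x * sigma x i j = \sum_l (ups k x * (l == i)%:R) * sigma x l j.
    by rewrite (bigD1 i)//= eqxx mulr1 big1 ?addr0// => l /negbTE ->; rewrite mulr0 mul0r.
  rewrite -!big_split /=; apply: eq_bigr => l _; rewrite [_^T i l]mxE [gmx k x l i]mxE /thomas.
  rewrite (sigma_sym j l Ax); ring.
rewrite e1 e2 !mxE; ring.
Qed.

(** Squares avoid the unknown sign of [det g]. The exponents balance by [2 (n+2) = 2 (n+1) + 2]: the
    inverse of [det g] against the [n+1] factors [rho^-1]. *)
Lemma det_sigma2 x : A x -> (\det (sigma x)) ^+ 2 = rho x ^+ 2.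
Proof.
move=> Ax; have r0 : rho x != 0 by rewrite gt_eqF// rho_gt0.
have d0 := det_neq0 Ax.
have h : rho x ^+ (2 * n.+2) = ((\det (g x)) ^+ 2)^-1.
  rewrite /rho -expRM_natr mulNr natrM -/N1 divfK ?mulf_neq0 ?pnatr_eq0//.
  by rewrite expRN lnK// posrE; exact: det2_gt0.
rewrite /sigma detZ det_inv exprMn [X in _ * X]exprVn -h.
rewrite exprVn exprVn -exprM mulnC (_ : (2 * n.+2 = 2 * n.+1 + 2)%N); last by lia.
by rewrite exprD mulrA mulVf ?mul1r// expf_neq0.
Qed.

Lemma thomas_sym x i j k : A x -> thomas i j k x = thomas j i k x.
Proof. by move=> Ax; rewrite /thomas (Gam_sym Ax) addrAC. Qed.

Lemma thomas_trace x l : A x -> \sum_k thomas k l k x = 0.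
Proof.
move=> Ax; rewrite /thomas !big_split /=.
have -> : \sum_k ups k x * (l == k)%:R = ups l x.
  by rewrite (bigD1 l)//= eqxx mulr1 big1 ?addr0// => k; rewrite eq_sym => /negbTE ->; rewrite mulr0.
have -> : \sum_(k < n.+1) ups l x * (k == k)%:R = n.+1%:R * ups l x.
  under eq_bigr do rewrite eqxx mulr1.
  by rewrite sumr_const card_ord mulr_natl.
have -> : \sum_k Gam k l k x = - (N1 * ups l x).
  rewrite /ups mulrC divfK// opprK; apply: eq_bigr => k _; exact: Gam_sym.
by rewrite /N1 -[n.+2%:R]natr1; ring.
Qed.

End metric_calculus.

(** * Invariance of the scalar curvature *)

Section curvature_matrices.
Context {R : realType} {n : nat}.
Local Notation E := 'rV[R]_n.+1.
Implicit Types (G : 'I_n.+1 -> E -> 'M[R]_n.+1) (x : E).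

(** The matrices act on row vectors, so compositions read from left to right, whence
    [G_j G_i - G_i G_j] where the usual formula has the other sign. *)
Definition curvature_mx G i j x : 'M[R]_n.+1 :=
  mpd i (G j) x - mpd j (G i) x + (G j x *m G i x - G i x *m G j x).

Definition ricci_mx G x : 'M[R]_n.+1 := \matrix_(j, l) \sum_k curvature_mx G k j x l k.

(** [H] stands for the second derivative of [J]; it is the same in both hypotheses and disappears in
    the antisymmetrisation. *)
Lemma curvature_gauge_algebra (J Gi Gj Bi Bj a a' b b' H : 'M[R]_n.+1) :
  a *m J + Gj *m (Gi *m J - J *m Bi) = H + ((Gi *m J - J *m Bi) *m Bj + J *m b) ->
  a' *m J + Gi *m (Gj *m J - J *m Bj) = H + ((Gj *m J - J *m Bj) *m Bi + J *m b') ->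
  (a - a' + (Gj *m Gi - Gi *m Gj)) *m J = J *m (b - b' + (Bj *m Bi - Bi *m Bj)).
Proof.
move=> /(canRL (addrK _)) e1 /(canRL (addrK _)) e2.
rewrite !mulmxDl !mulmxDr !mulNmx !mulmxN e1 e2 !mulmxBl !mulmxBr !mulmxA.
move: (Gi *m J *m Bj) (Gj *m J *m Bi) (J *m Bi *m Bj) (J *m Bj *m Bi) (J *m b) (J *m b')
  (Gj *m Gi *m J) (Gi *m Gj *m J) => m1 m2 m3 m4 m5 m6 m7 m8.
by apply/matrixP => u v; rewrite !mxE; ring.
Qed.

Section gauge.
Variables (A : set E) (J : E -> 'M[R]_n.+1) (G B : 'I_n.+1 -> E -> 'M[R]_n.+1).
Hypotheses (oA : rel_open A) (J_smooth : msmooth A J) (G_smooth : forall i, msmooth A (G i))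
  (B_smooth : forall i, msmooth A (B i))
  (gauge : forall i x, A x -> G i x *m J x = mpd i J x + J x *m B i x).

(** [J] acts here as a change of frame in the fibres, while the directions [i] and [j] of
    differentiation stay in the first chart; the second derivatives of [J] cancel by symmetry, and
    the curvature is merely conjugated. *)
Lemma curvature_gauge i j x : A x ->
  curvature_mx G i j x *m J x = J x *m curvature_mx B i j x.
Proof.
move=> Ax.
have dJ k : mpd k J x = G k x *m J x - J x *m B k x by rewrite gauge// addrK.
have key k l : mpd k (G l) x *m J x + G l x *m mpd k J x =
    mpd k (mpd l J) x + (mpd k J x *m B l x + J x *m mpd k (B l) x).
  rewrite -(mpdM k oA Ax)// -(mpdM k oA Ax)// -(mpdD k oA Ax); last 2 first.
  - exact: msmooth_pd.
  - exact: msmoothM.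
  by apply: (mpd_eq k oA Ax) => [|y Ay]; [exact: msmoothM|rewrite gauge].
have sym : mpd i (mpd j J) x = mpd j (mpd i J) x.
  apply/matrixP => u v; rewrite [LHS]mxE [RHS]mxE.
  have e q : (fun y => mpd q J y u v) = pd q (fun y => J y u v) by apply/funext => y; rewrite mxE.
  by rewrite !e (pd_schwarz i oA Ax).
apply: (@curvature_gauge_algebra _ _ _ _ _ _ _ _ _ (mpd i (mpd j J) x)).
  by rewrite -!dJ; exact: key.
by rewrite -!dJ sym; exact: key.
Qed.

End gauge.

Section pullback.
Variables (A : set E) (J : E -> 'M[R]_n.+1) (Gt B : 'I_n.+1 -> E -> 'M[R]_n.+1)
  (dG : 'I_n.+1 -> 'I_n.+1 -> E -> 'M[R]_n.+1).
Hypotheses (oA : rel_open A) (J_smooth : msmooth A J) (Gt_smooth : forall i, msmooth A (Gt i))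
  (J_closed : forall i j t x, A x -> pd i (fun y => J y j t) x = pd j (fun y => J y i t) x)
  (B_def : forall i x, B i x = \sum_s J x i s *: Gt s x)
  (chain : forall i t x, A x -> mpd i (Gt t) x = \sum_s J x i s *: dG s t x).

(** The complementary half of a change of chart, where only the directions of differentiation
    change. The terms in the derivative of [J] are symmetric in [i] and [j] by [J_closed], and
    cancel. *)
Lemma curvature_pullback i j x : A x -> curvature_mx B i j x =
  \sum_s \sum_t (J x i s * J x j t) *: (dG s t x - dG t s x + (Gt t x *m Gt s x - Gt s x *m Gt t x)).
Proof.
move=> Ax.
have dB k l : mpd k (B l) x = \sum_t pd k (fun y => J y l t) x *: Gt t x +
    \sum_s \sum_t (J x k s * J x l t) *: dG s t x.
  have -> : B l = fun y => \sum_t J y l t *: Gt t y by apply/funext => y; exact: B_def.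
  rewrite (mpd_sum k oA Ax) => [|t]; last exact: msmoothZ.
  rewrite exchange_big -big_split /=; apply: eq_bigr => t _.
  rewrite (mpdZ k oA Ax)//; congr (_ + _); rewrite chain// scaler_sumr.
  by apply: eq_bigr => s _; rewrite scalerA mulrC.
have BB k l : B l x *m B k x = \sum_s \sum_t (J x k s * J x l t) *: (Gt t x *m Gt s x).
  rewrite !B_def mulmx_suml exchange_big /=; apply: eq_bigr => t _.
  rewrite mulmx_sumr; apply: eq_bigr => s _.
  by rewrite -scalemxAl -scalemxAr scalerA mulrC.
rewrite /curvature_mx !dB [B j x *m _]BB [B i x *m _]BB.
under [\sum_t pd j _ x *: _]eq_bigr => t _ do rewrite -J_closed//.
rewrite opprD [X in X + _ = _]addrACA subrr add0r.
rewrite [X in _ - X + _]exchange_big [X in _ + (_ - X)]exchange_big /=.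
rewrite -!sumrB -big_split /=; apply: eq_bigr => s _.
rewrite -!sumrB -big_split /=; apply: eq_bigr => t _.
by rewrite scalerDr !scalerBr [J x j t * _]mulrC.
Qed.

End pullback.
End curvature_matrices.

Section scalar_curvature_invariance.
Context {R : realType} {n : nat} {N : bmanifold R n}.
Local Notation E := 'rV[R]_n.+1.
Implicit Types (nabla : connection N) (a b : chart_index N).

Definition connection_mx nabla a (i : 'I_n.+1) (x : E) := gmx (nabla a) i x.

Lemma riemann_curvature_mx nabla a i j l k x :
  riemann nabla a i j l k x = curvature_mx (connection_mx nabla a) i j x l k.
Proof.
have e q l' k' : (fun y => connection_mx nabla a q y l' k') = nabla a q l' k'.
  by apply/funext => y; rewrite mxE.
rewrite /riemann /curvature_mx !mxE !e; congr (_ + _).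
by rewrite -sumrB; apply: eq_bigr => s _; rewrite !mxE; ring.
Qed.

Lemma connection_mx_smooth nabla a i : msmooth (img (inner N) a) (connection_mx nabla a i).
Proof.
move=> l k; apply: (smooth_on_eq (f := nabla a i l k)); first by move=> x _; rewrite mxE.
exact: cn_smooth.
Qed.

Lemma inner_open : open (inner N).
Proof.
rewrite openE => p ip; have [a ap] := chart_cover p.
have oW := open_chart_preimage a (@open_pos R n).
apply: (@filterS _ (nbhs p)) (open_nbhs_nbhs (conj oW _)).
  by move=> q [aq /= q0] bq; move: q0; rewrite (boundary_coord bq aq) ltxx.
by split=> //; exact: inner_coord_gt0.
Qed.

(** The transformation law of a connection is factored into a change of frame ([curvature_gauge])
    and a change of directions ([curvature_pullback]). In the trace, the Jacobian on the direction
    index cancels against the inverse one on the fibre index. *)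
Lemma ricci_law nabla a b p : inner N p -> dom (chart a) p -> dom (chart b) p ->
  ricci_mx (connection_mx nabla a) (chart a p) =
  jac a b (chart a p) *m ricci_mx (connection_mx nabla b) (chart b p) *m (jac a b (chart a p))^T.
Proof.
move=> ip ap bp.
pose A := img (inner N `&` dom (chart b)) a.
have oN : open (inner N `&` dom (chart b)) by apply: openI; [exact: inner_open|exact: dom_open].
have oA : rel_open A by apply: img_rel_open.
have Ax : A (chart a p) by exists p.
have Aov : A `<=` overlap a b by apply: img_sub => q [].
pose J := jac a b; pose Gb := connection_mx nabla b.
pose Gt i x := Gb i (transition (chart a) (chart b) x).
pose dG s t x := mpd s (Gb t) (transition (chart a) (chart b) x).
(* The connection of chart [b], still in its own frame, with the direction index pulled back to
   chart [a]. *)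
pose B i x := \sum_s J x i s *: Gt s x.
have sJ : msmooth A J by move=> i j; exact: (smooth_on_sub Aov (@jac_smooth _ _ N a b i j)).
have sGb i : msmooth (img (inner N) b) (Gb i) by exact: connection_mx_smooth.
have sGt i : msmooth A (Gt i).
  by move=> l k; exact: (@smooth_on_transition _ _ N (inner N) a b _ (sGb i l k)).
have sG i : msmooth A (connection_mx nabla a i).
  move=> l k; apply: (smooth_on_sub _ (@connection_mx_smooth nabla a i l k)); by apply: img_sub => q [].
have sB i : msmooth A (B i) by apply: msmooth_sum => s; exact: msmoothZ.
have gauge i x : A x -> connection_mx nabla a i x *m J x = mpd i J x + J x *m B i x.
  move=> [q [[iq bq] aq] <-]; apply/matrixP => j l; rewrite [LHS]mxE [RHS]mxE.
  under eq_bigr => k _ do rewrite [connection_mx _ _ _ _ _ _]mxE.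
  have := @cn_law _ _ _ nabla a b q iq aq bq i j l; rewrite -/(J _) => ->; congr (_ + _).
    rewrite mxE; congr (pd i _ _); apply/funext => y; by rewrite mxE.
  rewrite [RHS]mxE exchange_big /=; apply: eq_bigr => t _.
  rewrite summxE mulr_sumr; apply: eq_bigr => s _.
  by rewrite !mxE transition_coord//; ring.
have closed i j t x : A x -> pd i (fun y => J y j t) x = pd j (fun y => J y i t) x.
  move=> Ax'; have e q : (fun y => J y q t) = pd q (fun y => transition (chart a) (chart b) y 0 t).
    by apply/funext => y; rewrite mxE.
  rewrite !e; apply: (pd_schwarz i oA Ax' j).
  exact: (smooth_on_sub Aov (@transition_smooth _ _ N a b t)).
have chain i t x : A x -> mpd i (Gt t) x = \sum_s J x i s *: dG s t x.
  move=> [q [[iq bq] aq] <-]; apply/matrixP => u v; rewrite mxE summxE.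
  rewrite (@pd_transition _ _ _ (inner N) a b q (fun y => Gb t y u v) i inner_open iq aq bq (sGb t u v)).
  by apply: eq_bigr => s _; rewrite [RHS]mxE /dG transition_coord// [mpd _ _ _ _ _]mxE.
have JV : J (chart a p) \in unitmx by exact: jac_unit.
have Rm i j : curvature_mx (connection_mx nabla a) i j (chart a p) *m J (chart a p) =
    J (chart a p) *m \sum_s \sum_t (J (chart a p) i s * J (chart a p) j t) *:
      curvature_mx Gb s t (chart b p).
  rewrite (curvature_gauge oA sJ sG sB gauge)//; congr (_ *m _).
  rewrite (curvature_pullback oA sJ sGt closed _ chain)//.
  apply: eq_bigr => s _; apply: eq_bigr => t _.
  by rewrite /dG /Gt transition_coord.
set x := chart a p in Ax JV Rm *; set y := chart b p in Rm *.
apply/matrixP => j l; rewrite [LHS]mxE.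
transitivity (\sum_k \sum_s \sum_t J x k s * J x j t *
   (J x *m curvature_mx Gb s t y *m invmx (J x)) l k).
  apply: eq_bigr => k _; rewrite -[curvature_mx _ _ _ _](mulmxK JV) Rm.
  rewrite mulmx_sumr mulmx_suml summxE; apply: eq_bigr => s _.
  rewrite mulmx_sumr mulmx_suml summxE; apply: eq_bigr => t _.
  by rewrite -scalemxAr -scalemxAl mxE.
transitivity (\sum_s \sum_t J x j t * (J x *m curvature_mx Gb s t y) l s).
  rewrite exchange_big; apply: eq_bigr => s _; rewrite exchange_big; apply: eq_bigr => t _ /=.
  rewrite -[in RHS](mulmxKV JV (J x *m _)) [(_ *m J x) l s]mxE mulr_sumr.
  by apply: eq_bigr => k _; ring.
rewrite exchange_big mxE.
under [RHS]eq_bigr => u _ do rewrite mxE mulr_suml.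
rewrite [RHS]exchange_big /=; apply: eq_bigr => t _.
rewrite -mulr_sumr; under [RHS]eq_bigr => u _ do rewrite -mulrA.
rewrite -mulr_sumr; congr (_ * _).
under eq_bigr => s _ do rewrite mxE.
rewrite exchange_big /=; apply: eq_bigr => u _.
rewrite !mxE mulr_suml; apply: eq_bigr => s _; exact: mulrC.
Qed.

Lemma scalar_curvature_mx g nabla a x :
  scalar_curvature g nabla a x = \tr (invmx (g a x) *m (ricci_mx (connection_mx nabla a) x)^T).
Proof.
rewrite /mxtrace; apply: eq_bigr => j _; rewrite mxE; apply: eq_bigr => l _.
congr (_ * _); rewrite !mxE; apply: eq_bigr => k _; exact: riemann_curvature_mx.
Qed.

(** The scalar curvature is given as a function of a chart and coordinates; this makes it a function
    on the interior, so that local extensions from different charts can be glued. *)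
Lemma scalar_curvature_chart g nabla a b p : inner N p -> dom (chart a) p -> dom (chart b) p ->
  scalar_curvature g nabla a (chart a p) = scalar_curvature g nabla b (chart b p).
Proof.
move=> ip ap bp; rewrite !scalar_curvature_mx (ricci_law _ ip ap bp) (gm_law g ip ap bp).
set J := jac a b _.
have uJ : J \in unitmx by exact: jac_unit.
have ug : g b (chart b p) \in unitmx by apply: gm_nondeg; exists p.
have -> : invmx (J *m g b (chart b p) *m J^T) = invmx J^T *m invmx (g b (chart b p)) *m invmx J.
  have uJT : J^T \in unitmx by rewrite unitmx_tr.
  have u1 : J *m g b (chart b p) *m J^T \in unitmx by rewrite !unitmx_mul uJ ug uJT.
  apply: (can_inj (mulmxK u1)); rewrite mulVmx// !mulmxA mulmxKV// mulmxKV// mulVmx//.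
rewrite !trmx_mul trmxK !mulmxA mulmxKV// mxtrace_mulC !mulmxA mulmxV ?unitmx_tr// mul1mx.
by [].
Qed.

End scalar_curvature_invariance.

(** * Scalar curvature in projective terms *)

Section kronecker_sums.
Context {R : realType} {n : nat}.
Implicit Types (f u : 'I_n.+1 -> R) (P : 'I_n.+1 -> 'I_n.+1 -> 'I_n.+1 -> R).

Lemma sum_deltar f j : \sum_k f k * (k == j)%:R = f j.
Proof. by rewrite (bigD1 j)//= eqxx mulr1 big1 ?addr0// => k /negbTE ->; rewrite mulr0. Qed.

Lemma sum_deltal f j : \sum_k f k * (j == k)%:R = f j.
Proof. by under eq_bigr => k _ do rewrite eq_sym; exact: sum_deltar. Qed.

(** The hypotheses are the vanishing of both traces of [P]. The constant is [(n+1) + 1 + 2]: the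
    term [u_j u_l] summed over [k], a Kronecker contraction, and the doubled product multiplying
    [(j == k)]. *)
Lemma thomas_quadratic P u j l (G := fun i j k => P i j k - u i * (j == k)%:R - u j * (i == k)%:R) :
  (forall i, \sum_k P k i k = 0) -> (forall i, \sum_k P i k k = 0) ->
  \sum_k \sum_s G j s k * G k l s =
  \sum_k \sum_s P j s k * P k l s - 2 * (\sum_k u k * P j l k) + (n%:R + 4) * (u j * u l).
Proof.
move=> t1 t2.
have h k : \sum_s G j s k * G k l s = \sum_s P j s k * P k l s - u k * P j l k - u l * P j k k
   - u j * P k l k + u j * (u k * (l == k)%:R) + u j * u l
   - (\sum_s u s * P k l s - 2 * u k * u l) * (j == k)%:R.
  transitivity (\sum_s (P j s k * P k l s - (u k * P j s k) * (l == s)%:R - (u l * P j s k) * (k == s)%:R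
     - (u j * G k l s) * (s == k)%:R
     - (j == k)%:R * (u s * P k l s) + (j == k)%:R * (u s * u k * (l == s)%:R)
     + (j == k)%:R * (u s * u l * (k == s)%:R))).
    by apply: eq_bigr => s _; rewrite /G; ring.
  rewrite !(sumrB, big_split) /= -!mulr_sumr !sum_deltal sum_deltar /G eqxx mulr1n.
  ring.
under eq_bigr => k _ do rewrite h.
rewrite !(sumrB, big_split) /= -!mulr_sumr !sum_deltal t1 t2.
rewrite sumr_const card_ord -[_ *+ _]mulr_natr -[n.+1%:R]natr1; ring.
Qed.
End kronecker_sums.

Section scalar_formula.
Context {R : realType} {n : nat}.
Local Notation E := 'rV[R]_n.+1.
Local Notation symbols := ('I_n.+1 -> 'I_n.+1 -> 'I_n.+1 -> E -> R).

Definition ricci_symbols (G : symbols) j l x : R :=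
  \sum_k (pd k (G j l k) x - pd j (G k l k) x +
    \sum_s (G k s k x * G j l s x - G j s k x * G k l s x)).

(** The Ricci expression of trace-free symbols: the two terms containing the trace [P_kl^k] have
    dropped out. *)
Definition thomas_ricci (P : symbols) j l x : R :=
  \sum_k pd k (P j l k) x - \sum_k \sum_s P j s k x * P k l s x.

(* The scalar curvature written so that each term contains [r] or its derivatives: it
   vanishes where [r] and [dr] do, and it makes sense on the boundary. *)
Definition scalar_form (P : symbols) (s : 'I_n.+1 -> 'I_n.+1 -> E -> R) (m : 'I_n.+1 -> E -> R)
    (r : E -> R) x : R :=
  r x * (\sum_j \sum_l s j l x * thomas_ricci P j l x) +
  n%:R * (r x * (\sum_j pd j (m j) x) + 2^-1 * (\sum_j m j x * pd j r x)
    - 2^-1 * (\sum_j \sum_l pd j (s j l) x * pd l r x)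
    - 2^-1 * (\sum_j \sum_l \sum_k s j l x * P j l k x * pd k r x)).

Variables (A : set E) (g : E -> 'M[R]_n.+1) (Gam : symbols).
Hypotheses (oA : rel_open A) (g_smooth : msmooth A g)
  (g_sym : forall x, A x -> (g x)^T = g x) (g_unit : forall x, A x -> g x \in unitmx)
  (Gam_smooth : forall i j k, smooth_on A (Gam i j k))
  (Gam_sym : forall x, A x -> forall i j k, Gam i j k x = Gam j i k x)
  (compat : forall x, A x -> forall i j k, pd k (fun y => g y i j) x =
     \sum_l (Gam k i l x * g x l j + Gam k j l x * g x i l)).

Local Notation U := (ups Gam).
Local Notation Pi := (thomas Gam).

Lemma thomas_smooth i j k : smooth_on A (Pi i j k).
Proof.
by rewrite /thomas; apply: smooth_onD; [apply: smooth_onD => //|]; apply: smooth_onM;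
  [exact: ups_smooth|exact: smooth_on_cst|exact: ups_smooth|exact: smooth_on_cst].
Qed.

Lemma thomasE i j k x : Gam i j k x = Pi i j k x - U i x * (j == k)%:R - U j x * (i == k)%:R.
Proof. by rewrite /thomas; ring. Qed.

Lemma trace_Gam l x : A x -> \sum_k Gam k l k x = - (n.+2%:R * U l x).
Proof.
move=> Ax; rewrite /ups mulrC divfK ?pnatr_eq0// opprK; apply: eq_bigr => k _; exact: Gam_sym.
Qed.

(** The classical change of Ricci curvature under a projective change, here from [Pi] to [Gam] in
    dimension [n+1]; the trace of [Gam] is [-(n+2) U] and that of [Pi] vanishes. *)
Lemma ricci_thomas j l x : A x -> ricci_symbols Gam j l x =
  thomas_ricci Pi j l x - pd l (U j) x + n.+1%:R * pd j (U l) x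
  - n%:R * (\sum_k U k x * Pi j l k x) + n%:R * (U j x * U l x).
Proof.
move=> Ax; have sP := thomas_smooth; have sU := ups_smooth Gam_smooth.
rewrite /ricci_symbols big_split sumrB /=.
have -> : \sum_k pd j (Gam k l k) x = - (n.+2%:R * pd j (U l) x).
  rewrite -(pd_sum j oA Ax) => [|k _]; last exact: Gam_smooth.
  transitivity (pd j (fun y => - (n.+2%:R * U l y)) x).
    by apply: (pd_eq j oA _ Ax) => [|y Ay]; [exact: smooth_on_sum|exact: trace_Gam].
  rewrite (pdN j oA Ax); last by apply: smooth_onM => //; exact: smooth_on_cst.
  by rewrite (pdM j oA Ax)//; [rewrite (pd_cst j oA Ax) mul0r add0r|exact: smooth_on_cst].
have -> : \sum_k pd k (Gam j l k) x = \sum_k pd k (Pi j l k) x - pd l (U j) x - pd j (U l) x.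
  transitivity (\sum_k (pd k (Pi j l k) x - pd k (U j) x * (l == k)%:R - pd k (U l) x * (j == k)%:R)).
    apply: eq_bigr => k _.
    have sc (u : 'I_n.+1) (b : bool) : smooth_on A (fun y => U u y * b%:R).
      by apply: smooth_onM => //; exact: smooth_on_cst.
    have dc (u : 'I_n.+1) (b : bool) : pd k (fun y => U u y * b%:R) x = pd k (U u) x * b%:R.
      by rewrite (pdM k oA Ax)//; [rewrite (pd_cst k oA Ax) mulr0 addr0|exact: smooth_on_cst].
    transitivity (pd k (fun y => Pi j l k y - U j y * (l == k)%:R - U l y * (j == k)%:R) x).
      by apply: (pd_eq k oA _ Ax) => [|y Ay]; [exact: Gam_smooth|exact: thomasE].
    rewrite (pdB k oA Ax); [|exact: smooth_onB|exact: sc].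
    by rewrite (pdB k oA Ax)// !dc.
  by rewrite !sumrB !sum_deltal.
under [X in _ + X = _]eq_bigr => k _ do rewrite sumrB.
rewrite sumrB.
have -> : \sum_k \sum_s Gam k s k x * Gam j l s x =
    - n.+2%:R * (\sum_s U s x * Pi j l s x - 2 * (U j x * U l x)).
  rewrite exchange_big /=.
  transitivity (\sum_s - n.+2%:R * (U s x * Pi j l s x - U j x * U s x * (l == s)%:R
     - U l x * U s x * (j == s)%:R)).
    by apply: eq_bigr => s _; rewrite -mulr_suml trace_Gam// [Gam j l s x]thomasE; ring.
  by rewrite -mulr_sumr !sumrB !sum_deltal; congr (_ * _); ring.
have -> : \sum_k \sum_s Gam j s k x * Gam k l s x = 
    \sum_k \sum_s Pi j s k x * Pi k l s x - 2 * (\sum_k U k x * Pi j l k x) + (n%:R + 4) * (U j x * U l x).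
  have t1 i := thomas_trace Gam_sym i Ax.
  have t2 i : \sum_k Pi i k k x = 0.
    rewrite -[RHS](t1 i); apply: eq_bigr => k _; exact: (thomas_sym Gam_sym _ _ _ Ax).
  have := thomas_quadratic (P := fun i j k => Pi i j k x) (fun i => U i x) j l t1 t2.
  move=> /= <-; apply: eq_bigr => k _; apply: eq_bigr => s _; by rewrite -!thomasE.
rewrite /thomas_ricci -[n.+2%:R]natr1 -[n.+1%:R]natr1; ring.
Qed.

(** One factor [rho] turns [g^-1] into [sigma]. Then [sigma dU] becomes the divergence of [mu] minus
    [(d sigma) U], and each product [rho U] becomes [d rho / 2], which removes the possibly singular
    [U]. *)
Lemma scalar_formula x : A x ->
  \sum_j \sum_l invmx (g x) j l * ricci_symbols Gam j l x =
  scalar_form Pi (fun i j y => sigma g y i j) (mu g Gam) (rho g) x.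
Proof.
move=> Ax; have sU := ups_smooth Gam_smooth.
have ss := sigma_smooth g_smooth g_unit.
have sym i j := sigma_sym g_sym i j Ax.
have r0 : rho g x != 0 by rewrite gt_eqF// rho_gt0.
have dr k : pd k (rho g) x = 2 * U k x * rho g x by exact: pd_rho oA g_smooth g_unit compat k x Ax.
have e1 : \sum_j \sum_l invmx (g x) j l * ricci_symbols Gam j l x =
   rho g x * \sum_j \sum_l sigma g x j l * ricci_symbols Gam j l x.
  rewrite mulr_sumr; apply: eq_bigr => j _; rewrite mulr_sumr; apply: eq_bigr => l _.
  by rewrite /sigma mxE !mulrA mulfV// mul1r.
have dmu : \sum_j pd j (mu g Gam j) x =
   \sum_j \sum_l (pd j (fun y => sigma g y j l) x * U l x + sigma g x j l * pd j (U l) x).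
  apply: eq_bigr => j _; rewrite /mu (pd_sum j oA Ax) => [|l _]; last exact: smooth_onM.
  by apply: eq_bigr => l _; rewrite (pdM j oA Ax).
have swap : \sum_j \sum_l sigma g x j l * pd l (U j) x = \sum_j \sum_l sigma g x j l * pd j (U l) x.
  by rewrite exchange_big; apply: eq_bigr => j _; apply: eq_bigr => l _; rewrite sym.
have e2 : \sum_j \sum_l sigma g x j l * ricci_symbols Gam j l x =
   \sum_j \sum_l sigma g x j l * thomas_ricci Pi j l x +
   n%:R * (\sum_j \sum_l sigma g x j l * pd j (U l) x
     - \sum_j \sum_l \sum_k sigma g x j l * Pi j l k x * U k x
     + \sum_j mu g Gam j x * U j x).
  have -> : \sum_j mu g Gam j x * U j x = \sum_j \sum_l sigma g x j l * (U j x * U l x).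
    apply: eq_bigr => j _; rewrite /mu mulr_suml; apply: eq_bigr => l _; ring.
  transitivity (\sum_j \sum_l (sigma g x j l * thomas_ricci Pi j l x
     - sigma g x j l * pd l (U j) x + n.+1%:R * (sigma g x j l * pd j (U l) x)
     - n%:R * (\sum_k sigma g x j l * Pi j l k x * U k x) + n%:R * (sigma g x j l * (U j x * U l x)))).
    apply: eq_bigr => j _; apply: eq_bigr => l _; rewrite ricci_thomas//.
    have -> : \sum_k sigma g x j l * Pi j l k x * U k x = sigma g x j l * \sum_k U k x * Pi j l k x.
      by rewrite mulr_sumr; apply: eq_bigr => k _; ring.
    ring.
  under eq_bigr => j _ do rewrite !(sumrB, big_split) /= -!mulr_sumr.
  rewrite !(sumrB, big_split) /= -!mulr_sumr swap -[n.+1%:R]natr1; ring.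
rewrite e1 e2 /scalar_form dmu.
under [\sum_j \sum_l (_ + _)]eq_bigr => j _ do rewrite big_split /=.
rewrite big_split /=.
have -> : \sum_j mu g Gam j x * pd j (rho g) x = 2 * rho g x * \sum_j mu g Gam j x * U j x.
  by rewrite mulr_sumr; apply: eq_bigr => j _; rewrite dr; ring.
have -> : \sum_j \sum_l pd j (fun y => sigma g y j l) x * pd l (rho g) x =
    2 * rho g x * \sum_j \sum_l pd j (fun y => sigma g y j l) x * U l x.
  rewrite mulr_sumr; apply: eq_bigr => j _; rewrite mulr_sumr; apply: eq_bigr => l _.
  by rewrite dr; ring.
have -> : \sum_j \sum_l \sum_k sigma g x j l * Pi j l k x * pd k (rho g) x =
    2 * rho g x * \sum_j \sum_l \sum_k sigma g x j l * Pi j l k x * U k x.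
  rewrite mulr_sumr; apply: eq_bigr => j _; rewrite mulr_sumr; apply: eq_bigr => l _.
  by rewrite mulr_sumr; apply: eq_bigr => k _; rewrite dr; ring.
by field.
Qed.

End scalar_formula.

(** * Values on the boundary *)

Section boundary_values.
Context {R : realType} {n : nat}.
Local Notation E := 'rV[R]_n.+1.
Implicit Types (A W : set E) (f g : E -> R) (x y : E).

Lemma smooth_on_germ (I : finType) A x (F : I -> E -> R) : (forall i, smooth_on A (F i)) -> A x ->
  exists2 d, 0 < d & exists H : I -> E -> R, (forall i, smooth_open (cube x d) (H i)) /\
    forall i y, cube x d y -> A y -> H i y = F i y.
Proof.
move=> sF Ax.
have loc i : exists H : E -> R, exists2 d, 0 < d & smooth_open (cube x d) H /\
    forall y, cube x d y -> A y -> H y = F i y.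
  have [W [H [oW Wx sH HF]]] := sF i x Ax; have [d d0 hd] := open_norm_ball oW Wx.
  exists H, d => //; split=> [k|y Qy]; last by apply: HF; exact: hd.
  by apply: Ck_sub (sH k) => y; exact: hd.
have [H hH] := choice loc.
have [d d0 hd] : exists2 d, 0 < d & forall i, smooth_open (cube x d) (H i) /\
    forall y, cube x d y -> A y -> H i y = F i y.
  apply: exists_min hH => i d d' [h1 h2] _ dd'.
  have sQ : cube x d' `<=` cube x d by move=> y yd; apply: lt_le_trans yd dd'.
  by split=> [k|y /sQ]; [exact: Ck_sub (h1 k)|exact: h2].
by exists d => //; exists H; split=> [i|i y]; have [] := hd i => // _; apply.
Qed.

Lemma dense_pos A W x : rel_open A -> A x -> open W -> W x -> exists y, [/\ W y, A y & 0 < y 0 0].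
Proof.
move=> oA Ax oW Wx; have [d d0 hd] := rel_open_ball oA Ax; have [e e0 he] := open_norm_ball oW Wx.
have x0 : 0 <= x 0 0 by have [V _ AV] := oA; move: Ax; rewrite AV => -[].
pose t := Num.min d e / 2.
have m0 : 0 < Num.min d e by rewrite lt_min d0.
have t0 : 0 < t by rewrite divr_gt0.
have tm : `|x + t *: 'e_0 - x| < Num.min d e.
  rewrite addrC addKr; apply: norm_ltP => // i; rewrite !mxE eqxx /=.
  apply: (@le_lt_trans _ _ t); last by rewrite ltr_pdivrMr// ltr_pMr// ltr1n.
  by case: (i == 0); rewrite /= ?mulr1 ?mulr0 ?normr0 ?gtr0_norm// ltW.
move: tm; rewrite lt_min => /andP[td te].
have y0 : 0 < (x + t *: 'e_0) 0 0 by rewrite !mxE !eqxx mulr1 ltr_wpDl.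
by exists (x + t *: 'e_0); split=> //; [exact: he|apply: hd => //; exact: ltW].
Qed.

Lemma smooth_on_cont A f x : smooth_on A f -> A x -> exists W F, [/\ open W, W x,
  forall y, W y -> {for y, continuous F} & forall y, W y -> A y -> F y = f y].
Proof.
move=> sf Ax; have [W [F [oW Wx sF Ff]]] := sf x Ax.
by exists W, F; split=> // y Wy; have [h _] := sF 0%N; exact: h.
Qed.

Lemma smooth_on_preimage A f (D : set R) x : open D -> smooth_on A f -> A x -> D (f x) ->
  exists W, [/\ open W, W x & forall y, W y -> A y -> D (f y)].
Proof.
move=> oD sf Ax Dx; have [W [F [oW Wx cF Ff]]] := smooth_on_cont sf Ax.
have cFx := cF x Wx; have DF : D (F x) by rewrite Ff.
have /nbhs_ballP[d d0 hd] := cFx _ (open_nbhs_nbhs (conj oD DF)).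
exists (W `&` cube x d); split; first by apply: openI => //; exact: cube_open.
  by split=> //; rewrite /cube /= subrr normr0.
move=> y [Wy Qy] Ay; rewrite -Ff//; apply: hd; rewrite -ball_normE /= distrC; exact: Qy.
Qed.

(** Points with positive coordinate 0 are dense in [A], and [f] is continuous up to the boundary. *)
Lemma closed_boundary_value A f (C : set R) x : rel_open A -> smooth_on A f -> A x -> closed C ->
  (forall y, A y -> 0 < y 0 0 -> C (f y)) -> C (f x).
Proof.
move=> oA sf Ax cC hC; apply: contrapT => nC.
have oC : open (~` C) by exact: closed_openC.
have [W [oW Wx hW]] := smooth_on_preimage oC sf Ax nC.
have [y [Wy Ay y0]] := dense_pos oA Ax oW Wx.
by apply: (hW y Wy Ay); exact: hC.
Qed.

Lemma eq_boundary_value A f g x : rel_open A -> smooth_on A f -> smooth_on A g -> A x ->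
  (forall y, A y -> 0 < y 0 0 -> f y = g y) -> f x = g x.
Proof.
move=> oA sf sg Ax fg; apply/eqP; rewrite -subr_eq0; apply/eqP.
apply: (@closed_boundary_value A (fun y => f y - g y) [set t | t = 0] x oA) => //.
- exact: smooth_onB.
- by move=> y Ay y0 /=; rewrite fg// subrr.
Qed.

(* [cube p d] meets the open half-space in a convex set, on which [f] cannot change sign. *)
Lemma constant_sign p (d : R) f : smooth_open (cube p d) f ->
  (forall y, cube p d y -> 0 < y 0 0 -> f y != 0) ->
  forall x y, cube p d x -> cube p d y -> 0 < x 0 0 -> 0 < y 0 0 -> 0 < f x -> 0 < f y.
Proof.
move=> sf fn x y Qx Qy x0 y0 fx; rewrite lt_def fn//= leNgt; apply/negP => fy.
pose c (t : R) : E := x + t *: (y - x).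
have c01 t : t \in `[0, 1]%R -> cube p d (c t) /\ 0 < c t 0 0.
  rewrite in_itv /= => /andP[t0 t1].
  have e : c t = (1 - t) *: x + t *: y.
    by rewrite /c scalerBr scalerBl scale1r addrA addrAC.
  split.
    rewrite /cube /= e.
    have -> : (1 - t) *: x + t *: y - p = (1 - t) *: (x - p) + t *: (y - p).
      by apply/rowP => i; rewrite !mxE; ring.
    apply: le_lt_trans (ler_normD _ _) _; rewrite !normrZ (ger0_norm t0) ger0_norm ?subr_ge0//.
    have [->|tn] := eqVneq t 0; first by rewrite subr0 mul1r mul0r addr0.
    rewrite -[ltRHS]mul1r -[X in _ < X * d](subrK t) [ltRHS]mulrDl.
    apply: ler_ltD; first by rewrite ler_wpM2l ?subr_ge0// ltW.
    by rewrite ltr_pM2l// lt_def tn.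
  rewrite e !mxE; have [->|tn] := eqVneq t 0; first by rewrite subr0 mul1r mul0r addr0.
  apply: ltr_wpDl; first by rewrite mulr_ge0 ?subr_ge0// ltW.
  by rewrite mulr_gt0// lt_def tn.
have cc : {within `[0, 1], continuous (f \o c)}.
  apply: continuous_in_subspaceT => t; rewrite inE => /c01[Qt _].
  apply: continuous_comp; last by have [h _] := sf 0%N; exact: h.
  apply: (@cvgD _ _ _ (nbhs t)); first exact: cvg_cst.
  by apply: (@cvgZr_tmp _ _ _ (nbhs t)); exact: cvg_id.
have [||t t01 ft] := @IVT R (f \o c) 0 1 0 _ cc; first exact: ler01.
  rewrite /= /c scale0r addr0 scale1r addrC subrK.
  by rewrite ge_min le_max (ltW fx) (ltW fy) orbT.
have [Qt ct] := c01 t t01; by move: (fn _ Qt ct); rewrite -[f (c t)]/((f \o c) t) ft eqxx.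
Qed.

End boundary_values.

Section scalar_form_locality.
Context {R : realType} {n : nat}.
Local Notation E := 'rV[R]_n.+1.
Local Notation symbols := ('I_n.+1 -> 'I_n.+1 -> 'I_n.+1 -> E -> R).
Variables (A : set E) (P : symbols) (s : 'I_n.+1 -> 'I_n.+1 -> E -> R) (m : 'I_n.+1 -> E -> R)
  (r : E -> R).
Hypotheses (oA : rel_open A) (sP : forall i j k, smooth_on A (P i j k))
  (ss : forall i j, smooth_on A (s i j)) (sm : forall i, smooth_on A (m i)) (sr : smooth_on A r).

Lemma scalar_form_smooth : smooth_on A (scalar_form P s m r).
Proof.
have spd f k : smooth_on A f -> smooth_on A (pd k f) by exact: smooth_on_pd.
rewrite /scalar_form /thomas_ricci; apply: smooth_onD.
  apply: smooth_onM => //; apply: smooth_on_sum => j _; apply: smooth_on_sum => l _.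
  apply: smooth_onM => //; apply: smooth_onB; apply: smooth_on_sum => k _; first exact: spd.
  by apply: smooth_on_sum => q _; exact: smooth_onM.
apply: smooth_onM; first exact: smooth_on_cst.
apply: smooth_onB; last first.
  apply: smooth_onM; first exact: smooth_on_cst.
  do 3![apply: smooth_on_sum => ? _]; apply: smooth_onM; last exact: spd.
  exact: smooth_onM.
apply: smooth_onB; last first.
  apply: smooth_onM; first exact: smooth_on_cst.
  do 2![apply: smooth_on_sum => ? _]; apply: smooth_onM; exact: spd.
apply: smooth_onD; apply: smooth_onM => //; last 2 first.
- exact: smooth_on_cst.
- by apply: smooth_on_sum => j _; apply: smooth_onM => //; exact: spd.
by apply: smooth_on_sum => j _; exact: spd.
Qed.

Lemma scalar_form_eq (P' : symbols) s' m' r' x : A x ->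
  (forall i j k y, A y -> P i j k y = P' i j k y) -> (forall i j y, A y -> s i j y = s' i j y) ->
  (forall i y, A y -> m i y = m' i y) -> (forall y, A y -> r y = r' y) ->
  scalar_form P s m r x = scalar_form P' s' m' r' x.
Proof.
move=> Ax eP es em er.
have dr k : pd k r x = pd k r' x by exact: (pd_eq k oA sr Ax).
have dP i j k l : pd l (P i j k) x = pd l (P' i j k) x.
  by apply: (pd_eq l oA (@sP i j k) Ax) => y; exact: eP.
have ds i j l : pd l (s i j) x = pd l (s' i j) x.
  by apply: (pd_eq l oA (@ss i j) Ax) => y; exact: es.
have dm i l : pd l (m i) x = pd l (m' i) x.
  by apply: (pd_eq l oA (@sm i) Ax) => y; exact: em.
rewrite /scalar_form /thomas_ricci er//.
congr (_ * _ + _ * (_ * _ + _ * _ - _ * _ - _ * _)).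
- apply: eq_bigr => j _; apply: eq_bigr => l _; rewrite es//; congr (_ * (_ - _)).
    by apply: eq_bigr => k _.
  by apply: eq_bigr => k _; apply: eq_bigr => q _; rewrite !eP.
- by apply: eq_bigr.
- by apply: eq_bigr => j _; rewrite em// dr.
- by apply: eq_bigr => j _; apply: eq_bigr => l _; rewrite ds dr.
- by apply: eq_bigr => j _; apply: eq_bigr => l _; apply: eq_bigr => k _; rewrite es// eP// dr.
Qed.

Lemma scalar_form_zero x : r x = 0 -> (forall k, pd k r x = 0) -> scalar_form P s m r x = 0.
Proof.
move=> r0 dr; rewrite /scalar_form r0 !mul0r add0r.
rewrite big1 => [|j _]; last by rewrite dr mulr0.
rewrite big1 => [|j _]; last by rewrite big1// => l _; rewrite dr mulr0.
rewrite big1 => [|j _]; last by rewrite big1// => l _; rewrite big1// => k _; rewrite dr mulr0.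
by rewrite !mulr0 !subr0 addr0 mulr0.
Qed.

End scalar_form_locality.

(** * Extension of the metric data to the boundary *)

(** [ups] changes by [-u], which compensates the change of the symbols. The identity is pointwise in
    [x], so it eliminates the one-form of the hypothesis whatever its behaviour at the boundary. *)
Lemma thomas_proj {R : realType} {n : nat} (G G' : 'I_n.+1 -> 'I_n.+1 -> 'I_n.+1 -> 'rV[R]_n.+1 -> R)
    (u : 'I_n.+1 -> R) x :
  (forall i j k, G' i j k x = G i j k x + u i * (j == k)%:R + u j * (i == k)%:R) ->
  forall i j k, thomas G' i j k x = thomas G i j k x.
Proof.
move=> h; have e i : ups G' i x = ups G i x - u i.
  rewrite /ups; have -> : \sum_l G' i l l x = \sum_l G i l l x + n.+2%:R * u i.
    under eq_bigr => l _ do rewrite h eqxx mulr1.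
    rewrite !big_split /= sum_deltal sumr_const card_ord -[n.+2%:R]natr1 -[_ *+ _]mulr_natr; ring.
  have : n.+2%:R != 0 :> R by rewrite pnatr_eq0.
  by move: (n.+2%:R) => c c0; field.
by move=> i j k; rewrite /thomas h !e; ring.
Qed.

Section levi_civita.
Context {R : realType} {n : nat} {N : bmanifold R n}.
Local Notation E := 'rV[R]_n.+1.
Local Notation symbols := ('I_n.+1 -> 'I_n.+1 -> 'I_n.+1 -> E -> R).
Variables (g : metric N) (nabla : connection N).
Hypothesis LC : levi_civita g nabla.
Implicit Types (a b : chart_index N) (U V : set N) (p q : N).

Lemma g_smooth_inner a : msmooth (img (inner N) a) (g a).
Proof. by move=> i j; exact: (@gm_smooth _ _ _ g a i j). Qed.

Lemma inner_img_rel_open a : rel_open (img (inner N) a).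
Proof. by apply: img_rel_open; exact: inner_open. Qed.

Let gs := g_smooth_inner.
Let oI := inner_img_rel_open.
Let gsym a := @gm_sym _ _ _ g a.
Let gunit a := @gm_nondeg _ _ _ g a.
Let ns a i j k : smooth_on (img (inner N) a) (nabla a i j k) := @cn_smooth _ _ _ nabla a i j k.
Let tf a := LC.1 a.
Let compat a := LC.2 a.

(** All that is retained of the prolongation: near a boundary point, later arguments see the metric
    through these four fields, smooth up to it. *)
Record normal_form a V (P : symbols) (s : 'I_n.+1 -> 'I_n.+1 -> E -> R) (m : 'I_n.+1 -> E -> R)
    (r : E -> R) : Prop := NormalForm {
  nf_thomas_smooth : forall i j k, smooth_on (img V a) (P i j k);
  nf_sigma_smooth : forall i j, smooth_on (img V a) (s i j);
  nf_mu_smooth : forall i, smooth_on (img V a) (m i);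
  nf_rho_smooth : smooth_on (img V a) r;
  nf_thomas : forall x i j k, img (V `&` inner N) a x -> P i j k x = thomas (nabla a) i j k x;
  nf_sigma : forall x i j, img (V `&` inner N) a x -> s i j x = sigma (g a) x i j;
  nf_mu : forall x i, img (V `&` inner N) a x -> m i x = mu (g a) (nabla a) i x;
  nf_rho : forall x, img (V `&` inner N) a x -> r x = rho (g a) x }.

Lemma local_normal_form p a : (0 < n)%N -> projective_structure_extends nabla ->
  boundary N p -> dom (chart a) p -> exists V P s m r,
  [/\ open V, V p, V `<=` dom (chart a) & normal_form a V P s m r].
Proof.
move=> n0 pe bp ap; have x00 := boundary_coord bp ap.
have [U [oU Up [Ups ext]]] := pe p bp.
have [V0 [Gh [oV0 V0p V0U sGh hGh]]] := local_christoffel oU Up ap ext.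
have sP0 i j k : smooth_on (img V0 a) (thomas Gh i j k) by exact: thomas_smooth.
have eP0 x i j k : img (V0 `&` inner N) a x -> thomas Gh i j k x = thomas (nabla a) i j k x.
  by move=> Ix; apply: (@thomas_proj _ _ _ _ (fun i => Ups a x 0 i)) => *; exact: hGh.
have V0x := imgI_pred V0p ap.
(* The trace-free symbols are extended beyond the half-space to a full cube, since the differential
   equation is solved across the boundary. *)
have [d1 d10 [H [sH eH]]] := @smooth_on_germ R n _ (img V0 a) (chart a p)
  (fun t : 'I_n.+1 * 'I_n.+1 * 'I_n.+1 => thomas Gh t.1.1 t.1.2 t.2)
  (fun t => sP0 t.1.1 t.1.2 t.2) V0x.
have [d2 d20 hd2] := rel_open_ball (img_rel_open a oV0) V0x.
set x0 := chart a p in x00 V0x sH eH hd2 *.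
pose d := Num.min d1 d2.
have d0 : 0 < d by rewrite lt_min d10.
have Qd1 : cube x0 d `<=` cube x0 d1 by move=> y; rewrite /cube /= lt_min => /andP[].
have QV y : cube x0 d y -> 0 <= y 0 0 -> img V0 a y.
  by rewrite /cube /= lt_min => /andP[_ h] y0; exact: hd2.
have QI y : cube x0 d y -> 0 < y 0 0 -> img (V0 `&` inner N) a y.
  by move=> Qy y0; rewrite img_inner; split=> //; apply: QV => //; exact: ltW.
have QI' y : cube x0 d y /\ 0 < y 0 0 -> img (inner N) a y.
  by move=> [Qy y0]; have [q [[_ iq] aq] <-] := QI y Qy y0; exists q.
pose P i j k := H (i, j, k).
have eP y i j k : cube x0 d y -> 0 < y 0 0 -> P i j k y = thomas (nabla a) i j k y.
  move=> Qy y0; rewrite /P eH/=; last 2 first.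
  - exact: Qd1.
  - by apply: QV => //; exact: ltW.
  by apply: eP0; exact: QI.
have [|d' /andP[d'0 d'd] [Y [sY eY]]] := @metrizability_extension R n x0 d
  (fun i j y => sigma (g a) y i j) (mu (g a) (nabla a)) P n0 d0 x00
  (fun i j k l => Ck_sub Qd1 (sH (i, j, k) l))
  (fun i j => smooth_on_sub QI' (sigma_smooth (@gs a) (@gunit a) i j))
  (fun j => smooth_on_sub QI' (mu_smooth (@gs a) (@gunit a) (@ns a) j)) _.
  move=> k i j x [Qx xp] /=.
  rewrite (sigma_metrizability (oI a) (@gs a) (@gsym a) (@gunit a) (@compat a) k i j (QI' x (conj Qx xp))).
  by congr (_ + (- _ - _)); apply: eq_bigr => l _; rewrite eP.
pose V := dom (chart a) `&` chart a @^-1` cube x0 d'.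
have oV : open V by apply: open_chart_preimage; exact: cube_open.
have Qd' : cube x0 d' `<=` cube x0 d by move=> y yd; apply: lt_le_trans yd d'd.
have Qx0 : cube x0 d' x0 by rewrite /cube /= subrr normr0.
have VQ y : img V a y -> cube x0 d' y by move=> [q [[_ Qq] _] <-].
have VV0 y : img V a y -> img V0 a y.
  by move=> h; apply: QV; [exact: Qd' (VQ y h)|case: h => q [_ aq] <-; exact: coord_ge0].
have VI y : img (V `&` inner N) a y -> cube x0 d' y /\ 0 < y 0 0.
  by rewrite img_inner => -[/VQ].
have VI' y : img (V `&` inner N) a y -> img (inner N) a y.
  by move=> [q [[_ iq] aq] <-]; exists q.
have Vx0 : img V a x0 by exists p.
have sYV i j : smooth_on (img V a) (Y i j).
  exact: (smooth_on_sub VQ (smooth_open_on (@cube_open R n x0 d') (sY i j))).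
have sPV i j k : smooth_on (img V a) (P i j k).
  by apply: (smooth_on_eq (f := thomas Gh i j k)) (smooth_on_sub VV0 (sP0 i j k)) => y Vy;
    rewrite /P eH//=; [exact: Qd1 (Qd' _ (VQ _ Vy))|exact: VV0].
have oVa := img_rel_open a oV; have oVi : rel_open (img (V `&` inner N) a).
  by apply: img_rel_open; apply: openI => //; exact: inner_open.
pose D y := \det (\matrix_(i, j) Y i j y).
have ePV x i j k : img (V `&` inner N) a x -> P i j k x = thomas (nabla a) i j k x.
  by move=> /VI[h1 h2]; rewrite eP//; exact: Qd'.
have eYV x i j : img (V `&` inner N) a x -> Y i j x = sigma (g a) x i j.
  by move=> /VI[h1 h2]; rewrite eY.
have D2 y : cube x0 d' y -> 0 < y 0 0 -> D y ^+ 2 = rho (g a) y ^+ 2.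
  move=> Qy y0; rewrite -(det_sigma2 (@gunit a)); last by apply: QI'; split=> //; exact: Qd'.
  by congr (\det _ ^+ 2); apply/matrixP => i j; rewrite mxE eY.
have sD : smooth_on (cube x0 d') D.
  apply: smooth_on_det => i j; apply: (smooth_on_eq (f := Y i j)) => [y _|]; first by rewrite mxE.
  exact: smooth_open_on (@cube_open R n x0 d') (sY i j).
(* An interior reference point decides which of [D] and [- D] is the positive root [rho]. *)
have [y1 [Qy1 _ y10]] := dense_pos oVa Vx0 (@cube_open R n x0 d') Qx0.
have sign f : smooth_on (cube x0 d') f ->
    (forall y, cube x0 d' y -> 0 < y 0 0 -> f y ^+ 2 = rho (g a) y ^+ 2) -> 0 < f y1 ->
    forall y, cube x0 d' y -> 0 < y 0 0 -> f y = rho (g a) y.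
  move=> sf f2 f1 y Qy y0.
  have f0 z : cube x0 d' z -> 0 < z 0 0 -> f z != 0.
    move=> Qz z0; apply/eqP => h; have := f2 z Qz z0; rewrite h expr0n /= => /esym/eqP.
    by rewrite expf_eq0 /= gt_eqF ?rho_gt0.
  have fy := constant_sign (smooth_on_open (@cube_open R n x0 d') sf) f0 Qy1 Qy y10 y0 f1.
  by apply: (pexpIrn (n := 2)); rewrite ?nnegrE ?ltW ?rho_gt0// f2.
have [r [sr er]] : exists r, smooth_on (cube x0 d') r /\
    forall y, cube x0 d' y -> 0 < y 0 0 -> r y = rho (g a) y.
  have [D1|] := ltP 0 (D y1); first by exists D; split=> //; exact: sign.
  rewrite le_eqVlt => /orP[/eqP D1|D1].
    have := D2 y1 Qy1 y10; rewrite D1 expr0n /= => /esym/eqP.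
    by rewrite expf_eq0 /= gt_eqF ?rho_gt0.
  have sN : smooth_on (cube x0 d') (fun y => - D y) by exact: smooth_onN.
  exists (fun y => - D y); split=> //; apply: sign => //; last by rewrite oppr_gt0.
  by move=> y Qy y0; rewrite sqrrN D2.
(* The metrizability equation with [k = i = j], solved for [mu j]. *)
pose m j y := 2^-1 * (pd j (Y j j) y + (\sum_l Y j l y * P j l j y) + \sum_l P j l j y * Y l j y).
exists V, P, Y, m, r; split=> //.
  by move=> q [].
split=> //.
- move=> j; apply: smooth_onM; first exact: smooth_on_cst.
  apply: smooth_onD; first (apply: smooth_onD; first exact: smooth_on_pd);
    by apply: smooth_on_sum => l _; exact: smooth_onM.
- exact: (smooth_on_sub VQ sr).
- move=> x j Vx.
  have Ax : img (inner N) a x by exact: VI'.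
  have e1 : pd j (Y j j) x = pd j (fun y => sigma (g a) y j j) x.
    apply: (pd_eq j oVi _ Vx) => [|y Vy]; last exact: eYV.
    by apply: (smooth_on_sub _ (sYV j j)); apply: img_sub => q [].
  rewrite /m e1 (sigma_metrizability (oI a) (@gs a) (@gsym a) (@gunit a) (@compat a) j j j Ax) eqxx.
  have -> : \sum_l Y j l x * P j l j x = \sum_l sigma (g a) x j l * thomas (nabla a) j l j x.
    by apply: eq_bigr => l _; rewrite eYV// ePV.
  have -> : \sum_l P j l j x * Y l j x = \sum_l thomas (nabla a) j l j x * sigma (g a) x l j.
    by apply: eq_bigr => l _; rewrite eYV// ePV.
  by rewrite !mulr1n; field.
- by move=> x /VI[h1 h2]; rewrite er.
Qed.

Lemma scalar_curvature_form a x : img (inner N) a x -> scalar_curvature g nabla a x =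
  scalar_form (thomas (nabla a)) (fun i j y => sigma (g a) y i j) (mu (g a) (nabla a)) (rho (g a)) x.
Proof.
exact: (scalar_formula (oI a) (@gs a) (@gsym a) (@gunit a) (@ns a) (@tf a) (@compat a)).
Qed.

Lemma scalar_curvature_smooth a : smooth_on (img (inner N) a) (scalar_curvature g nabla a).
Proof.
apply: (smooth_on_eq (fun x Ax => esym (scalar_curvature_form Ax))).
apply: (scalar_form_smooth (oI a)).
- exact: (thomas_smooth (@ns a)).
- exact: (sigma_smooth (@gs a) (@gunit a)).
- exact: (mu_smooth (@gs a) (@gunit a) (@ns a)).
- exact: (rho_smooth (@gs a) (@gunit a)).
Qed.

(** [riemann] is antisymmetric in its first two indices, which here take a single value. *)
Lemma scalar_curvature_dim1 a x : n = 0%N -> scalar_curvature g nabla a x = 0.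
Proof.
move=> n0; have o (i j : 'I_n.+1) : i = j.
  have k0 (k : 'I_n.+1) : (k : nat) = 0%N.
    by apply/eqP; rewrite -leqn0 -[X in (_ <= X)%N]n0 -ltnS ltn_ord.
  by apply: val_inj; rewrite /= !k0.
rewrite /scalar_curvature big1// => j _; rewrite big1// => l _.
rewrite /ricci big1 ?mulr0// => k _; rewrite /riemann (o k j) subrr add0r.
by rewrite big1// => q _; rewrite subrr.
Qed.

Section normal_form_consequences.
Variables (a : chart_index N) (V : set N) (P : symbols) (s : 'I_n.+1 -> 'I_n.+1 -> E -> R)
  (m : 'I_n.+1 -> E -> R) (r : E -> R).
Hypotheses (oV : open V) (nf : normal_form a V P s m r).

Let VI x : img (V `&` inner N) a x -> img (inner N) a x.
Proof. by move=> [q [[_ iq] aq] <-]; exists q. Qed.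

Let VV x : img (V `&` inner N) a x -> img V a x.
Proof. by move=> [q [[Vq _] aq] <-]; exists q. Qed.

Let oVi : rel_open (img (V `&` inner N) a).
Proof. by apply: img_rel_open; apply: openI => //; exact: inner_open. Qed.

Lemma nf_scalar_smooth : smooth_on (img V a) (scalar_form P s m r).
Proof.
by case: nf => *; apply: scalar_form_smooth => //; exact: img_rel_open.
Qed.

Lemma nf_scalar x : img (V `&` inner N) a x -> scalar_form P s m r x = scalar_curvature g nabla a x.
Proof.
move=> Vx; rewrite scalar_curvature_form; last exact: VI.
case: nf => sP ss sm sr eP es em er.
apply: (scalar_form_eq oVi) => //.
- move=> i j k; exact: (smooth_on_sub VV (sP i j k)).
- move=> i j; exact: (smooth_on_sub VV (ss i j)).
- move=> i; exact: (smooth_on_sub VV (sm i)).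
- exact: (smooth_on_sub VV sr).
- by move=> i j k y; exact: eP.
- by move=> i j y; exact: es.
- by move=> i y; exact: em.
Qed.

Lemma nf_pd_rho x k : img (V `&` inner N) a x -> pd k r x = 2 * ups (nabla a) k x * r x.
Proof.
move=> Vx; case: nf => sP ss sm sr eP es em er.
rewrite er// -(pd_rho (oI a) (@gs a) (@gunit a) (@compat a) k (VI Vx)).
exact: (pd_eq k oVi (smooth_on_sub VV sr) Vx er).
Qed.

Lemma nf_rho_gt0 x : img (V `&` inner N) a x -> 0 < r x.
Proof. by move=> Vx; rewrite (nf_rho nf)// rho_gt0. Qed.

Lemma nf_ups x k : img (V `&` inner N) a x -> (2 * r x)^-1 * pd k r x = ups (nabla a) k x.
Proof.
move=> Vx; have r0 : r x != 0 by rewrite gt_eqF// nf_rho_gt0.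
by rewrite nf_pd_rho//; field.
Qed.

End normal_form_consequences.

(** [V] may or may not meet the boundary, so that a single gluing argument covers all of [N]. *)
Definition local_scalar a V (h : E -> R) := [/\ open V, V `<=` dom (chart a), smooth_on (img V a) h &
  forall x, img (V `&` inner N) a x -> h x = scalar_curvature g nabla a x].

Lemma local_scalar_exists p a : projective_structure_extends nabla -> dom (chart a) p ->
  exists V h, V p /\ local_scalar a V h.
Proof.
move=> pe ap; have [bp|ip] := pselect (boundary N p); last first.
  exists (inner N `&` dom (chart a)), (scalar_curvature g nabla a); split=> //; split.
  - by apply: openI; [exact: inner_open|exact: dom_open].
  - by move=> q [].
  - apply: (smooth_on_sub _ (@scalar_curvature_smooth a)); by apply: img_sub => q [].
  - by [].
have [n0|n0] := posnP n.
  exists (dom (chart a)), (fun=> 0); split=> //; split=> //; first exact: dom_open.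
    exact: smooth_on_cst.
  by move=> x _; rewrite scalar_curvature_dim1.
have [V [P [s [m [r [oV Vp Va nf]]]]]] := local_normal_form n0 pe bp ap.
exists V, (scalar_form P s m r); split=> //; split=> //; first exact: nf_scalar_smooth.
by move=> x Vx; exact: (nf_scalar oV nf).
Qed.

(** Inside, both functions are the scalar curvature, which does not depend on the chart; by density
    they agree at boundary points too. *)
Lemma local_scalar_eq a b V V' h h' q : local_scalar a V h -> local_scalar b V' h' -> V q -> V' q ->
  h (chart a q) = h' (chart b q).
Proof.
move=> [oV Va sh eh] [oV' Vb sh' eh'] Vq V'q.
have aq := Va q Vq; have bq := Vb q V'q.
pose A := img ((V `&` V') `&` dom (chart b)) a.
have oA : rel_open A.
  by apply: img_rel_open; apply: openI; [exact: openI|exact: dom_open].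
rewrite -(transition_coord b aq).
apply: (@eq_boundary_value _ _ A h (fun x => h' (transition (chart a) (chart b) x)) _ oA).
- by apply: (smooth_on_sub _ sh); apply: img_sub => z [[]].
- apply: (smooth_on_transition (U := V `&` V')); apply: (smooth_on_sub _ sh').
  by apply: img_sub => z [].
- by exists q.
- move=> y [z [[[Vz V'z] bz] az] <-] z0; rewrite transition_coord//.
  have iz : inner N z by move=> bdz; move: z0; rewrite (boundary_coord bdz az) ltxx.
  rewrite eh; last by exists z.
  by rewrite eh'; [exact: scalar_curvature_chart|exists z].
Qed.

(** A value is chosen at each point from some local extension; [local_scalar_eq] makes it
    independent of the choice, so near every point [S] coincides with one smooth local extension. *)
Theorem scalar_extension_exists : projective_structure_extends nabla ->
  exists S : N -> R, scalar_curvature_extension g nabla S.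
Proof.
move=> pe.
have loc q : exists v : R, exists a V h, [/\ V q, local_scalar a V h & v = h (chart a q)].
  have [a aq] := chart_cover q; have [V [h [Vq lh]]] := local_scalar_exists pe aq.
  by exists (h (chart a q)), a, V, h.
have [S hS] := choice loc.
have Sh a V h q : local_scalar a V h -> V q -> S q = h (chart a q).
  move=> lh Vq; have [b [V' [h' [V'q lh' ->]]]] := hS q; exact: local_scalar_eq lh' lh V'q Vq.
have inS a q V h : V q -> local_scalar a V h -> in_chart S a (chart a q) = h (chart a q).
  by move=> Vq lh; have [_ Va _ _] := lh; rewrite /in_chart point_atK ?(Sh a V h)//; exact: Va.
exists S; split.
  move=> a; apply: smooth_on_local => x [q [_ aq] <-].
  have [V [h [Vq lh]]] := local_scalar_exists pe aq.
  have [oV Va sh eh] := lh.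
  have [W oW VW] := img_rel_open a oV.
  exists W; split=> //; first by have := imgI_pred Vq aq; rewrite VW => -[].
  have AV : img [set: N] a `&` W `<=` img V a.
    by move=> y [[z [_ az] <-] Wz]; rewrite VW; split=> //; exact: coord_ge0.
  apply: (smooth_on_eq (f := h)); last exact: (smooth_on_sub AV sh).
  by move=> y /AV[z [Vz az] <-]; rewrite (inS a z V h).
move=> a x [q [iq aq] <-]; have [V [h [Vq lh]]] := local_scalar_exists pe aq.
rewrite (inS a q V h)//; have [_ _ _ ->] := lh => //; by exists q.
Qed.

End levi_civita.

(** * Projective compactness *)

Section differential.
Context {R : realType} {n : nat} {N : bmanifold R n}.
Local Notation E := 'rV[R]_n.+1.
Implicit Types (a b : chart_index N) (U : set N) (p : N).

Lemma smooth_fun_of_chart U a (r : E -> R) : U `<=` dom (chart a) -> smooth_on (img U a) r ->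
  smooth_fun U (fun q => r (chart a q)).
Proof.
move=> Ua sr b; have := @smooth_on_transition _ _ N U b a r sr.
by rewrite (_ : U `&` dom (chart a) = U)//; apply/setIidPl.
Qed.

Lemma in_chart_transition (f : N -> R) a b p : dom (chart a) p -> dom (chart b) p ->
  in_chart f a (chart a p) = in_chart f b (transition (chart a) (chart b) (chart a p)).
Proof. by move=> ap bp; rewrite /in_chart transition_coord// !point_atK. Qed.

Lemma differential_law U (f : N -> R) a b p : open U -> smooth_fun U f -> U p ->
  dom (chart a) p -> dom (chart b) p ->
  differential f a (chart a p) = differential f b (chart b p) *m (jac a b (chart a p))^T.
Proof.
move=> oU sf Up ap bp; apply/rowP => i; rewrite [LHS]mxE [RHS]mxE.
have oA : rel_open (img (U `&` dom (chart b)) a).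
  by apply: img_rel_open; apply: openI => //; exact: dom_open.
transitivity (pd i (fun x => in_chart f b (transition (chart a) (chart b) x)) (chart a p)).
  apply: (pd_eq i oA).
  - by apply: (smooth_on_sub _ (sf a)); apply: img_sub => q [].
  - by exists p.
  - by move=> y [q [[_ bq] aq] <-]; exact: in_chart_transition.
rewrite (pd_transition i oU Up ap bp (sf b)); apply: eq_bigr => j _.
by rewrite [X in _ = X * _]mxE [X in _ = _ * X]mxE mulrC.
Qed.

End differential.

Section compactness.
Context {R : realType} {n : nat} {N : bmanifold R n}.
Local Notation E := 'rV[R]_n.+1.
Local Notation symbols := ('I_n.+1 -> 'I_n.+1 -> 'I_n.+1 -> E -> R).
Variables (g : metric N) (nabla : connection N).
Hypotheses (LC : levi_civita g nabla)
  (not_ext : forall (p : N) (U : set N), boundary N p -> open U -> U p -> ~ connection_extends nabla U)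
  (curv : (exists2 c : R, 0 < c &
       forall a x, img (inner N) a x -> c <= `|scalar_curvature g nabla a x|)
    \/
    (exists2 S : N -> R, scalar_curvature_extension g nabla S &
       forall p, boundary N p -> S p <> 0)).

(** Unifies the two forms of the curvature hypothesis: a lower bound on the absolute value is a
    closed condition and passes to the boundary, and a given extension has the same boundary values
    as any local one. *)
Lemma local_scalar_neq0 a V (h : E -> R) p : local_scalar g nabla a V h -> V p -> boundary N p ->
  h (chart a p) <> 0.
Proof.
move=> [oV Va sh eh] Vp bp; have oA := img_rel_open a oV; have ap := Va p Vp.
have Ax := imgI_pred Vp ap.
have pos y : img V a y -> 0 < y 0 0 -> img (V `&` inner N) a y by move=> *; rewrite img_inner; split.
case: curv => [[c c0 hc]|[S [sS eS] S0]].
  have : c <= `|h (chart a p)|.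
    apply: (@closed_boundary_value _ _ (img V a) h [set t | c <= `|t|] _ oA sh Ax).
      apply: (@preimage_closed _ _ (fun t : R => `|t|) [set t | c <= t]); last exact: closed_ge.
      by move=> t _; exact: norm_continuous.
    move=> y Vy y0 /=; have Iy := pos y Vy y0; rewrite eh//; apply: hc.
    by case: Iy => q [[_ iq] aq] <-; exists q.
  by move=> + h0; rewrite h0 normr0 leNgt c0.
have <- : in_chart S a (chart a p) = h (chart a p).
  apply: (@eq_boundary_value _ _ (img V a) (in_chart S a) h _ oA _ sh Ax).
    by apply: (smooth_on_sub _ (sS a)); apply: img_sub.
  move=> y Vy y0; have Iy := pos y Vy y0; rewrite eh// eS//.
  by case: Iy => q [[_ iq] aq] <-; exists q.
by rewrite /in_chart point_atK//; exact: S0.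
Qed.

(** In dimension one the zero function would be a local extension, contrary to
    [local_scalar_neq0]. *)
Lemma dim_gt0 p : boundary N p -> (0 < n)%N.
Proof.
move=> bp; rewrite lt0n; apply/eqP => n0; have [a ap] := chart_cover p.
apply: (@local_scalar_neq0 a (dom (chart a)) (fun=> 0) p) => //; split=> //.
- exact: dom_open.
- exact: smooth_on_cst.
- by move=> x _; rewrite scalar_curvature_dim1.
Qed.

Section local.
Variables (a : chart_index N) (V : set N) (P : symbols) (s : 'I_n.+1 -> 'I_n.+1 -> E -> R)
  (m : 'I_n.+1 -> E -> R) (r : E -> R).
Hypotheses (oV : open V) (Va : V `<=` dom (chart a)) (nf : normal_form g nabla a V P s m r).

Let oA := img_rel_open a oV.

(* Otherwise [dr / 2r] is smooth near [p], and [nabla] is recovered from it and [P]. *)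
Lemma nf_rho_boundary p : V p -> boundary N p -> r (chart a p) = 0.
Proof.
move=> Vp bp; apply: contrapT => /eqP r0; have Ax := imgI_pred Vp (Va Vp).
have sr := nf_rho_smooth nf; have sP := nf_thomas_smooth nf.
have oD : open [set t : R | t != 0] by exact: open_neq.
have [W [oW Wx hW]] := smooth_on_preimage oD sr Ax r0.
pose V' := V `&` (dom (chart a) `&` chart a @^-1` W).
have oV' : open V' by apply: openI => //; exact: open_chart_preimage.
have V'p : V' p by split=> //; split=> //; exact: Va.
apply: (not_ext bp oV' V'p).
have VV' x : img V' a x -> img V a x by apply: img_sub => q [].
have r'0 x : img V' a x -> r x != 0.
  by rewrite /V' img_chart_preimage => -[Vx Wx']; exact: hW.
pose u i x := (2 * r x)^-1 * pd i r x.
have su i : smooth_on (img V' a) (u i).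
  apply: smooth_onM; last exact: (smooth_on_sub VV' (smooth_on_pd i oA sr)).
  apply: smooth_onV; first by move=> x Vx; rewrite mulf_neq0 ?pnatr_eq0// r'0.
  by apply: smooth_onM; [exact: smooth_on_cst|exact: (smooth_on_sub VV' sr)].
pose G i j k x := P i j k x - u i x * (j == k)%:R - u j x * (i == k)%:R.
(* With the zero one-form, extension of the projective structure is extension of [nabla] itself,
   which [not_ext] forbids. *)
have ext : extends_with nabla V' (fun _ _ => 0).
  apply: (@extends_with_of_chart _ _ _ nabla _ V' a G oV').
  - by move=> q [/Va].
  - by move=> b c q _ _ _; rewrite mul0mx.
  - move=> i j k; apply: smooth_onB; first apply: smooth_onB.
    + exact: (smooth_on_sub VV' (sP i j k)).
    + by apply: smooth_onM => //; exact: smooth_on_cst.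
    + by apply: smooth_onM => //; exact: smooth_on_cst.
  - move=> x i j k V'x; have Vx : img (V `&` inner N) a x.
      by case: V'x => q [[[Vq _] iq] aq] <-; exists q.
    rewrite /G /u !(nf_ups LC oV nf _ Vx) (nf_thomas nf)// [in RHS]thomasE !mxE; ring.
move=> xi eta; have [zeta hz] := ext xi eta; exists zeta => b x Vx.
rewrite hz// /proj_covariant /pairing !big1 => [|i _|i _]; last 2 first.
- by rewrite mxE mul0r.
- by rewrite mxE mul0r.
by rewrite !scale0r !addr0.
Qed.

Lemma nf_differential_boundary p : V p -> boundary N p -> exists k, pd k r (chart a p) != 0.
Proof.
move=> Vp bp; apply: contrapT => nk.
have dr k : pd k r (chart a p) = 0.
  by apply/eqP; apply: contrapT => /negP h; apply: nk; exists k.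
have lh : local_scalar g nabla a V (scalar_form P s m r).
  by split=> //; [exact: (nf_scalar_smooth oV nf)|move=> x Vx; exact: (nf_scalar LC oV nf)].
by apply: (local_scalar_neq0 lh Vp bp); exact: (scalar_form_zero P s m (nf_rho_boundary Vp bp) dr).
Qed.

Let rV (q : N) := r (chart a q).

Lemma nf_smooth_fun : smooth_fun V rV.
Proof. by apply: smooth_fun_of_chart => //; exact: nf_rho_smooth nf. Qed.

Lemma nf_pd_in_chart k x : img V a x -> pd k (in_chart rV a) x = pd k r x.
Proof.
move=> Vx; have sf : smooth_on (img V a) (in_chart rV a) by exact: nf_smooth_fun.
apply: (pd_eq k oA sf Vx) => y [q [Vq aq] <-]; by rewrite /in_chart /rV point_atK.
Qed.

Lemma nf_defining_function : local_defining_function V rV.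
Proof.
have rpos p : V p -> inner N p -> 0 < rV p.
  by move=> Vp ip; apply: (nf_rho_gt0 nf); exists p => //; split=> //; exact: Va.
split.
- exact: nf_smooth_fun.
- move=> p Vp; have [bp|ip] := pselect (boundary N p); last by rewrite ltW// rpos.
  by rewrite /rV nf_rho_boundary.
- move=> p Vp; split=> [r0|bp]; last exact: nf_rho_boundary.
  by apply: contrapT => ip; have := rpos p Vp ip; rewrite r0 ltxx.
(* Nonvanishing of the differential is known in chart [a] and transported to [b] by the
   transformation law of covectors. *)
- move=> b x [p [[Vp bdp] bp] <-] d0; have ap := Va Vp.
  have [k] := nf_differential_boundary Vp bdp.
  have := differential_law oV nf_smooth_fun Vp ap bp.
  rewrite d0 mul0mx => /rowP/(_ k); rewrite !mxE => e.
  by rewrite -nf_pd_in_chart ?e ?eqxx//; exact: imgI_pred.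
Qed.

Lemma nf_projectively_compact :
  extends_with nabla V (fun b x => (2 * in_chart rV b x)^-1 *: differential rV b x).
Proof.
apply: (@extends_with_of_chart _ _ _ nabla _ V a P oV Va).
- move=> b c p [Vp _] bp cp; rewrite -scalemxAl (differential_law oV nf_smooth_fun Vp bp cp).
  by rewrite (in_chart_transition rV bp cp) transition_coord.
- exact: nf_thomas_smooth nf.
- move=> x i j k Vx; rewrite (nf_thomas nf)// /thomas.
  have e l : ((2 * in_chart rV a x)^-1 *: differential rV a x) 0 l = ups (nabla a) l x.
    have Vx' : img V a x by case: Vx => q [[Vq _] aq] <-; exists q.
    rewrite -(nf_ups LC oV nf _ Vx) mxE; congr (_ ^-1 * _).
      by case: Vx' => q [Vq aq] <-; rewrite /in_chart /rV point_atK.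
    by rewrite mxE nf_pd_in_chart.
  by rewrite !e.
Qed.

End local.
End compactness.

Theorem theorem5 (R : realType) (n : nat) (N : bmanifold R n)
    (g : metric N) (nabla : connection N)
    (LC : levi_civita g nabla)
    (proj_ext : projective_structure_extends nabla) :
  (exists S : N -> R, scalar_curvature_extension g nabla S) /\
  ((forall (p : N) (U : set N), boundary N p -> open U -> U p ->
      ~ connection_extends nabla U) ->
   ((exists2 c : R, 0 < c &
       forall a x, img (inner N) a x -> c <= `|scalar_curvature g nabla a x|)
    \/
    (exists2 S : N -> R, scalar_curvature_extension g nabla S &
       forall p, boundary N p -> S p <> 0)) ->
   metric_projectively_compact 2 g).
Proof.
split; first exact: scalar_extension_exists.
move=> not_ext curv; exists nabla; split=> // p bp.
have [a ap] := chart_cover p.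
have [V [P [s [m [r [oV Vp Va nf]]]]]] :=
  local_normal_form LC (dim_gt0 curv bp) proj_ext bp ap.
exists V, (fun q => r (chart a q)); split=> //.
- exact: (nf_defining_function LC not_ext curv oV Va nf).
- exact: (nf_projectively_compact LC oV Va nf).
Qed.
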